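(* Let $d\ge 2$, $\mu>-1$ and $s\in\mathbb{N}_0$. There is a constant $c>0$, depending only on $\mu$, $d$ and $s$, such that for every $f\in W_2^{2s+1}(\varpi_\mu,\mathbb{B}^d)$ and every integer $n\ge 2s+1$, $$E_n(f)_\mu\le\frac{c}{n^{2s+1}}\left[\sum_{i=1}^dE_{n-2s-1}(\partial_i\Delta^sf)_{\mu+2s+1}+\sum_{1\le i<j\le d}E_n(D_{i,j}\Delta_0^sf)_\mu\right].$$
   Context: $\mathbb{B}^d=\{x\in\mathbb{R}^d:\|x\|\le 1\}$ is the unit ball, $\varpi_\mu(x)=(1-\|x\|^2)^\mu$ for $\mu>-1$, and $\|f\|_\mu=\big(b_\mu\int_{\mathbb{B}^d}|f(x)|^2\varpi_\mu(x)\,dx\big)^{1/2}$ (with values in $[0,\infty]$), where $b_\mu=1/\int_{\mathbb{B}^d}\varpi_\mu(x)\,dx$. $\Pi_n^d$ is the space of polynomials of degree at most $n$ in $d$ variables, and $E_n(f)_\mu=\inf_{p\in\Pi_n^d}\|f-p\|_\mu$. For $s\in\mathbb{N}$, $W_2^s(\varpi_\mu,\mathbb{B}^d)$ is the Sobolev space of all $f\in L^2(\varpi_\mu,\mathbb{B}^d)$ with $\partial^{\mathbf m}f\in L^2(\varpi_{\mu+|\mathbf m|},\mathbb{B}^d)$ for all $\mathbf m\in\mathbb{N}_0^d$ with $|\mathbf m|=m_1+\dots+m_d\le s$, where $\partial^{\mathbf m}=\partial_1^{m_1}\cdots\partial_d^{m_d}$. $\partial_i$ is the $i$th partial derivative,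 $\Delta=\partial_1^2+\dots+\partial_d^2$, $D_{i,j}=x_i\partial_j-x_j\partial_i$ for $1\le i<j\le d$, and $\Delta_0$ is the Laplace-Beltrami operator on the unit sphere $\mathbb{S}^{d-1}$ acting on functions on the ball, i.e. $\Delta_0=\sum_{1\le i<j\le d}D_{i,j}^2$. *)

(* Defs.v *)
From HB Require Import structures.
From mathcomp Require Import all_boot all_order all_algebra.
From mathcomp Require Import all_classical all_reals all_analysis.
(* The notations of mpoly clash with those of MathComp-Analysis. *)
From mathcomp Require mpoly.
Import (canonicals, coercions) mpoly.

Set Implicit Arguments.
Unset Strict Implicit.
Unset Printing Implicit Defensive.

Import Order.TTheory GRing.Theory Num.Theory.
Import numFieldNormedType.Exports.

Local Open Scope classical_set_scope.
Local Open Scope ring_scope.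

Definition rV_display : measure_display.
Proof. exact: default_measure_display. Qed.

Section rV_measurable.
Context {R : realType} {n : nat}.

Definition rV_coord (i : 'I_n) (x : 'rV[R]_n) : R := x ord0 i.

Let rV_set0 : g_sigma_preimage rV_coord set0.
Proof. exact: sigma_algebra0. Qed.

Let rV_setC A : g_sigma_preimage rV_coord A -> g_sigma_preimage rV_coord (~` A).
Proof. exact: sigma_algebraC. Qed.

Let rV_bigcup (F : (set 'rV[R]_n)^nat) :
  (forall i, g_sigma_preimage rV_coord (F i)) ->
  g_sigma_preimage rV_coord (\bigcup_i (F i)).
Proof. exact: sigma_algebra_bigcup. Qed.

(* The product sigma-algebra on R^n, which is its Borel sigma-algebra. *)
HB.instance Definition _ := @isMeasurable.Build rV_display 'rV[R]_n
  (g_sigma_preimage rV_coord) rV_set0 rV_setC rV_bigcup.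

Lemma measurable_rV_coord (i : 'I_n) : measurable_fun [set: 'rV[R]_n] (rV_coord i).
Proof.
move=> _ Y mY; rewrite setTI; apply: sub_sigma_algebra => /=.
rewrite -bigcup_seq/=; exists i => /=; first by rewrite mem_index_enum.
by exists Y => //; rewrite setTI.
Qed.

Lemma measurable_fun_rVP d (T : measurableType d) (f : T -> 'rV[R]_n) :
  (forall i, measurable_fun [set: T] (rV_coord i \o f)) ->
  measurable_fun [set: T] f.
Proof.
move=> mf; have prefS : g_sigma_preimage (fun i => rV_coord i \o f) `<=` measurable.
  apply: smallest_sub; first exact: sigma_algebra_measurable.
  rewrite -bigcup_seq; apply: bigcup_sub => i _.
  by move=> A [B mB <-]; exact: mf.
by move=> _ A mA; apply: prefS; rewrite g_sigma_preimage_comp; exists A.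
Qed.

End rV_measurable.

Section lebesgue_rV.
Context {R : realType}.

Definition rV_cons n (p : measurableTypeR R * 'rV[R]_n) : 'rV[R]_n.+1 :=
  \row_i (if unlift ord0 i is Some j then p.2 ord0 j else p.1).

Lemma rV_cons0 n p : @rV_cons n p ord0 ord0 = p.1.
Proof.
by rewrite mxE unlift_none.
Qed.

Lemma rV_consS n p i : @rV_cons n p ord0 (lift ord0 i) = p.2 ord0 i.
Proof.
by rewrite mxE liftK.
Qed.

Lemma measurable_rV_cons n : measurable_fun setT (@rV_cons n).
Proof.
apply: measurable_fun_rVP => i; case: (unliftP ord0 i) => [j|] ->.
  rewrite (_ : _ \o _ = rV_coord j \o snd); last first.
    by apply/funext => p; rewrite /rV_coord /= rV_consS.
  by apply: measurableT_comp; [exact: measurable_rV_coord|exact: measurable_snd].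
rewrite (_ : _ \o _ = fst); first exact: measurable_fst.
by apply/funext => p; rewrite /rV_coord /= rV_cons0.
Qed.

Definition lebesgue_rV_step n
    (m : {sigma_finite_measure set 'rV[R]_n -> \bar R}) :
    set 'rV[R]_n.+1 -> \bar R :=
  pushforward (lebesgue_measure \x m)%E (@rV_cons n).



Section step.
Local Open Scope ereal_scope.
Variables (n : nat) (m : {sigma_finite_measure set 'rV[R]_n -> \bar R}).

Let measurable_preimage (A : set 'rV[R]_n.+1) :
  measurable A -> measurable (@rV_cons n @^-1` A).
Proof. by move=> mA; rewrite -[X in measurable X]setTI; exact: measurable_rV_cons. Qed.

Let step0 : lebesgue_rV_step m set0 = 0.
Proof. by rewrite /lebesgue_rV_step/pushforward preimage_set0 measure0. Qed.

Let step_ge0 A : 0 <= lebesgue_rV_step m A.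
Proof. by rewrite /lebesgue_rV_step/pushforward; exact: measure_ge0. Qed.

Let step_sigma_additive : semi_sigma_additive (lebesgue_rV_step m).
Proof.
move=> F mF tF mUF; rewrite /lebesgue_rV_step/pushforward preimage_bigcup.
apply: measure_semi_sigma_additive.
- by move=> k; exact: measurable_preimage.
- apply/trivIsetP => /= i j _ _ ij; rewrite -preimage_setI.
  by move/trivIsetP : tF => /(_ _ _ _ _ ij) ->//; rewrite preimage_set0.
- by rewrite -preimage_bigcup; exact: measurable_preimage.
Qed.

HB.instance Definition _ := isMeasure.Build _ _ _ (lebesgue_rV_step m)
  step0 step_ge0 step_sigma_additive.

Let step_sigma_finite : sigma_finite setT (lebesgue_rV_step m).
Proof.
have /sigma_finiteP[G [TG ndG Goo]] := sigma_finiteT (@lebesgue_measure R).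
have /sigma_finiteP[H [TH ndH Hoo]] := sigma_finiteT m.
pose g (x : 'rV[R]_n.+1) : measurableTypeR R * 'rV[R]_n :=
  (x ord0 ord0, \row_i x ord0 (lift ord0 i))%R.
have mg : measurable_fun setT g.
  apply: measurable_fun_pair; first exact: (@measurable_rV_coord R n.+1 ord0).
  apply: measurable_fun_rVP => i.
  rewrite (_ : _ \o _ = rV_coord (lift ord0 i)); first exact: measurable_rV_coord.
  by apply/funext => x; rewrite /rV_coord /= mxE.
have gK p : g (@rV_cons n p) = p.
  case: p => a b; rewrite /g rV_cons0; congr pair.
  by apply/rowP => i; rewrite mxE rV_consS.
exists (fun k => g @^-1` (G k `*` H k)) => [|k].
  rewrite -preimage_bigcup (_ : \bigcup_k _ = setT) ?preimage_setT//.
  apply/seteqP; split => // -[x y] _.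
  have [i _ Gx] : (\bigcup_k G k) x by rewrite -TG.
  have [j _ Hy] : (\bigcup_k H k) y by rewrite -TH.
  exists (maxn i j) => //; split.
    by move: x Gx; exact/subsetPset/ndG/leq_maxl.
  by move: y Hy; exact/subsetPset/ndH/leq_maxr.
have [mG Gk] := Goo k; have [mH Hk] := Hoo k; split.
  by rewrite -[X in measurable X]setTI; apply: mg => //; exact: measurableX.
rewrite /lebesgue_rV_step /pushforward (_ : _ @^-1` _ = G k `*` H k); last first.
  by rewrite -comp_preimage (_ : g \o _ = id)//; apply/funext => p; exact: gK.
by rewrite product_measure1E// lte_mul_pinfty// ge0_fin_numE.
Qed.

HB.instance Definition _ := Measure_isSigmaFinite.Build _ _ _
  (lebesgue_rV_step m) step_sigma_finite.

End step.

(* Product of n copies of the Lebesgue measure of R; see lebesgue_rV_box. *)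
Fixpoint lebesgue_rV n : {sigma_finite_measure set 'rV[R]_n -> \bar R} :=
  match n with
  | 0 => \d_(0 : 'rV[R]_0)
  | k.+1 => lebesgue_rV_step (lebesgue_rV k)
  end.

Lemma lebesgue_rV_box n (a b : 'rV[R]_n) :
  (forall i, a ord0 i <= b ord0 i) ->
  lebesgue_rV n [set x | forall i, a ord0 i <= x ord0 i <= b ord0 i] =
  (\prod_(i < n) (b ord0 i - a ord0 i))%:E.
Proof.
elim: n a b => [|n IHn] a b ab.
  rewrite big_ord0 /= diracE mem_set// => i; by case: i.
rewrite big_ord_recl /= /lebesgue_rV_step /pushforward.
pose a' : 'rV[R]_n := (\row_i a ord0 (lift ord0 i))%R.
pose b' : 'rV[R]_n := (\row_i b ord0 (lift ord0 i))%R.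
set B := [set x : 'rV[R]_n | forall i, a' ord0 i <= x ord0 i <= b' ord0 i].
rewrite (_ : _ @^-1` _ = `[a ord0 ord0, b ord0 ord0]%classic `*` B); last first.
  apply/seteqP; split => p /=.
    move=> abp; split; first by have := abp ord0; rewrite rV_cons0 /= in_itv.
    by move=> i; have := abp (lift ord0 i); rewrite rV_consS !mxE.
  rewrite in_itv/= => -[p1 p2] i; case: (unliftP ord0 i) => [j|] ->.
    by rewrite rV_consS; have := p2 j; rewrite !mxE.
  by rewrite rV_cons0.
have mB : measurable B.
  rewrite (_ : B = \big[setI/setT]_(i < n)
      (rV_coord i @^-1` `[a' ord0 i, b' ord0 i]%classic)); last first.
    rewrite -bigcap_seq; apply/seteqP; split => x /=.
      by move=> h i _ /=; rewrite in_itv; exact: h.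
    by move=> h i; have := h i; rewrite /= in_itv; apply; rewrite mem_index_enum.
  apply: bigsetI_measurable => i _.
  rewrite -[X in measurable X]setTI.
  exact: (measurable_rV_coord i measurableT (measurable_itv _)).
rewrite product_measure1E//.
rewrite IHn => [|i]; last by rewrite !mxE.
rewrite [X in (X * _)%E = _](_ : _ = (b ord0 ord0 - a ord0 ord0)%:E); last first.
  apply: etrans (lebesgue_measure_itv _) _; rewrite /= lte_fin.
  case: ltP => [_|ba]; first by rewrite EFinN.
  by rewrite (_ : a _ _ = b ord0 ord0) ?subrr//; apply/eqP; rewrite eq_le ab.
by rewrite -EFinM; congr (_ * _)%:E; apply: eq_bigr => i _; rewrite !mxE.
Qed.

End lebesgue_rV.

Section ball.
Context {R : realType} {d : nat}.
Implicit Types (x : 'rV[R]_d) (f g phi : 'rV[R]_d -> R) (m : 'I_d -> nat)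
  (i j : 'I_d) (mu : R).

(* The norm that MathComp-Analysis puts on 'rV[R]_d is the maximum norm. *)
Definition enorm x : R := Num.sqrt (\sum_(i < d) x ord0 i ^+ 2).

Definition unit_ball : set 'rV[R]_d := [set x | enorm x <= 1].

Definition open_unit_ball : set 'rV[R]_d := [set x | enorm x < 1].

Definition weight mu x : R := (1 - enorm x ^+ 2) `^ mu.

Definition bconst mu : R :=
  (\int[lebesgue_rV d]_(x in unit_ball) weight mu x)^-1.

Definition wnorm mu f : \bar R :=
  (((bconst mu)%:E *
    \int[lebesgue_rV d]_(x in unit_ball) (`|f x| ^+ 2 * weight mu x)%:E)
   `^ 2^-1)%E.

Definition in_L2 mu f : Prop :=
  measurable_fun unit_ball f /\ (wnorm mu f < +oo)%E.

(* mpoly.msize p is 1 + the total degree of p, and 0 when p = 0. *)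
Definition best_approx (n : nat) mu f : \bar R :=
  ereal_inf [set wnorm mu (fun x => f x - mpoly.meval (x ord0) p) |
             p in [set p : mpoly.mpoly d R | (mpoly.msize p <= n.+1)%N]].

Definition mlen m : nat := (\sum_(i < d) m i)%N.

Definition partial i phi : 'rV[R]_d -> R :=
  fun x => 'D_(delta_mx ord0 i) phi x.

Definition mpartial m phi : 'rV[R]_d -> R :=
  foldr (fun i => iter (m i) (partial i)) phi (enum 'I_d).

(* Every iterated partial derivative is Frechet differentiable everywhere, which
   amounts to phi being C^oo. *)
Definition smooth phi : Prop :=
  forall (s : seq 'I_d) x, differentiable (foldr partial phi s) x.

Definition test_function phi : Prop :=
  smooth phi /\
  exists K : set 'rV[R]_d,
    [/\ compact K, K `<=` open_unit_ball & forall x, ~ K x -> phi x = 0].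

(* Locally integrable on the open ball. The values on the unit sphere, a null
   set, only have to be measurable. *)
Definition locally_integrable_ball f : Prop :=
  measurable_fun unit_ball f /\
  forall K : set 'rV[R]_d, compact K -> K `<=` open_unit_ball ->
    (\int[lebesgue_rV d]_(x in K) `|f x|%:E < +oo)%E.

Definition is_weak_derivative m f g : Prop :=
  [/\ locally_integrable_ball f, locally_integrable_ball g &
   forall phi, test_function phi ->
     \int[lebesgue_rV d]_(x in open_unit_ball) (f x * mpartial m phi x) =
     (-1) ^+ mlen m *
     \int[lebesgue_rV d]_(x in open_unit_ball) (g x * phi x)].

Definition sobolev (s : nat) mu f : Prop :=
  in_L2 mu f /\
  forall m, (mlen m <= s)%N ->
    exists2 g, is_weak_derivative m f g & in_L2 (mu + (mlen m)%:R) g.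

(* A weak derivative is unique only up to a null set: wpartial i f is some weak
   partial derivative of f if there is one, and 0 otherwise. *)
Definition wpartial i f : 'rV[R]_d -> R :=
  xget (cst 0) [set g | is_weak_derivative (fun j => (j == i) : nat) f g].

Definition laplacian f : 'rV[R]_d -> R :=
  fun x => \sum_(i < d) wpartial i (wpartial i f) x.

Definition angular i j f : 'rV[R]_d -> R :=
  fun x => x ord0 i * wpartial j f x - x ord0 j * wpartial i f x.

Definition laplace_beltrami f : 'rV[R]_d -> R :=
  fun x => \sum_(i < d) \sum_(j < d | (i < j)%N) angular i j (angular i j f) x.

End ball.

(* Main.v *)
Require Import Defs.
From mathcomp Require Import all_boot all_order all_algebra.
From mathcomp Require Import all_classical all_reals all_analysis.
From mathcomp Require Import measurable_realfun ring lra zify.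
From mathcomp Require mpoly finmap.
Import (canonicals, coercions) mpoly.

Set Implicit Arguments.
Unset Strict Implicit.
Unset Printing Implicit Defensive.

Import Order.TTheory GRing.Theory Num.Theory.
Import numFieldNormedType.Exports.

Local Open Scope classical_set_scope.
Local Open Scope ring_scope.

(** The error is estimated by the orthogonal expansion of f. Write w = 1 - |x|^2 and
    let V_k be the space of polynomials of degree k orthogonal to all lower degrees
    for the weight w^mu. The operators Delta and d_i map orthogonal polynomials for
    w^a to orthogonal polynomials for w^(a+2) and w^(a+1), of degree lower by two and
    one, and D_(i,j) preserves V_k: their adjoints, computed by integration by parts,
    raise degrees by as much. On V_k the operator w^(-mu) div (w^(mu+1) grad) + Delta_0
    is the scalar - k (k + 2 mu + d).

    The heart of the proof is an inequality for a single p in V_k, key_inequality: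
    k^(4s+2) |p|^2 is at most a constant times the squared norm of grad Delta^s p for
    the weight w^(mu+2s+1) plus that of all D_(i,j) Delta_0^s p for the weight w^mu.
    An exact formula for the norm of Delta p (lap_formE) shows that Delta behaves
    like multiplication by k^2 except for tangential energy, and an interpolation
    inequality for the powers of Delta_0 (lb_interpolation) bounds that energy.
    This part is algebra: it holds for every semidefinite form that satisfies the
    integration by parts rules (ball_form), which the forms int p q w^a do
    (ip_ball_form).

    The inequality passes from p to f by duality. Let g be the difference of the
    projections of f to the polynomials of degree at most N and at most n. It is a
    sum of elements of V_k with k > n, whose images under the operators of the
    theorem are again mutually orthogonal, so the inequality holds for g with n in
    place of k (projection_gap_energy). If T is one of these operators, with adjoint
    S up to sign, the squared norm of T g is - <g, S T g>, in which g may be replaced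
    by f because only low degrees differ; hence it is <T f - r, T g> for every r in
    the space of polynomials of the degree allowed on the right, and so at most
    |T f - r|^2 (projection_gap_le). As N grows, g tends to the error of the
    projection of degree n, since polynomials are dense (poly_dense).

    Weak derivatives enter only through <T f, q> = - <f, S q> for polynomials q
    (wpartial_laplacian_adjoint, angular_beltrami_adjoint). The function q w^a is not a
    test function; it is approximated by products with smooth cutoffs of w, which stay
    in an explicit class stable under differentiation (cutsum), and dominated
    convergence removes the cutoff. *)

(** * Differential operators on polynomials *)

Section PolynomialOperators.
Context {R : realType} {d : nat}.
Local Notation P := (mpoly.mpoly d R).
Implicit Types (p q g : P) (i j : 'I_d) (a c : R).

Definition pX i : P := mpoly.mpolyX R (mpoly.mnm1 i).
Definition pD i p : P := mpoly.mderiv i p.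

Lemma pDB i : {morph pD i : p q / p - q}.
Proof. exact: mpoly.mderivB. Qed.

Lemma pDD i : {morph pD i : p q / p + q}.
Proof. exact: mpoly.mderivD. Qed.

Lemma pDZ i c p : pD i (c *: p) = c *: pD i p.
Proof. exact: mpoly.mderivZ. Qed.

Lemma pDM i p q : pD i (p * q) = pD i p * q + p * pD i q.
Proof. exact: mpoly.mderivM. Qed.

Lemma pDC i j p : pD i (pD j p) = pD j (pD i p).
Proof. exact: mpoly.mderiv_comm. Qed.

Lemma pDsum i (I : Type) (r : seq I) (Q : pred I) (F : I -> P) :
  pD i (\sum_(k <- r | Q k) F k) = \sum_(k <- r | Q k) pD i (F k).
Proof. exact: (raddf_sum (mpoly.mderiv i)). Qed.

Lemma pDX i j : pD i (pX j) = (i == j)%:R.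
Proof.
rewrite /pD /pX mpoly.mderivX mpoly.mnm1E eq_sym.
case: eqP => [->|_]; last by rewrite scale0r.
by rewrite scale1r -mpoly.mpolyX0; congr (mpoly.mpolyX _ _); apply/mpoly.mnmP => k;
  rewrite mpoly.mnmBE mpoly.mnm0E subnn.
Qed.

Lemma pD1 i : pD i 1 = 0.
Proof. by rewrite /pD -mpoly.mpolyC1 mpoly.mderivC. Qed.

(** In the comments below, w is 1 - |x|^2, E is the Euler operator euler,
    D_(i,j) is ang i j, Delta is lap and Delta_0 is lb. *)
Definition euler p : P := \sum_(i < d) pX i * pD i p.
Definition lap p : P := \sum_(i < d) pD i (pD i p).
Definition pr2 : P := \sum_(i < d) pX i * pX i.
Definition pw : P := 1 - pr2.
Definition ang i j p : P := pX i * pD j p - pX j * pD i p.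
Definition lb p : P := \sum_(i < d) \sum_(j < d | (i < j)%N) ang i j (ang i j p).

Lemma sum_delta i (F : 'I_d -> P) : \sum_(j < d) (i == j)%:R * F j = F i.
Proof.
rewrite (bigD1 i) //= eqxx mul1r big1 ?addr0// => j ji.
by rewrite eq_sym (negbTE ji) mul0r.
Qed.

Lemma pD_pr2 i : pD i pr2 = 2%:R * pX i.
Proof.
rewrite /pr2 pDsum (eq_bigr (fun k => (i == k)%:R * (2%:R * pX k))) ?sum_delta//.
by move=> k _; rewrite pDM pDX; ring.
Qed.

Lemma pD_pw i : pD i pw = - 2%:R * pX i.
Proof. by rewrite /pw pDB pD1 pD_pr2; ring. Qed.

Lemma eulerD p q : euler (p + q) = euler p + euler q.
Proof.
by rewrite /euler -big_split; apply: eq_bigr => i _; rewrite pDD mulrDr.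
Qed.

Lemma eulerZ c p : euler (c *: p) = c *: euler p.
Proof. by rewrite /euler scaler_sumr; apply: eq_bigr => i _; rewrite pDZ scalerAr. Qed.

Lemma eulerM p q : euler (p * q) = euler p * q + p * euler q.
Proof.
rewrite /euler mulr_suml mulr_sumr -big_split; apply: eq_bigr => i _ /=.
by rewrite pDM; ring.
Qed.

Lemma euler_pw : euler pw = - 2%:R * pr2.
Proof.
by rewrite /euler /pr2 mulr_sumr; apply: eq_bigr => i _; rewrite pD_pw; ring.
Qed.

Lemma lapD p q : lap (p + q) = lap p + lap q.
Proof. by rewrite /lap -big_split; apply: eq_bigr => i _; rewrite !pDD. Qed.

Lemma lapZ c p : lap (c *: p) = c *: lap p.
Proof. by rewrite /lap scaler_sumr; apply: eq_bigr => i _; rewrite !pDZ. Qed.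

Lemma lapM_pw p : lap (pw * p) = pw * lap p - 4%:R * euler p - (2 * d)%:R * p.
Proof.
rewrite (_ : (2 * d)%:R * p = \sum_(i < d) 2%:R * p); last first.
  by rewrite sumr_const card_ord natrM -mulrA mulr_natl -mulr_natl; ring.
rewrite /lap /euler !mulr_sumr -!sumrB; apply: eq_bigr => i _.
rewrite pDM pD_pw pDD !pDM pD_pw pDX eqxx (_ : pD i (- 2%:R) = 0); first by rewrite (_ : true%:R = 1 :> P) //; ring.
by rewrite /pD mpoly.mderivN mpoly.mderivMn -[1]mpoly.mpolyC1 mpoly.mderivC mul0rn oppr0.
Qed.

Lemma pD_euler i p : pD i (euler p) = pD i p + euler (pD i p).
Proof.
rewrite /euler pDsum -[pD i p](sum_delta i (fun k => pD k p)) -big_split /=.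
by apply: eq_bigr => k _; rewrite pDM pDX pDC sum_delta.
Qed.

Lemma lap_euler p : lap (euler p) = euler (lap p) + 2%:R * lap p.
Proof.
rewrite /lap (eq_bigr (fun i => euler (pD i (pD i p)) + 2%:R * pD i (pD i p))).
  rewrite big_split /= -mulr_sumr; congr (_ + _).
  rewrite /euler exchange_big; apply: eq_bigr => i _ /=.
  by rewrite pDsum mulr_sumr.
by move=> i _; rewrite !(pD_euler, pDD); ring.
Qed.


Local Notation C c := (mpoly.mpolyC d c).

Lemma pDCM i c p : pD i (C c * p) = C c * pD i p.
Proof. exact: mpoly.mderiv_mulC. Qed.

Lemma eulerCM c p : euler (C c * p) = C c * euler p.
Proof. by rewrite !mpoly.mul_mpolyC eulerZ. Qed.

Lemma lapCM c p : lap (C c * p) = C c * lap p.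
Proof. by rewrite !mpoly.mul_mpolyC lapZ. Qed.

Lemma angangE i j p : ang i j (ang i j p) =
  (pX i * pX i) * pD j (pD j p) + (pX j * pX j) * pD i (pD i p) -
  2%:R * (pX i * (pX j * pD i (pD j p))) - pX i * pD i p - pX j * pD j p +
  (i == j)%:R * (2%:R * (pX i * pD i p)).
Proof.
rewrite /ang !pDB !pDM !pDX !eqxx (pDC j i p) (eq_sym j i).
by case: eqVneq => [->|_] /=; rewrite ?mulr1n ?mulr0n; ring.
Qed.

(** Delta_0 = |x|^2 Delta - E^2 - (d - 2) E. The sum S over all ordered pairs
    is easier to evaluate, and equals twice the sum over i < j. *)
Lemma lbE p :
  lb p = pr2 * lap p - euler (euler p) - C (d%:R - 2) * euler p.
Proof.
pose S := \sum_(i < d) \sum_(j < d) ang i j (ang i j p).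
have S2 : S = 2%:R * lb p.
  rewrite /S (eq_bigr (fun i => \sum_(j < d | (i < j)%N) ang i j (ang i j p) +
     \sum_(j < d | (j < i)%N) ang i j (ang i j p))); last first.
    move=> i _; rewrite (bigID (fun j : 'I_d => (i < j)%N)) /=; congr (_ + _).
    rewrite [RHS]big_mkcond [LHS]big_mkcond; apply: eq_bigr => j _.
    rewrite -leqNgt; case: ltngtP => //= /val_inj ->.
    by rewrite /ang subrr.
  rewrite big_split /= mulr_natl mulr2n; congr (_ + _).
  rewrite (exchange_big_dep xpredT) //=; apply: eq_bigr => i _.
  apply: eq_bigr => j _; rewrite /ang !pDB !pDM; ring.
have SE : S = 2%:R * (pr2 * lap p - euler (euler p) - C (d%:R - 2) * euler p).
  rewrite /S; under eq_bigr => i _ do under eq_bigr => j _ do rewrite angangE.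
  under eq_bigr => i _.
    rewrite !(big_split, sumrN) /= sum_delta -mulr_sumr -mulr_suml -!mulr_sumr.
    rewrite sumr_const card_ord -mulr_natl.
    rewrite -!/(lap p) -!/(pr2) -!/(euler p); over.
  have eulerK : euler (euler p) = euler p +
      \sum_(i < d) pX i * \sum_(j < d) pX j * pD i (pD j p).
    by rewrite {1}/euler -big_split /=; apply: eq_bigr => i _; rewrite pD_euler
      mulrDr /euler; congr (_ + _ * _); apply: eq_bigr => j _; rewrite pDC.
  rewrite !(big_split, sumrN) /= -!mulr_suml -!mulr_sumr -/(euler p) eulerK.
  rewrite -/pr2 -/(lap p) sumr_const card_ord -mulr_natl -/(euler p).
  under [\sum_(i < d) pX i * (_ *+ d)]eq_bigr => i _ do rewrite mulrnAr.
  rewrite sumrMnl -/(euler p) -mulr_natl mpoly.mpolyCB !mpoly.mpolyC_nat; ring.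
have : 2%:R * lb p = 2%:R * (pr2 * lap p - euler (euler p) - C (d%:R - 2) * euler p).
  by rewrite -S2.
have two0 : 2%:R != 0 :> P.
  by rewrite -mpoly.mpolyC_nat mpoly.mpolyC_eq0 pnatr_eq0.
by move/(mulfI two0).
Qed.

(** The product rule gives d_i (w^(a+1) q) = w^a (dq a i q), so that dq a i is
    minus the adjoint of d_i from the weight w^(a+1) to the weight w^a. *)
Definition dq a i q : P := pw * pD i q - C (2 * (a + 1)) * (pX i * q).

(** The operator w^(-a) div (w^(a+1) grad p) *)
Definition TT a p : P := pw * lap p - C (2 * (a + 1)) * euler p.

Lemma sum_dq_pD a p : \sum_(i < d) dq a i (pD i p) = TT a p.
Proof. by rewrite /dq sumrB -!mulr_sumr. Qed.

(** The factor |x|^2 cancels. Since E is k on homogeneous polynomials of degree k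
    and Delta lowers degrees, TT + lb is - k (k + 2a + d) up to lower degrees. *)
Lemma TT_lb a p : TT a p + lb p =
  lap p - euler (euler p) - C (2 * a + d%:R) * euler p.
Proof.
rewrite lbE /TT /pw !(mpoly.mpolyCB, mpoly.mpolyCD, mpoly.mpolyCM, mpoly.mpolyC_nat).
ring.
Qed.

Lemma sum_dq_dq a g : \sum_(i < d) dq a i (dq (a + 1) i g) =
  pw * pw * lap g - C (4 * (a + 2)) * (pw * euler g)
  - C (2 * (a + 2) * d%:R) * (pw * g) + C (4 * (a + 1) * (a + 2)) * (pr2 * g).
Proof.
pose F i := pw * pw * pD i (pD i g) - C (4 * (a + 2)) * (pw * (pX i * pD i g))
  - C (2 * (a + 2)) * (pw * g) + C (4 * (a + 1) * (a + 2)) * ((pX i * pX i) * g).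
rewrite (eq_bigr F) => [|i _].
  rewrite /F !(big_split, sumrN) /= sumr_const card_ord -!mulr_sumr -mulr_suml.
  rewrite -/(lap g) -/(euler g) -/pr2 -mulr_natl.
  by rewrite !(mpoly.mpolyCB, mpoly.mpolyCD, mpoly.mpolyCM, mpoly.mpolyC_nat); ring.
rewrite /dq pDB pDCM !pDM pD_pw pDX eqxx.
have -> : true%:R = 1 :> P by [].
by rewrite /F !(mpoly.mpolyCB, mpoly.mpolyCD, mpoly.mpolyCM, mpoly.mpolyC_nat) mpoly.mpolyC1; ring.
Qed.

Lemma euler_pwM p : euler (pw * p) = pw * euler p - 2%:R * (pr2 * p).
Proof. rewrite eulerM euler_pw; ring. Qed.

Lemma eulerB p q : euler (p - q) = euler p - euler q.
Proof. by rewrite -scaleN1r eulerD eulerZ scaleN1r. Qed.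

Lemma lapB p q : lap (p - q) = lap p - lap q.
Proof. by rewrite -scaleN1r lapD lapZ scaleN1r. Qed.

(** The adjoint of Delta composed with Delta is a polynomial in TT and Delta_0
    alone, whose quadratic forms are known on orthogonal polynomials. *)
Lemma sum_dq_dq_lap a p :
  \sum_(i < d) dq a i (dq (a + 1) i (lap p)) =
  TT a (TT a p) - C (2 * (a + 1) * (d%:R - 2)) * TT a p
  + C (4 * (a + 1) ^+ 2) * lb p.
Proof.
rewrite sum_dq_dq lbE {1}/TT /TT lapB eulerB lapCM eulerCM lapM_pw lap_euler euler_pwM.
rewrite !(mpoly.mpolyCB, mpoly.mpolyCD, mpoly.mpolyCM, mpoly.mpolyC_nat, mpoly.mpolyC1, expr2) natrM.
ring.
Qed.

End PolynomialOperators.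

(** * Degrees *)

Section Degrees.
Context {R : realType} {d : nat}.
Local Notation P := (mpoly.mpoly d R).
Local Notation C c := (mpoly.mpolyC d c).
Local Notation msize p := (mpoly.msize p).
Implicit Types (p q g : P) (i j : 'I_d) (a c : R) (k : nat).

Lemma lap_pXM i p : lap (pX i * p) = pX i * lap p + 2%:R * pD i p.
Proof.
rewrite /lap (eq_bigr (fun l => pX i * pD l (pD l p) + (i == l)%:R * (2%:R * pD l p))).
  by rewrite big_split /= -mulr_sumr sum_delta.
move=> l _; rewrite pDM pDD pDX !pDM !pDX (eq_sym l i).
case: eqVneq => [->|_] /=; rewrite ?mulr1n ?mulr0n ?pD1; last first.
  by rewrite /pD mpoly.mderiv0 -/(pD _ _); ring.
ring.
Qed.

Lemma pD_lap i p : pD i (lap p) = lap (pD i p).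
Proof. by rewrite /lap pDsum; apply: eq_bigr => l _; rewrite !(pDC i). Qed.

Lemma lap_ang i j p : lap (ang i j p) = ang i j (lap p).
Proof. by rewrite /ang lapB !lap_pXM !pD_lap (pDC i j); ring. Qed.

Lemma euler_pX i : euler (pX i : P) = pX i.
Proof.
rewrite /euler (eq_bigr (fun l => (i == l)%:R * pX l)) ?sum_delta// => l _.
by rewrite pDX mulrC eq_sym.
Qed.

Lemma euler_ang i j p : euler (ang i j p) = ang i j (euler p).
Proof.
by rewrite /ang eulerB !eulerM !euler_pX !pD_euler; ring.
Qed.

Lemma angB i j p q : ang i j (p - q) = ang i j p - ang i j q.
Proof. by rewrite /ang !pDB; ring. Qed.

Lemma angD i j p q : ang i j (p + q) = ang i j p + ang i j q.
Proof. by rewrite /ang !pDD; ring. Qed.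

Lemma angCM i j c p : ang i j (C c * p) = C c * ang i j p.
Proof. by rewrite /ang !pDCM; ring. Qed.

Lemma ang_pr2M i j p : ang i j (pr2 * p) = pr2 * ang i j p.
Proof. by rewrite /ang !pDM !pD_pr2; ring. Qed.

(** lbE expresses Delta_0 through |x|^2, Delta and E, which commute with
    each D_(i,j). *)
Lemma lb_ang i j p : lb (ang i j p) = ang i j (lb p).
Proof.
by rewrite !lbE !angB ang_pr2M angCM !lap_ang !euler_ang.
Qed.

Lemma lbD p q : lb (p + q) = lb p + lb q.
Proof.
rewrite /lb -big_split; apply: eq_bigr => i _ /=; rewrite -big_split.
by apply: eq_bigr => j _; rewrite !angD.
Qed.

Lemma msize_leP k p :
  (forall m, (k <= mpoly.mdeg m)%N -> mpoly.mcoeff m p = 0) <-> (msize p <= k)%N.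
Proof.
split=> [h|h m km].
  rewrite mpoly.msizeE; apply/bigmax_leqP_seq => m mp _.
  rewrite ltnNge; apply/negP => /h; apply/eqP.
  by rewrite -mpoly.mcoeff_msupp.
apply: mpoly.memN_msupp_eq0; exact: mpoly.msize_mdeg_ge (leq_trans h km).
Qed.

Lemma msizeB_leq k p q : (msize p <= k)%N -> (msize q <= k)%N -> (msize (p - q) <= k)%N.
Proof.
move=> /msize_leP hp /msize_leP hq; apply/msize_leP => m km.
by rewrite mpoly.mcoeffB hp ?hq// subr0.
Qed.

Lemma msizeD_leq k p q : (msize p <= k)%N -> (msize q <= k)%N -> (msize (p + q) <= k)%N.
Proof.
move=> /msize_leP hp /msize_leP hq; apply/msize_leP => m km.
by rewrite mpoly.mcoeffD hp ?hq// addr0.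
Qed.

Lemma msizeCM_leq k c p : (msize p <= k)%N -> (msize (C c * p) <= k)%N.
Proof.
move=> /msize_leP hp; apply/msize_leP => m km.
by rewrite mpoly.mcoeffCM hp// mulr0.
Qed.

Lemma msize_sum_leq k (I : Type) (r : seq I) (Q : pred I) (F : I -> P) :
  (forall l, Q l -> msize (F l) <= k)%N -> (msize (\sum_(i <- r | Q i) F i) <= k)%N.
Proof.
move=> h; elim/big_ind : _ => //; first by rewrite mpoly.msize0.
by move=> p q; exact: msizeD_leq.
Qed.

Lemma msize_pD k i p : (msize p <= k)%N -> (msize (pD i p) <= k.-1)%N.
Proof.
move=> /msize_leP hp; apply/msize_leP => m km.
rewrite mpoly.mcoeff_mderiv hp ?mul0rn// mpoly.mdegD mpoly.mdeg1.
by case: k km {hp} => //= k; rewrite addn1.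
Qed.

Lemma msize_pXM k i p : (msize p <= k)%N -> (msize (pX i * p) <= k.+1)%N.
Proof.
move=> hp; have [->|p0] := eqVneq p 0; first by rewrite mulr0 mpoly.msize0.
have X0 : (pX i : P) != 0.
  by rewrite -mpoly.msize_poly_eq0 mpoly.msizeX mpoly.mdeg1.
by rewrite mpoly.msizeM// mpoly.msizeX mpoly.mdeg1 add2n.
Qed.

Lemma msize_le0 p : (msize p <= 0)%N -> p = 0.
Proof. by rewrite leqn0 mpoly.msize_poly_eq0 => /eqP. Qed.

Lemma msize_XD k i j p : (msize p <= k)%N -> (msize (pX i * pD j p) <= k)%N.
Proof.
case: k => [/msize_le0 ->|k hp]; first by rewrite /pD mpoly.mderiv0 mulr0 mpoly.msize0.
exact: msize_pXM (msize_pD _ hp).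
Qed.

Lemma msize_ang k i j p : (msize p <= k)%N -> (msize (ang i j p) <= k)%N.
Proof. by move=> hp; apply: msizeB_leq; exact: msize_XD. Qed.

Lemma msize_lb k p : (msize p <= k)%N -> (msize (lb p) <= k)%N.
Proof.
move=> hp; apply: msize_sum_leq => i _; apply: msize_sum_leq => j _.
by do 2!apply: msize_ang.
Qed.

Lemma msize_euler k p : (msize p <= k)%N -> (msize (euler p) <= k)%N.
Proof. by move=> hp; apply: msize_sum_leq => i _; exact: msize_XD. Qed.

Lemma msize_lap k p : (msize p <= k)%N -> (msize (lap p) <= k.-2)%N.
Proof. by move=> hp; apply: msize_sum_leq => i _; do 2!apply: msize_pD. Qed.

Lemma msize_pwM k p : (msize p <= k)%N -> (msize (pw * p) <= k.+2)%N.
Proof.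
move=> hp; rewrite mulrBl mul1r; apply: msizeB_leq.
  by apply: leq_trans hp _; rewrite leqW.
rewrite /pr2 mulr_suml; apply: msize_sum_leq => i _; rewrite -mulrA.
by do 2!apply: msize_pXM.
Qed.

Lemma msize_dq k a i p : (msize p <= k)%N -> (msize (dq a i p) <= k.+1)%N.
Proof.
case: k => [/msize_le0 ->|k hp].
  by rewrite /dq /pD mpoly.mderiv0 !mulr0 subrr mpoly.msize0.
apply: msizeB_leq; first exact: msize_pwM (msize_pD _ hp).
exact: msizeCM_leq (msize_pXM _ hp).
Qed.

Lemma mcoeff_euler m p :
  mpoly.mcoeff m (euler p) = (mpoly.mdeg m)%:R * mpoly.mcoeff m p.
Proof.
elim/mpoly.mpolyind: p => [|c m' p _ _ IH].
  by rewrite (_ : euler 0 = 0) ?mpoly.mcoeff0 ?mulr0// /euler big1// => i _;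
    rewrite /pD mpoly.mderiv0 mulr0.
rewrite eulerD eulerZ !mpoly.mcoeffD IH !mpoly.mcoeffZ mulrDr; congr (_ + _).
rewrite (_ : euler (mpoly.mpolyX R m') = (mpoly.mdeg m')%:R * mpoly.mpolyX R m').
  rewrite mulr_natl mpoly.mcoeffMn mpoly.mcoeffX; case: eqVneq => [->|_] /=.
    by rewrite mulr1 mulrC.
  by rewrite mulr0n mul0rn !mulr0.
rewrite mpoly.mdegE natr_sum mulr_suml /euler; apply: eq_bigr => i _.
rewrite /pD mpoly.mderivX -scalerAr /pX -mpoly.mpolyXD scaler_nat mulr_natl.
case: (posnP (m' i)) => [->|mi]; first by rewrite !mulr0n.
congr (mpoly.mpolyX _ _ *+ _); apply/mpoly.mnmP => l.
rewrite mpoly.mnmDE mpoly.mnmBE mpoly.mnm1E; case: eqVneq => [<-|_] /=.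
  by rewrite add1n subn1 prednK.
by rewrite add0n subn0.
Qed.

(** On the homogeneous part of top degree k, the Euler operator is k. *)
Lemma msize_eulerB k p : (msize p <= k.+1)%N ->
  (msize (euler p - C k%:R * p) <= k)%N.
Proof.
move=> /msize_leP hp; apply/msize_leP => m km.
rewrite mpoly.mcoeffB mcoeff_euler mpoly.mcoeffCM -mulrBl.
case: ltngtP km => // [km _|-> _]; first by rewrite hp// mulr0.
by rewrite subrr mul0r.
Qed.

Lemma msize_eigen k a p : (msize p <= k.+1)%N ->
  (msize (TT a p + lb p + C (k%:R * (k%:R + (2 * a + d%:R))) * p) <= k)%N.
Proof.
move=> hp; rewrite TT_lb.
set N := 2 * a + d%:R; set q := euler p - C k%:R * p.
rewrite (_ : _ + _ = lap p - (euler q + C (k%:R + N) * q)); last first.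
  by rewrite /q eulerB eulerCM !(mpoly.mpolyCD, mpoly.mpolyCM); ring.
apply: msizeB_leq; first by apply: leq_trans (msize_lap hp) _ => /=; exact: leq_pred.
apply: msizeD_leq; first exact/msize_euler/msize_eulerB.
exact/msizeCM_leq/msize_eulerB.
Qed.

End Degrees.

(** * Orthogonal polynomials for the weights (1 - |x|^2)^a *)

Section BallForms.
Context {R : realType} {d : nat}.
Local Notation P := (mpoly.mpoly d R).
Local Notation C c := (mpoly.mpolyC d c).
Local Notation msize p := (mpoly.msize p).
Implicit Types (p q g : P) (i j : 'I_d) (a c : R) (k : nat).

(** What the algebra needs from the forms int p q w^a over the ball. The exponent
    is an argument because differentiation shifts it. Semidefiniteness is enough:
    form_null replaces the conclusion that p vanishes. *)
Record ball_form (ip : R -> P -> P -> R) : Prop := BallForm {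
  formC : forall a p q, -1 < a -> ip a p q = ip a q p;
  formDl : forall a p q g, -1 < a -> ip a (p + q) g = ip a p g + ip a q g;
  formCl : forall a c p q, -1 < a -> ip a (C c * p) q = c * ip a p q;
  form_ge0 : forall a p, -1 < a -> 0 <= ip a p p;
  form_pD : forall a i p q, -1 < a ->
    ip (a + 1) (pD i p) q = - ip a p (dq a i q);
  form_ang : forall a i j p q, -1 < a -> i != j ->
    ip a (ang i j p) q = - ip a p (ang i j q)
}.

Variable ip : R -> P -> P -> R.
Hypothesis H : ball_form ip.

Lemma formDr a p q g : -1 < a -> ip a g (p + q) = ip a g p + ip a g q.
Proof. by move=> a1; rewrite (formC H g)// formDl// !(formC H _ g). Qed.

Lemma formCr a c p q : -1 < a -> ip a p (C c * q) = c * ip a p q.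
Proof. by move=> a1; rewrite (formC H)// formCl// (formC H). Qed.

Lemma form0l a q : -1 < a -> ip a 0 q = 0.
Proof. by move=> a1; rewrite -[X in ip a X](mul0r q) -mpoly.mpolyC0 formCl// mul0r. Qed.

Lemma form0r a q : -1 < a -> ip a q 0 = 0.
Proof. by move=> a1; rewrite (formC H)// form0l. Qed.

Lemma formNl a p q : -1 < a -> ip a (- p) q = - ip a p q.
Proof.
move=> a1; rewrite -mulN1r -[X in X * p]opprK -mpoly.mpolyC1.
by rewrite opprK -mpoly.mpolyCN formCl// mulN1r.
Qed.

Lemma formBl a p q g : -1 < a -> ip a (p - q) g = ip a p g - ip a q g.
Proof. by move=> a1; rewrite formDl// formNl. Qed.

Lemma formBr a p q g : -1 < a -> ip a g (p - q) = ip a g p - ip a g q.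
Proof. by move=> a1; rewrite (formC H g)// formBl// !(formC H _ g). Qed.

Lemma form_suml a (I : Type) (r : seq I) (Q : pred I) (F : I -> P) g : -1 < a ->
  ip a (\sum_(l <- r | Q l) F l) g = \sum_(l <- r | Q l) ip a (F l) g.
Proof.
move=> a1; apply: (big_morph (fun p => ip a p g)) => [p q|]; first exact: formDl.
exact: form0l.
Qed.

Lemma form_sumr a (I : Type) (r : seq I) (Q : pred I) (F : I -> P) g : -1 < a ->
  ip a g (\sum_(l <- r | Q l) F l) = \sum_(l <- r | Q l) ip a g (F l).
Proof.
move=> a1; apply: (big_morph (fun p => ip a g p)) => [p q|]; first exact: formDr.
exact: form0r.
Qed.

(** If ip a p q were not 0, the square of t p + q would be affine and nonconstant
    in t, hence negative for some t. *)
Lemma form_null a p q : -1 < a -> ip a p p = 0 -> ip a p q = 0.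
Proof.
move=> a1 p0; apply/eqP/negPn/negP => pq0.
pose t := - (ip a q q + 1) / (2 * ip a p q).
have := form_ge0 H (C t * p + q) a1.
rewrite !(formDl, formDr)// !(formCl, formCr)// p0 (formC H q)//.
have -> : t * (t * 0) + t * ip a p q + (t * ip a p q + ip a q q) = -1.
  by rewrite /t; field.
by rewrite ler0N1.
Qed.

(** The Dirichlet forms of TT a and of Delta_0, see form_TT and form_lb *)
Definition grad a p q := \sum_(i < d) ip (a + 1) (pD i p) (pD i q).
Definition tang a p q :=
  \sum_(i < d) \sum_(j < d | (i < j)%N) ip a (ang i j p) (ang i j q).

Lemma ltr_a1 a : -1 < a -> -1 < a + 1.
Proof. lra. Qed.

Lemma form_TT a p q : -1 < a -> ip a (TT a p) q = - grad a p q.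
Proof.
move=> a1; rewrite -sum_dq_pD form_suml// /grad -sumrN; apply: eq_bigr => i _.
by rewrite (formC H)// (formC H (pD i p)) ?ltr_a1// form_pD// opprK.
Qed.

Lemma form_lb a p q : -1 < a -> ip a (lb p) q = - tang a p q.
Proof.
move=> a1; rewrite /lb /tang form_suml// -sumrN; apply: eq_bigr => i _.
rewrite form_suml// -sumrN; apply: eq_bigr => j ij.
by rewrite form_ang// neq_ltn ij.
Qed.

Lemma gradC a p q : -1 < a -> grad a p q = grad a q p.
Proof. by move=> a1; apply: eq_bigr => i _; rewrite (formC H) ?ltr_a1. Qed.

Lemma tangC a p q : -1 < a -> tang a p q = tang a q p.
Proof. by move=> a1; apply: eq_bigr => i _; apply: eq_bigr => j _; rewrite (formC H). Qed.

Lemma form_TTC a p q : -1 < a -> ip a (TT a p) q = ip a p (TT a q).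
Proof. by move=> a1; rewrite (formC H p)// !form_TT// gradC. Qed.

Lemma form_lbC a p q : -1 < a -> ip a (lb p) q = ip a p (lb q).
Proof. by move=> a1; rewrite (formC H p)// !form_lb// tangC. Qed.

Lemma grad_ge0 a p : -1 < a -> 0 <= grad a p p.
Proof. by move=> a1; apply: sumr_ge0 => i _; apply: (form_ge0 H); exact: ltr_a1. Qed.

Lemma tang_ge0 a p : -1 < a -> 0 <= tang a p p.
Proof.
by move=> a1; apply: sumr_ge0 => i _; apply: sumr_ge0 => j _; exact: (form_ge0 H).
Qed.

(** Orthogonal polynomials of degree k; since the form is semidefinite, the degree
    is only bounded by k. *)
Definition orthodeg a k p :=
  (msize p <= k.+1)%N /\ forall q, (msize q <= k)%N -> ip a p q = 0.

(** d_i q is orthogonal to lower degrees because its adjoint raises degrees by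
    one. *)
Lemma orthodeg_pD a k i p : -1 < a ->
  orthodeg a k.+1 p -> orthodeg (a + 1) k (pD i p).
Proof.
move=> a1 [sp op]; split; first exact: (msize_pD i sp).
by move=> q sq; rewrite form_pD// op ?oppr0// msize_dq.
Qed.

Lemma orthodeg_ang a k i j p : -1 < a -> i != j ->
  orthodeg a k p -> orthodeg a k (ang i j p).
Proof.
move=> a1 ij [sp op]; split; first exact: msize_ang.
by move=> q sq; rewrite form_ang// op ?oppr0// msize_ang.
Qed.

Lemma orthodeg_sum a k (I : Type) (r : seq I) (Q : pred I) (F : I -> P) : -1 < a ->
  (forall l, Q l -> orthodeg a k (F l)) -> orthodeg a k (\sum_(l <- r | Q l) F l).
Proof.
move=> a1 h; split; first by apply: msize_sum_leq => l /h [].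
by move=> q sq; rewrite form_suml// big1// => l /h [_]; exact.
Qed.

Lemma orthodeg_lap a k p : -1 < a ->
  orthodeg a k.+2 p -> orthodeg (a + 2) k (lap p).
Proof.
move=> a1 op; apply: orthodeg_sum => [|i _]; first lra.
rewrite (_ : a + 2 = a + 1 + 1); last by ring.
by apply: orthodeg_pD; [exact: ltr_a1|exact: orthodeg_pD].
Qed.

Definition eigen a k : R := k%:R * (k%:R + (2 * a + d%:R)).

(** The eigenvalue equation TT p + Delta_0 p = - K p, tested against q. Its defect r
    has degree below k by msize_eigen and is orthogonal to all such polynomials,
    because TT and Delta_0 are symmetric and preserve degrees; so r is null. *)
Lemma orthodeg_energy a k p q : -1 < a -> orthodeg a k p ->
  grad a p q + tang a p q = eigen a k * ip a p q.
Proof.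
move=> a1 [sp op]; set K := eigen a k.
pose r := TT a p + lb p + C K * p.
have sr : (msize r <= k)%N by exact: msize_eigen.
have sTT u : (msize u <= k)%N -> (msize (TT a u) <= k)%N.
  move=> su; case: k su {sp op K r sr} => [/msize_le0 ->|k su].
    rewrite -sum_dq_pD; apply: msize_sum_leq => i _.
    by rewrite /dq /pD !mpoly.mderiv0 !mulr0 subrr mpoly.msize0.
  rewrite -sum_dq_pD; apply: msize_sum_leq => i _; apply: msize_dq.
  exact: (msize_pD i su).
have rr : ip a r r = 0.
  rewrite /r (formDl H)// (formDl H)// (formCl H)// -/r.
  rewrite form_TTC// form_lbC// !op ?mulr0 ?addr0//; first exact: msize_lb.
  exact: sTT.
have := form_null q a1 rr.
rewrite /r (formDl H)// (formDl H)// (formCl H)// form_TT// form_lb//.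
lra.
Qed.

Hypothesis hd : (2 <= d)%N.

Lemma eigen_ge0 a k : -1 < a -> 0 <= eigen a k.
Proof.
move=> a1; have : 2 <= d%:R :> R by rewrite ler_nat.
by move=> d2; apply: mulr_ge0 => //; have : 0 <= k%:R :> R by []; lra.
Qed.

Lemma tang_le a k p : -1 < a -> orthodeg a k p ->
  tang a p p <= eigen a k * ip a p p.
Proof.
by move=> a1 op; rewrite -orthodeg_energy// lerDr grad_ge0.
Qed.

Lemma lb_tang a p : -1 < a -> ip a (lb p) (lb p) =
  \sum_(i < d) \sum_(j < d | (i < j)%N) tang a (ang i j p) (ang i j p).
Proof.
move=> a1; rewrite form_lb// /tang -sumrN; apply: eq_bigr => i _.
rewrite -sumrN; apply: eq_bigr => j _.
by rewrite -lb_ang (formC H)// form_lb// opprK.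
Qed.

(** D_(i,j) commutes with Delta_0 and preserves orthogonal polynomials, so the
    bound of tang_le applies to each D_(i,j) p. *)
Lemma lb_le a k p : -1 < a -> orthodeg a k p ->
  ip a (lb p) (lb p) <= eigen a k * tang a p p.
Proof.
move=> a1 op; rewrite lb_tang// /tang mulr_sumr; apply: ler_sum => i _.
rewrite mulr_sumr; apply: ler_sum => j ij.
by apply: tang_le => //; apply: orthodeg_ang => //; rewrite neq_ltn ij.
Qed.

(** Moving both Laplacians to the same side gives the operator of sum_dq_dq_lap,
    in which TT p can be replaced by - K p - Delta_0 p. *)
Lemma lap_formE a k p : -1 < a -> orthodeg a k p ->
  ip (a + 2) (lap p) (lap p) =
  eigen a k ^+ 2 * ip a p p - 2 * eigen a k * tang a p p + ip a (lb p) (lb p)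
  + 2 * (a + 1) * (d%:R - 2) * grad a p p - 4 * (a + 1) ^+ 2 * tang a p p.
Proof.
move=> a1 op; set K := eigen a k.
have TE q : ip a (TT a p) q = - (K * ip a p q) - ip a (lb p) q.
  by rewrite -orthodeg_energy// form_TT// form_lb//; ring.
have -> : ip (a + 2) (lap p) (lap p) =
    ip a p (\sum_(i < d) dq a i (dq (a + 1) i (lap p))).
  rewrite {1}/lap form_suml; last lra.
  rewrite form_sumr//; apply: eq_bigr => i _.
  rewrite (_ : a + 2 = a + 1 + 1); last by ring.
  by rewrite (form_pD H) ?ltr_a1// (form_pD H)// opprK.
rewrite sum_dq_dq_lap formDr// formBr// !formCr// -form_TTC//.
have grE : ip a p (TT a p) = - grad a p p by rewrite (formC H)// form_TT.
have tgE : ip a p (lb p) = - tang a p p by rewrite (formC H)// form_lb.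
rewrite TE grE tgE (formC H (lb p))// TE tgE.
have := orthodeg_energy p a1 op; rewrite -/K => gt.
have -> : grad a p p = K * ip a p p - tang a p p by rewrite -gt; ring.
ring.
Qed.
End BallForms.

(** * The spectral inequality for orthogonal polynomials *)

Section KeyInequality.
Context {R : realType} {d : nat}.
Local Notation P := (mpoly.mpoly d R).
Local Notation C c := (mpoly.mpolyC d c).
Implicit Types (p q g : P) (i j : 'I_d) (a c : R) (k l s : nat).
Variable ip : R -> P -> P -> R.
Hypothesis H : ball_form ip.
Hypothesis hd : (2 <= d)%N.

Local Notation iplap a l p :=
  (ip (a + (2 * l)%:R) (iter l lap p) (iter l lap p)).

Lemma ltr_a2l a l : -1 < a -> -1 < a + (2 * l)%:R.
Proof. by move=> a1; apply: ltr_wpDr. Qed.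

Lemma orthodeg_iter_lap a k l p : -1 < a -> (2 * l <= k)%N -> orthodeg ip a k p ->
  orthodeg ip (a + (2 * l)%:R) (k - 2 * l) (iter l lap p).
Proof.
move=> a1 lk op; elim: l lk => [|l IH] lk; first by rewrite muln0 addr0 subn0.
rewrite (_ : a + _ = a + (2 * l)%:R + 2); last by rewrite mulnS natrD; ring.
apply: orthodeg_lap => //; first exact: ltr_a2l.
rewrite (_ : (k - 2 * l.+1).+2 = (k - 2 * l)%N); last first.
  by lia.
by apply: IH; apply: leq_trans lk; rewrite leq_mul2l leqnSn orbT.
Qed.

(* Constants with eigen (a + 2l) (k - 2l) ~ k^2 uniformly in l <= s *)
Let B a s : R := 1 + 2 * s%:R + 2 * `|a| + d%:R.

Lemma eigen_bounds a k l s : -1 < a -> (l <= s)%N -> (2 * s + 2 <= k)%N ->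
  k%:R ^+ 2 / (s%:R + 1) <= eigen (d := d) (a + (2 * l)%:R) (k - 2 * l)%N
    <= B a s * k%:R ^+ 2.
Proof.
move=> a1 ls sk; rewrite /eigen.
have lk : (2 * l <= k)%N.
  by apply: leq_trans sk; rewrite (leq_trans _ (leq_addr _ _))// leq_mul2l ls.
have d2 : 2 <= d%:R :> R by rewrite ler_nat.
have s0 : 0 <= s%:R :> R by [].
have l0 : 0 <= l%:R :> R by [].
have lsR : l%:R <= s%:R :> R by rewrite ler_nat.
have skR : 2 * s%:R + 2 <= k%:R :> R by rewrite -natrM -natrD ler_nat.
have aa : a <= `|a| by exact: ler_norm.
have a0 : 0 <= `|a| by exact: normr_ge0.
rewrite natrB// natrM; set x : R := k%:R in skR *.
apply/andP; split.
  rewrite ler_pdivrMr; last lra.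
  have h1 : x <= (x - 2 * l%:R) * (s%:R + 1) by nra.
  have h2 : x <= x - 2 * l%:R + (2 * (a + 2 * l%:R) + d%:R) by lra.
  rewrite mulrAC expr2; apply: ler_pM => //; lra.
rewrite mulrC /B expr2 mulrA; apply: ler_pM; [lra|lra| |lra].
have : `|a| <= `|a| * x by rewrite ler_peMr//; lra.
have : d%:R <= d%:R * x by rewrite ler_peMr//; lra.
have : s%:R <= s%:R * x by rewrite ler_peMr//; lra.
nra.
Qed.

Let M a s : R := B a s ^+ 2 + 2 * (`|a| + 1 + 2 * s%:R) * d%:R * B a s.
Let M2 a s : R := 2 * B a s + 4 * (`|a| + 1 + 2 * s%:R) ^+ 2.

Let B1 a s : 1 <= B a s.
Proof. by rewrite /B -!addrA lerDl !addr_ge0// mulr_ge0. Qed.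

Let M_1 a s : 1 <= M a s.
Proof.
rewrite /M -[1]addr0; apply: lerD; first by rewrite expr_ge1// (le_trans _ (B1 a s)).
by rewrite !mulr_ge0 ?addr_ge0 ?mulr_ge0// (le_trans _ (B1 a s)).
Qed.

Let abs_bound a l s : -1 < a -> (l <= s)%N ->
  0 <= a + (2 * l)%:R + 1 <= `|a| + 1 + 2 * s%:R.
Proof.
move=> a1 ls; rewrite natrM.
have lsR : l%:R <= s%:R :> R by rewrite ler_nat.
have l0 : 0 <= l%:R :> R by [].
have aa : a <= `|a| by exact: ler_norm.
by apply/andP; split; lra.
Qed.

(** In lap_formE the term K^2 |p|^2 dominates, K being of order k^2: all others are
    at most of the same order for the upper bound; for the lower bound, those that
    are negative are multiples of the tangential energy of order k^2. *)
Lemma lap_upper a k l s p : -1 < a -> (l <= s)%N -> (2 * s + 2 <= k)%N ->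
  orthodeg ip (a + (2 * l)%:R) (k - 2 * l) p ->
  ip (a + (2 * l)%:R + 2) (lap p) (lap p) <=
    M a s * k%:R ^+ 4 * ip (a + (2 * l)%:R) p p.
Proof.
move=> a1 ls sk op; have b1 := ltr_a2l l a1.
have := lap_formE H b1 op => ->.
have := lb_le H b1 op; have := tang_ge0 H p b1; have := form_ge0 H p b1.
have := grad_ge0 H p b1; have := orthodeg_energy H p b1 op.
have /andP[_] := eigen_bounds a1 ls sk; have := eigen_ge0 hd (k - 2 * l) b1.
have /andP[] := abs_bound a1 ls.
move: (eigen _ _) (ip _ p p) (tang _ _ _ _) (grad _ _ _ _) (ip _ (lb p) (lb p)) => K u t g v.
pose b' : R := `|a| + 1 + 2 * s%:R; rewrite -/b'; set b : R := a + (2 * l)%:R + 1 => b0 bb' K0 KB gtE g0 u0 t0 vK.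
have d2 : 2 <= d%:R :> R by rewrite ler_nat.
have x1 : 1 <= k%:R :> R by rewrite ler1n (leq_trans _ sk)// addn2.
set x : R := k%:R in x1 KB *.
have gK : g <= K * u by lra.
have h1 : 2 * b * (d%:R - 2) * g <= 2 * b' * d%:R * (K * u).
  by rewrite !ler_pM// ?mulr_ge0//; lra.
have h2 : 0 <= 4 * b ^+ 2 * t by rewrite !mulr_ge0// ?sqr_ge0.
have h3 : 0 <= K * t by exact: mulr_ge0.
have B0 : 0 <= B a s by apply: le_trans (B1 a s).
have K2 : K ^+ 2 <= (B a s) ^+ 2 * x ^+ 4.
  by rewrite (_ : x ^+ 4 = (x ^+ 2) ^+ 2) -?exprMn ?lerXn2r ?nnegrE// -?exprM// mulr_ge0// sqr_ge0.
have K4 : K <= B a s * x ^+ 4.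
  apply: le_trans KB _; by rewrite ler_wpM2l// ler_weXn2l.
have b'0 : 0 <= b' by apply: le_trans bb'.
have h4 : 2 * b' * d%:R * (K * u) <= 2 * b' * d%:R * (B a s * x ^+ 4 * u).
  apply: ler_wpM2l; first by rewrite !mulr_ge0.
  exact: (ler_wpM2r u0 K4).
have h5 : K ^+ 2 * u <= B a s ^+ 2 * x ^+ 4 * u by rewrite ler_wpM2r.
have -> : M a s * x ^+ 4 * u = B a s ^+ 2 * x ^+ 4 * u + 2 * b' * d%:R * (B a s * x ^+ 4 * u).
  by rewrite /M -/b'; ring.
lra.
Qed.

Lemma lap_lower a k l s p : -1 < a -> (l <= s)%N -> (2 * s + 2 <= k)%N ->
  orthodeg ip (a + (2 * l)%:R) (k - 2 * l) p ->
  k%:R ^+ 4 * ip (a + (2 * l)%:R) p p <= (s%:R + 1) ^+ 2 *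
   (ip (a + (2 * l)%:R + 2) (lap p) (lap p) +
    M2 a s * k%:R ^+ 2 * tang ip (a + (2 * l)%:R) p p).
Proof.
move=> a1 ls sk op; have b1 := ltr_a2l l a1.
have := lap_formE H b1 op => ->.
have := form_ge0 H (lb p) b1; have := tang_ge0 H p b1; have := form_ge0 H p b1.
have := grad_ge0 H p b1.
have /andP[] := eigen_bounds a1 ls sk; have := eigen_ge0 hd (k - 2 * l) b1.
have /andP[] := abs_bound a1 ls.
move: (eigen _ _) (ip _ p p) (tang _ _ _ _) (grad _ _ _ _) (ip _ (lb p) (lb p)) => K u t g v.
pose b' : R := `|a| + 1 + 2 * s%:R; rewrite -/b'; set b : R := a + (2 * l)%:R + 1 => b0 bb' K0 KS KB g0 u0 t0 v0.
have d2 : 2 <= d%:R :> R by rewrite ler_nat.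
have x1 : 1 <= k%:R :> R by rewrite ler1n (leq_trans _ sk)// addn2.
set x : R := k%:R in x1 KS KB *.
have s0 : 0 < s%:R + 1 :> R by rewrite ltr_wpDl.
have xK : x ^+ 2 <= (s%:R + 1) * K by rewrite mulrC -ler_pdivrMr.
have xK4 : x ^+ 4 <= (s%:R + 1) ^+ 2 * K ^+ 2.
  have -> : x ^+ 4 = (x ^+ 2) ^+ 2 by rewrite -exprM.
  rewrite -exprMn; apply: lerXn2r => //; first by rewrite nnegrE sqr_ge0.
  by rewrite nnegrE mulr_ge0// ltW.
apply: (@le_trans _ _ ((s%:R + 1) ^+ 2 * K ^+ 2 * u)); first by rewrite ler_wpM2r.
rewrite -mulrA ler_wpM2l// ?sqr_ge0//.
have h1 : 0 <= 2 * b * (d%:R - 2) * g by rewrite !mulr_ge0//; lra.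
have h2 : 4 * b ^+ 2 * t <= 4 * b' ^+ 2 * x ^+ 2 * t.
  rewrite ler_wpM2r// -[X in X <= _]mulr1 ler_pM// ?mulr_ge0// ?sqr_ge0//.
    by rewrite ler_wpM2l// lerXn2r// nnegrE//; exact: le_trans bb'.
  by rewrite expr_ge1//; lra.
have h3 : 2 * K * t <= 2 * (B a s * x ^+ 2) * t by rewrite ler_wpM2r// ler_wpM2l.
have -> : M2 a s * x ^+ 2 * t = 2 * (B a s * x ^+ 2) * t + 4 * b' ^+ 2 * x ^+ 2 * t.
  by rewrite /M2 -/b'; ring.
lra.
Qed.

Lemma iter_lap_ang l i j p : iter l lap (ang i j p) = ang i j (iter l lap p).
Proof. by elim: l => //= l ->; rewrite lap_ang. Qed.

Lemma iter_lap_upper a k l s p : -1 < a -> (l <= s)%N -> (2 * s + 2 <= k)%N ->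
  orthodeg ip a k p -> iplap a l p <= (M a s * k%:R ^+ 4) ^+ l * ip a p p.
Proof.
move=> a1 + sk op; elim: l => [|l IH] ls; first by rewrite muln0 addr0 mul1r.
rewrite (_ : a + _ = a + (2 * l)%:R + 2); last by rewrite mulnS natrD; ring.
apply: le_trans (lap_upper a1 (ltnW ls) sk (orthodeg_iter_lap a1 _ op)) _.
  by lia.
rewrite (exprS (M a s * _)) -(mulrA (M a s * _)); apply: ler_wpM2l.
  by rewrite mulr_ge0// (le_trans _ (M_1 a s)).
exact: IH (ltnW ls).
Qed.

(** D_(i,j) commutes with Delta, so that iter_lap_upper applies to D_(i,j) p. *)
Lemma iter_lap_tang a k l s p : -1 < a -> (l <= s)%N -> (2 * s + 2 <= k)%N ->
  orthodeg ip a k p ->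
  tang ip (a + (2 * l)%:R) (iter l lap p) (iter l lap p) <=
    (M a s * k%:R ^+ 4) ^+ l * tang ip a p p.
Proof.
move=> a1 ls sk op; rewrite /tang mulr_sumr; apply: ler_sum => i _.
rewrite mulr_sumr; apply: ler_sum => j ij; rewrite -!iter_lap_ang.
apply: iter_lap_upper => //; apply: orthodeg_ang => //.
by rewrite neq_ltn ij.
Qed.

(** Iterating lap_lower loses tangential energies of the Delta^j p, which
    iter_lap_tang returns to that of p. *)
Lemma iter_lap_lower a s l : -1 < a -> (l <= s)%N -> exists2 c : R, 0 < c &
  forall k p, (2 * s + 2 <= k)%N -> orthodeg ip a k p ->
    k%:R ^+ (4 * l + 2) * ip a p p <=
    c * (k%:R ^+ 2 * iplap a l p + k%:R ^+ (4 * l) * tang ip a p p).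
Proof.
move=> a1; elim: l => [|l IH] ls.
  exists 1 => // k p sk op; rewrite muln0 add0n addr0 mul1r mul1r lerDl.
  exact: (tang_ge0 H p a1).
have [c c0 hc] := IH (ltnW ls).
pose A : R := (s%:R + 1) ^+ 2; pose D : R := A * M2 a s * M a s ^+ l + 1.
have b'0 : 0 <= `|a| + 1 + 2 * s%:R :> R by rewrite addr_ge0// mulr_ge0.
have M20 : 0 <= M2 a s.
  by rewrite /M2 addr_ge0// mulr_ge0// ?sqr_ge0// (le_trans _ (B1 a s)).
have A0 : 0 < A by rewrite exprn_gt0// ltr_wpDl.
have M0 : 0 <= M a s by rewrite (le_trans _ (M_1 a s)).
have D0 : 1 <= D.
  by rewrite /D lerDr; apply: mulr_ge0; [apply: mulr_ge0 => //; exact: ltW|exact: exprn_ge0].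
exists (c * (A + D)) => [|k p sk op]; first by apply: mulr_gt0 => //; lra.
have ol : orthodeg ip (a + (2 * l)%:R) (k - 2 * l) (iter l lap p).
  by apply: orthodeg_iter_lap => //; move: sk; clear -ls; lia.
have := lap_lower a1 (ltnW ls) sk ol.
have := iter_lap_tang a1 (ltnW ls) sk op.
have := hc k p sk op; have t0 := tang_ge0 H p a1.
have v0 : 0 <= iplap a l.+1 p by exact: (form_ge0 H _ (ltr_a2l l.+1 a1)).
rewrite -[ip (_ + 2) _ _]/(ip _ (iter l.+1 lap p) (iter l.+1 lap p)).
rewrite (_ : a + (2 * l)%:R + 2 = a + (2 * l.+1)%:R); last by rewrite mulnS natrD; ring.
move: v0 t0; move: (iplap a l.+1 p) (iplap a l p) (tang ip a p p) (ip a p p).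
move: (tang ip _ (iter _ _ _) _) => tl v u t w.
set x : R := k%:R; have x0 : 0 <= x by [].
move=> v0 t0 h1 h2 h3; rewrite -/A in h3.
rewrite (_ : 4 * l.+1 + 2 = 4 + (4 * l + 2))%N; last by clear; lia.
rewrite (_ : 4 * l.+1 = 4 * l + 4)%N; last by clear; lia.
rewrite exprMn -exprM in h2.
rewrite exprD -mulrA; apply: (le_trans (ler_wpM2l (exprn_ge0 4 x0) h1)).
rewrite mulrCA -mulrA; apply: ler_wpM2l; first exact: ltW.
have -> : x ^+ 4 * (x ^+ 2 * u + x ^+ (4 * l) * t) =
  x ^+ 2 * (x ^+ 4 * u) + x ^+ (4 * l + 4) * t by rewrite exprD; ring.
apply: (@le_trans _ _ (x ^+ 2 * (A * (v + M2 a s * x ^+ 2 * (M a s ^+ l * x ^+ (4 * l) * t)))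
   + x ^+ (4 * l + 4) * t)).
  rewrite lerD2r ler_wpM2l ?sqr_ge0//; apply: (le_trans h3).
  rewrite ler_wpM2l ?(ltW A0)// lerD2l ler_wpM2l//.
  by rewrite mulr_ge0// sqr_ge0.
have -> : x ^+ 2 * (A * (v + M2 a s * x ^+ 2 * (M a s ^+ l * x ^+ (4 * l) * t)))
   + x ^+ (4 * l + 4) * t = A * (x ^+ 2 * v) + D * (x ^+ (4 * l + 4) * t).
  by rewrite /D exprD; ring.
have X0 : 0 <= x ^+ 2 * v by rewrite mulr_ge0// sqr_ge0.
have Y0 : 0 <= x ^+ (4 * l + 4) * t by rewrite mulr_ge0// exprn_ge0.
nra.
Qed.

(** For the nonnegative operator A = - Delta_0 this is the positivity of
    (A^(2s) - t^(2s)) (A - t). The inductive step adds (A + t) (A - t)^2 A^(2s),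
    which is a sum of squares, so no diagonalization is needed. *)
Lemma lb_interpolation a s t p : -1 < a -> 0 <= t ->
  t ^+ (2 * s) * (tang ip a p p - t * ip a p p) <=
    tang ip a (iter s lb p) (iter s lb p) - t * ip a (iter s lb p) (iter s lb p).
Proof.
move=> a1 t0; elim: s => [|s IH]; first by rewrite muln0 expr0 mul1r.
rewrite iterS; move: (iter s lb p) IH => q IH.
have e1 : ip a (lb q) (lb q) - 2 * t * tang ip a q q + t ^+ 2 * ip a q q >= 0.
  have := form_ge0 H (lb q + C t * q) a1.
  rewrite !(formDl H, formDr H)// !(formCl H, formCr H)// (formC H q (lb q))// (form_lb H)//.
  by move/le_trans; apply; rewrite le_eqVlt; apply/orP; left; apply/eqP; rewrite !(form_lb H)//; ring.
have e2 : tang ip a (lb q) (lb q) - 2 * t * ip a (lb q) (lb q) + t ^+ 2 * tang ip a q q >= 0.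
  have h i j : 0 <= ip a (ang i j (lb q)) (ang i j (lb q)) +
      2 * t * ip a (ang i j q) (ang i j (lb q)) + t ^+ 2 * ip a (ang i j q) (ang i j q).
    move: (ang i j (lb q)) (ang i j q) => g1 g2.
    have := form_ge0 H (g1 + C t * g2) a1.
    rewrite !(formDl H, formDr H)// !(formCl H, formCr H)//.
    rewrite (formC H g1 g2)//.
    by move/le_trans; apply; rewrite le_eqVlt; apply/orP; left; apply/eqP; ring.
  have -> : tang ip a (lb q) (lb q) - 2 * t * ip a (lb q) (lb q) +
      t ^+ 2 * tang ip a q q = tang ip a (lb q) (lb q) +
      2 * t * tang ip a q (lb q) + t ^+ 2 * tang ip a q q.
    by rewrite (form_lb H)//; ring.
  rewrite /tang !mulr_sumr -!big_split; apply: sumr_ge0 => i _ /=.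
  rewrite !mulr_sumr -!big_split; apply: sumr_ge0 => j _ /=; exact: h.
rewrite (_ : 2 * s.+1 = 2 + 2 * s)%N; last by clear; lia.
rewrite exprD -mulrA; apply: (le_trans (ler_wpM2l (sqr_ge0 t) IH)).
have e1' := mulr_ge0 t0 e1.
nra.
Qed.

(** By iter_lap_lower, Delta^s p controls p up to k^(4s) times the tangential energy
    of p. Interpolation with t = k^2 / (2 c1) bounds this loss by the tangential
    energy of Delta_0^s p and a part of k^(4s+2) |p|^2 that is absorbed on the left:
    with c1 the constant of the first step, this part is one half. *)
Lemma key_inequality a s : -1 < a -> exists2 c : R, 0 < c &
  forall k p, (2 * s + 2 <= k)%N -> orthodeg ip a k p ->
    k%:R ^+ (4 * s + 2) * ip a p p <=
    c * (grad ip (a + (2 * s)%:R) (iter s lap p) (iter s lap p)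
         + tang ip a (iter s lb p) (iter s lb p)).
Proof.
move=> a1; have [c c0 hc] := iter_lap_lower a1 (leqnn s).
pose S : R := s%:R + 1; have S1 : 1 <= S by rewrite lerDr.
pose c1 : R := c * (S + S * M a s ^+ s + 1).
have M0 : 0 <= M a s by rewrite (le_trans _ (M_1 a s)).
have MS : 0 <= S * M a s ^+ s by rewrite mulr_ge0// ?exprn_ge0//; lra.
have c10 : 0 < c1 by rewrite mulr_gt0//; lra.
have cc1 : 0 < (2 * c1) ^+ (2 * s) by rewrite exprn_gt0// mulr_gt0.
exists (2 * c1 * (1 + (2 * c1) ^+ (2 * s))) => [|k p sk op].
  apply: mulr_gt0; first exact: mulr_gt0.
  exact: addr_gt0.
have b1 := ltr_a2l s a1.
have ol : orthodeg ip (a + (2 * s)%:R) (k - 2 * s) (iter s lap p).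
  by apply: orthodeg_iter_lap => //; move: sk; clear; lia.
have := orthodeg_energy H (iter s lap p) b1 ol.
have := hc k p sk op; have := iter_lap_tang a1 (leqnn s) sk op.
have := eigen_bounds a1 (leqnn s) sk; move=> /andP[+ _].
have G0 := grad_ge0 H (iter s lap p) b1.
have F0 := tang_ge0 H (iter s lb p) a1.
have u0 := form_ge0 H p a1.
have us0 : 0 <= iplap a s p by exact: (form_ge0 H _ b1).
have es0 := form_ge0 H (iter s lb p) a1.
have x0 : 0 < k%:R :> R by rewrite ltr0n; move: sk; clear; lia.
have t0 : 0 <= k%:R ^+ 2 / (2 * c1) by rewrite divr_ge0// ?sqr_ge0// mulr_ge0// ltW.
have := lb_interpolation s p a1 t0; have A0 := tang_ge0 H p a1.
move: (eigen _ _) => K; move: G0 F0 u0 us0 es0 A0.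
move: (grad _ _ _ _) (tang ip (a + (2 * s)%:R) _ _) (iplap a s p) (ip a p p) (tang ip a p p)
  (tang ip a _ _) (ip a (iter _ _ _) _) => G ts us u A F es G0 F0 u0 us0 es0 A0.
set x : R := k%:R in x0 t0 *; set t := x ^+ 2 / (2 * c1).
move=> hint; rewrite ler_pdivrMr ?ltr_wpDl// => hK hts hmain hen.
have h1 : x ^+ 2 * us <= S * (G + (M a s * x ^+ 4) ^+ s * A).
  apply: (@le_trans _ _ (K * S * us)); first by rewrite ler_wpM2r.
  by rewrite mulrAC mulrC -hen ler_wpM2l//; lra.
have h2 : x ^+ (4 * s + 2) * u <= c1 * (G + x ^+ (4 * s) * A).
  apply: (le_trans hmain); rewrite /c1 -mulrA; apply: ler_wpM2l; first exact: ltW.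
  apply: (@le_trans _ _ (S * (G + (M a s * x ^+ 4) ^+ s * A) + x ^+ (4 * s) * A)).
    by rewrite lerD2r.
  rewrite exprMn -exprM.
  have X0 : 0 <= x ^+ (4 * s) * A by rewrite mulr_ge0// exprn_ge0// ltW.
  have -> : S * (G + M a s ^+ s * x ^+ (4 * s) * A) + x ^+ (4 * s) * A =
    S * G + (S * M a s ^+ s) * (x ^+ (4 * s) * A) + x ^+ (4 * s) * A by ring.
  nra.
have h3 : x ^+ (4 * s) * A <= (2 * c1) ^+ (2 * s) * F + x ^+ (4 * s + 2) * u / (2 * c1).
  have e : (2 * c1) ^+ (2 * s) * t ^+ (2 * s) = x ^+ (4 * s).
    have tE : 2 * c1 * t = x ^+ 2 by rewrite /t; field; rewrite gt_eqF.
    rewrite -exprMn tE -exprM.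
    by congr (_ ^+ _); clear; lia.
  have : (2 * c1) ^+ (2 * s) * (t ^+ (2 * s) * (A - t * u)) <= (2 * c1) ^+ (2 * s) * F.
    rewrite ler_wpM2l ?(ltW cc1)//; apply: (le_trans hint).
    by rewrite gerBl mulr_ge0.
  rewrite mulrA e mulrBr lerBlDr => /le_trans; apply; rewrite lerD2l.
  by rewrite /t exprD le_eqVlt; apply/orP; left; apply/eqP; ring.
have h4 : c1 * (x ^+ (4 * s + 2) * u / (2 * c1)) = x ^+ (4 * s + 2) * u / 2.
  by field; rewrite gt_eqF.
have h5 : c1 * (x ^+ (4 * s) * A) <= c1 * ((2 * c1) ^+ (2 * s) * F) + x ^+ (4 * s + 2) * u / 2.
  by rewrite -h4 -mulrDr ler_wpM2l// ltW.
have h6 : c1 * (G + x ^+ (4 * s) * A) = c1 * G + c1 * (x ^+ (4 * s) * A) by ring.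
have h7 : 0 <= c1 * ((2 * c1) ^+ (2 * s) * G) by apply: mulr_ge0 (ltW c10) _; apply: mulr_ge0 (ltW cc1) G0.
have h8 : 0 <= c1 * F by rewrite mulr_ge0// ltW.
have -> : 2 * c1 * (1 + (2 * c1) ^+ (2 * s)) * (G + F) =
  2 * (c1 * G + c1 * ((2 * c1) ^+ (2 * s) * F) + c1 * F + c1 * ((2 * c1) ^+ (2 * s) * G)) by ring.
move: (x ^+ (4 * s + 2) * u) h2 h5 => z; lra.
Qed.

End KeyInequality.

(** * Borel sets and polynomial functions on row vectors *)

Section RowVectors.
Context {R : realType} {d : nat}.
Implicit Types (x y : 'rV[R]_d) (A U K : set 'rV[R]_d).

Lemma rV_box_measurable x (e : R) :
  measurable [set y : 'rV[R]_d | forall i, ball (x ord0 i) e (y ord0 i)].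
Proof.
rewrite (_ : mkset _ = \big[setI/setT]_(i < d)
    (rV_coord i @^-1` ball (x ord0 i) e)); last first.
  rewrite -bigcap_seq; apply/seteqP; split => y /=.
    by move=> h i _ /=; exact: h.
  by move=> h i; apply: h; rewrite /= mem_index_enum.
apply: bigsetI_measurable => i _; rewrite -[X in measurable X]setTI.
apply: (measurable_rV_coord i measurableT); apply: open_measurable.
exact: ball_open.
Qed.

(** Boxes with rational centres and radii 1/(k+1) form a countable base. *)
Lemma open_rV_measurable U : open U -> measurable U.
Proof.
move=> oU; pose c (q : 'rV[rat]_d) : 'rV[R]_d := \row_i ratr (q ord0 i).
pose B (q : 'rV[rat]_d * nat) :=
  [set y : 'rV[R]_d | forall i, ball (c q.1 ord0 i) q.2.+1%:R^-1 (y ord0 i)].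
pose F q := if pselect (B q `<=` U) then B q else set0.
rewrite (_ : U = \bigcup_q F q).
  apply: countable_bigcupT_measurable; first exact: countableP.
  by move=> q; rewrite /F; case: (pselect _) => [qU|qU]; [exact: rV_box_measurable|exact: measurable0].
apply/seteqP; split => [x Ux|x [q _]]; last first.
  by rewrite /F; case: pselect => // h /h.
have /nbhs_ballP[e /= e0 xeU] : nbhs x U by apply: open_nbhs_nbhs.
have [k ke] : exists k : nat, k.+1%:R^-1 < e / 2.
  have [k] := @ltr_add_invr R 0 (e / 2) (divr_gt0 e0 (ltr0Sn R 1)).
  by rewrite add0r => ?; exists k.
have hq i : exists q : rat, `|x ord0 i - ratr q| < k.+1%:R^-1.
  have [|q] := @rat_in_itvoo R (x ord0 i - k.+1%:R^-1) (x ord0 i + k.+1%:R^-1).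
    by rewrite ltrBlDr -addrA ltrDl addr_gt0// invr_gt0.
  by rewrite in_itv /= => /andP[h1 h2]; exists q; rewrite distrC ltr_distl h1 h2.
have [g hg] := choice hq.
exists (\row_i g i, k) => //; rewrite /F; case: pselect => [h /= i|h].
  by rewrite !mxE /ball /= distrC.
exfalso; apply: h => y /= yB; apply: xeU; split => // i j.
rewrite ord1; have := yB j; rewrite /ball /= !mxE => h1; have h2 := hg j.
rewrite (_ : x 0 j - y 0 j = (x 0 j - ratr (g j)) + (ratr (g j) - y 0 j)); last by ring.
apply: le_lt_trans (ler_normD _ _) _; apply: lt_trans (ltrD h2 h1) _.
by rewrite [ltRHS](splitr e); exact: ltrD.
Qed.

Lemma closed_rV_measurable A : closed A -> measurable A.
Proof.
move=> cA; rewrite -(setCK A); apply: measurableC; apply: open_rV_measurable.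
exact: closed_openC.
Qed.

Lemma compact_rV_measurable K : compact K -> measurable K.
Proof.
by move=> cK; apply: closed_rV_measurable; exact: compact_closed.
Qed.

Lemma continuous_rV_measurable (f : 'rV[R]_d -> R) :
  continuous f -> measurable_fun setT f.
Proof.
move=> /continuousP cf; apply: (measurability _ (RGenOpens.measurableE R)).
move=> _ [_ [a [b ->] <-]]; rewrite setTI; apply: open_rV_measurable.
exact/cf/interval_open.
Qed.

Definition pev (p : mpoly.mpoly d R) (x : 'rV[R]_d) : R := mpoly.meval (x ord0) p.

Lemma pevD p q x : pev (p + q) x = pev p x + pev q x.
Proof. exact: mpoly.mevalD. Qed.
Lemma pevB p q x : pev (p - q) x = pev p x - pev q x.
Proof. exact: mpoly.mevalB. Qed.
Lemma pevN p x : pev (- p) x = - pev p x.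
Proof. exact: mpoly.mevalN. Qed.
Lemma pevM p q x : pev (p * q) x = pev p x * pev q x.
Proof. exact: mpoly.mevalM. Qed.
Lemma pevC c x : pev (mpoly.mpolyC d c) x = c.
Proof. exact: mpoly.mevalC. Qed.
Lemma pevX i x : pev (pX i) x = x ord0 i.
Proof. exact: mpoly.mevalXU. Qed.
Lemma pev0 x : pev 0 x = 0.
Proof. exact: mpoly.meval0. Qed.
Lemma pev1 x : pev 1 x = 1.
Proof. exact: mpoly.meval1. Qed.
Lemma pev_nat n x : pev n%:R x = n%:R.
Proof. by rewrite /pev mpoly.mevalMn mpoly.meval1. Qed.
Lemma pev_sum (I : Type) (r : seq I) (Q : pred I) F x :
  pev (\sum_(l <- r | Q l) F l) x = \sum_(l <- r | Q l) pev (F l) x.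
Proof. exact: (raddf_sum (mpoly.meval (x ord0))). Qed.

Lemma poly_ind (Q : mpoly.mpoly d R -> Prop) :
  (forall c, Q (mpoly.mpolyC d c)) -> (forall i, Q (pX i)) ->
  (forall p q, Q p -> Q q -> Q (p + q)) -> (forall p q, Q p -> Q q -> Q (p * q)) ->
  forall p, Q p.
Proof.
move=> QC QX QD QM; elim/mpoly.mpolyind => [|c m p _ _ Qp].
  by rewrite -mpoly.mpolyC0.
apply: (QD) => //; rewrite -mpoly.mul_mpolyC; apply: (QM) => //.
rewrite mpoly.mpolyXE_id; apply: big_ind.
- by rewrite -mpoly.mpolyC1.
- exact: QM.
move=> i _; elim: (m i) => [|k IH]; first by rewrite expr0 -mpoly.mpolyC1.
by rewrite exprS; apply: (QM) => //; exact: QX.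
Qed.

Lemma differentiable_pev p x : differentiable (pev p) x.
Proof.
elim/poly_ind : p => [c|i|p q|p q].
- by rewrite (_ : pev _ = cst c) //; apply/funext => y; rewrite pevC.
- rewrite (_ : pev _ = fun y : 'rV[R]_d => y ord0 i).
    exact: differentiable_coord.
  by apply/funext => y; rewrite pevX.
- move=> hp hq; rewrite (_ : pev (p + q) = pev p \+ pev q); last first.
    by apply/funext => y; rewrite pevD.
  exact: differentiableD.
- move=> hp hq; rewrite (_ : pev (p * q) = pev p * pev q); last first.
    by apply/funext => y; rewrite pevM.
  exact: differentiableM.
Qed.

Lemma continuous_pev p : continuous (pev p).
Proof. by move=> x; exact/differentiable_continuous/differentiable_pev. Qed.

Lemma is_derive_pev p x i : is_derive x (delta_mx ord0 i) (pev p) (pev (pD i p) x).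
Proof.
elim/poly_ind : p => [c|j|p q|p q].
- rewrite /pD mpoly.mderivC pev0 (_ : pev _ = cst c); first exact: is_derive_cst.
  by apply/funext => y; rewrite pevC.
- rewrite (_ : pev (pX j) = fun y : 'rV[R]_d => y ord0 j); last first.
    by apply/funext => y; rewrite pevX.
  have cd : differentiable (fun y : 'rV[R]_d => y ord0 j) x by exact: differentiable_coord.
  apply: DeriveDef; first exact: diff_derivable.
  have /matrixP/(_ ord0 j) := @derive_mx R 'rV[R]_d 1 d id x (delta_mx ord0 i) (@derivable_id R _ x (delta_mx ord0 i)).
  rewrite derive_id !mxE /= => <-.
  by rewrite pDX eq_sym; case: eqP; rewrite ?pev1 ?pev0.
- move=> hp hq; rewrite (_ : pev (p + q) = pev p + pev q); last first.
    by apply/funext => y; rewrite pevD.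
  by rewrite pDD pevD; exact: is_deriveD.
- move=> hp hq; rewrite (_ : pev (p * q) = pev p * pev q); last first.
    by apply/funext => y; rewrite pevM.
  apply: is_derive_eq; rewrite pDM pevD !pevM /GRing.scale /=; ring.
Qed.

Lemma measurable_pev p (D : set 'rV[R]_d) : measurable_fun D (pev p).
Proof.
apply: (measurable_funS measurableT) => //.
exact: continuous_rV_measurable (@continuous_pev p).
Qed.

End RowVectors.

(** * The unit ball *)

Section UnitBall.
Context {R : realType} {d : nat}.
Implicit Types (x y : 'rV[R]_d).

Lemma enorm_sqr x : enorm x ^+ 2 = \sum_(i < d) x ord0 i ^+ 2.
Proof. by rewrite /enorm sqr_sqrtr// sumr_ge0// => i _; exact: sqr_ge0. Qed.

Lemma pev_pw x : pev pw x = 1 - enorm x ^+ 2.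
Proof.
rewrite /pw pevB pev1 /pr2 pev_sum enorm_sqr; congr (_ - _).
by apply: eq_bigr => i _; rewrite pevM pevX expr2.
Qed.

Lemma enorm_ge0 x : 0 <= enorm x.
Proof. exact: sqrtr_ge0. Qed.

Lemma open_unit_ballE : open_unit_ball = [set x : 'rV[R]_d | 0 < pev pw x].
Proof.
apply/seteqP; split => x /=; rewrite /open_unit_ball /= pev_pw subr_gt0 => h.
  by rewrite expr_lt1// enorm_ge0.
by move: h; rewrite expr_lt1// enorm_ge0.
Qed.

Lemma unit_ballE : unit_ball = [set x : 'rV[R]_d | 0 <= pev pw x].
Proof.
apply/seteqP; split => x /=; rewrite /unit_ball /= pev_pw subr_ge0 => h.
  by rewrite expr_le1// enorm_ge0.
by move: h; rewrite expr_le1// enorm_ge0.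
Qed.

Lemma pw_le1 x : pev pw x <= 1.
Proof. by rewrite pev_pw gerBl sqr_ge0. Qed.

Lemma open_unit_ball_sub : open_unit_ball `<=` (unit_ball : set 'rV[R]_d).
Proof. by rewrite open_unit_ballE unit_ballE => x /= /ltW. Qed.

Lemma open_open_unit_ball : open (open_unit_ball : set 'rV[R]_d).
Proof.
rewrite open_unit_ballE (_ : mkset _ = pev pw @^-1` [set t | 0 < t])//.
by apply: open_comp => [x _|]; [exact: continuous_pev|exact: open_gt].
Qed.

Lemma measurable_open_unit_ball : measurable (open_unit_ball : set 'rV[R]_d).
Proof. exact: open_rV_measurable open_open_unit_ball. Qed.

Lemma closed_pw_ge (e : R) : closed [set x : 'rV[R]_d | e <= pev pw x].
Proof.
rewrite (_ : mkset _ = pev pw @^-1` [set t | e <= t])//.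
by apply: closed_comp => [x _|]; [exact: continuous_pev|exact: closed_ge].
Qed.

Lemma measurable_unit_ball : measurable (unit_ball : set 'rV[R]_d).
Proof. by apply: closed_rV_measurable; rewrite unit_ballE; exact: closed_pw_ge. Qed.

Lemma coord_le1 x i : unit_ball x -> `|x ord0 i| <= 1.
Proof.
rewrite unit_ballE /= pev_pw enorm_sqr subr_ge0 => h.
rewrite -(@expr_le1 _ 2)// real_normK ?num_real//; apply: le_trans h.
by rewrite (bigD1 i)//= lerDl sumr_ge0// => j _; exact: sqr_ge0.
Qed.

Lemma compact_pw_ge (e : R) : 0 <= e -> compact [set x : 'rV[R]_d | e <= pev pw x].
Proof.
move=> e0; apply: (@subclosed_compact _ _
    [set x : 'rV[R]_d | forall i, `[-1, 1]%classic (x ord0 i)]).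
- exact: closed_pw_ge.
- by apply: (@rV_compact _ _ (fun=> `[(-1 : R), 1]%classic)) => _; exact: segment_compact.
move=> x /= ex i; rewrite in_itv /= -ler_norml; apply: coord_le1.
by rewrite unit_ballE /= (le_trans e0).
Qed.

Lemma lebesgue_unit_ball_lty : (lebesgue_rV d (unit_ball : set 'rV[R]_d) < +oo)%E.
Proof.
pose a : 'rV[R]_d := \row_i (-1); pose b : 'rV[R]_d := \row_i 1.
have ab i : a ord0 i <= b ord0 i by rewrite !mxE; lra.
pose B := [set x : 'rV[R]_d | forall i, a ord0 i <= x ord0 i <= b ord0 i].
apply: (@le_lt_trans _ _ (lebesgue_rV d B)).
  apply: le_measure; rewrite ?inE; first exact: measurable_unit_ball.
    rewrite (_ : B = [set x : 'rV[R]_d | forall i, `[-1, 1]%classic (x ord0 i)]).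
      apply: compact_rV_measurable.
      by apply: (@rV_compact _ _ (fun=> `[(-1 : R), 1]%classic)) => _; exact: segment_compact.
    by apply/seteqP; split => x /= h i; have := h i; rewrite /= in_itv !mxE.
  by move=> x xb i; rewrite !mxE -ler_norml; exact: coord_le1.
by rewrite /B lebesgue_rV_box// ltry.
Qed.

End UnitBall.

Section Slices.
Context {R : realType}.

Lemma integral_rV_S n (f : 'rV[R]_n.+1 -> \bar R) :
  (lebesgue_rV n.+1).-integrable setT f ->
  [/\ (lebesgue_measure \x lebesgue_rV n)%E.-integrable setT (f \o @rV_cons R n) &
  (\int[lebesgue_rV n.+1]_x f x =
   \int[lebesgue_measure \x lebesgue_rV n]_p f (rV_cons p))%E].
Proof.
move=> intf; have mf : measurable_fun setT f by case/integrableP : intf.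
have mc := @measurable_rV_cons R n.
have e A : measurable A -> A `<=` setT -> lebesgue_rV n.+1 A =
   pushforward (lebesgue_measure \x lebesgue_rV n)%E (@rV_cons R n) A by [].
have intc : (lebesgue_measure \x lebesgue_rV n)%E.-integrable setT (f \o @rV_cons R n).
  apply/integrableP; split; first exact: measurableT_comp.
  case/integrableP : intf => _; rewrite (eq_measure_integral _ e).
  by rewrite (ge0_integral_pushforward mc)//; exact: measurableT_comp.
split => //; rewrite (eq_measure_integral _ e).
by rewrite (integral_pushforward mc).
Qed.

End Slices.

(** * The divergence theorem for compactly supported fields *)

Section Divergence.
Context {R : realType}.

Definition box n (M : R) : set 'rV[R]_n := [set x | forall i, - M <= x ord0 i <= M].

Lemma box_compact n M : compact (@box n M).
Proof.
have := @rV_compact R n (fun=> `[(- M : R), M]%classic) (fun=> @segment_compact _ _ _).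
by congr compact; apply/seteqP; split => x /= h i; have := h i; rewrite /= in_itv.
Qed.

Lemma box_lty n M : 0 <= M -> (lebesgue_rV n (@box n M) < +oo)%E.
Proof.
move=> M0; pose a : 'rV[R]_n := \row_i (- M); pose b : 'rV[R]_n := \row_i M.
rewrite (_ : box M = [set x : 'rV[R]_n | forall i, a ord0 i <= x ord0 i <= b ord0 i]).
  by rewrite lebesgue_rV_box ?ltry// => i; rewrite !mxE; lra.
by apply/seteqP; split => x /= h i; have := h i; rewrite !mxE.
Qed.

Lemma compact_bounded_fun n (K : set 'rV[R]_n) (g : 'rV[R]_n -> R) :
  compact K -> continuous g -> exists2 C : R, 0 <= C & forall x, K x -> `|g x| <= C.
Proof.
move=> cK cg; have cgK : compact (g @` K).
  by apply: continuous_compact => //; exact: continuous_subspaceT.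
have [M [Mr hM]] := compact_bounded cgK.
exists (`|M| + 1) => [|x Kx]; first by rewrite addr_ge0.
apply: hM; last by exists x.
by rewrite (le_lt_trans (ler_norm M))// ltrDl.
Qed.

Lemma integrable_indic_lty d (T : measurableType d) (m : {measure set T -> \bar R})
    (A : set T) : measurable A -> (m A < +oo)%E ->
  m.-integrable setT (fun x => (\1_A x)%:E).
Proof.
move=> mA Aoo; apply/integrableP; split; first exact/measurable_EFinP.
rewrite (eq_integral (fun x => (\1_A x)%:E)) => [|x _]; last first.
  by rewrite gee0_abs// lee_fin.
by rewrite integral_indic// setIT.
Qed.

Lemma integrable_compact_support n (K : set 'rV[R]_n) (g : 'rV[R]_n -> R) M :
  compact K -> K `<=` box M -> continuous g -> (forall x, ~ K x -> g x = 0) ->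
  (lebesgue_rV n).-integrable setT (EFin \o g).
Proof.
move=> cK KM cg gK; have [C C0 hC] := compact_bounded_fun cK cg.
have mg := continuous_rV_measurable cg.
have mK := compact_rV_measurable cK.
apply: (@le_integrable _ _ _ _ _ measurableT _ (fun x => (C * \1_K x)%:E)).
- exact/measurable_EFinP.
- move=> x _ /=; rewrite lee_fin indicE.
  have [xK|xK] := boolP (x \in K).
    by rewrite mulr1 (le_trans (hC _ (set_mem xK)))// ler_norm.
  by rewrite gK ?normr0 ?mulr0//; move=> /mem_set; exact/negP.
rewrite (_ : (fun _ => _) = (fun x => C%:E * (\1_K x)%:E)%E); last first.
  by apply/funext => x; rewrite EFinM.
apply: integrableZl => //.
have [M0|M0] := leP 0 M.
  apply: integrable_indic_lty => //.
  apply: le_lt_trans (box_lty n M0); apply: le_measure; rewrite ?inE//.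
  by apply: compact_rV_measurable; exact: box_compact.
apply: integrable_indic_lty => //.
apply: le_lt_trans (box_lty n (lexx 0)); apply: le_measure; rewrite ?inE//.
  by apply: compact_rV_measurable; exact: box_compact.
by move=> x /KM h i; have := h i; lra.
Qed.

Lemma integral_derivative_box (psi g : R -> R) (M : R) : 0 < M -> continuous g ->
  (forall x : R, is_derive x 1 psi (g x)) ->
  (forall x, M < `|x| -> psi x = 0) -> (forall x, M < `|x| -> g x = 0) ->
  (\int[lebesgue_measure]_x (g x)%:E = 0)%E.
Proof.
move=> M0 cg dpsi psi0 g0.
have cpsi : continuous psi.
  move=> x; apply/differentiable_continuous/derivable1_diffP; exact: ex_derive.
pose N : R := M + 1; pose I : set R := `[- N, N]%classic.
rewrite (_ : (\int[_]_x _ = \int[lebesgue_measure]_(x in I) (g x)%:E)%E); last first.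
  rewrite [RHS]integral_mkcond; apply: eq_integral => x _; rewrite patchE.
  case: ifPn => // /negP h; rewrite g0// ltNge; apply/negP => xM; apply: h.
  rewrite inE /I /= in_itv /= -ler_norml; apply: le_trans xM _; rewrite /N; lra.
rewrite (@continuous_FTC2 _ _ psi).
- by rewrite psi0 ?psi0 ?sube0//; rewrite ?normrN ger0_norm /N; lra.
- rewrite /N; lra.
- exact: continuous_subspaceT.
- split => [x _||]; first exact: ex_derive.
    by apply: cvg_at_right_filter; exact: cpsi.
  by apply: cvg_at_left_filter; exact: cpsi.
- by move=> x _; rewrite derive1E derive_val.
Qed.

Lemma is_derive_rV_cons0 n (psi : 'rV[R]_n.+1 -> R) (g : 'rV[R]_n.+1 -> R) a y :
  is_derive (rV_cons (a, y)) (delta_mx ord0 ord0) psi (g (rV_cons (a, y))) ->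
  is_derive (a : R) 1 (fun b => psi (rV_cons (b, y))) (g (rV_cons (a, y))).
Proof.
move=> [dpsi <-].
have e : (fun h : R => h^-1 *: (((fun b => psi (rV_cons (b, y))) \o shift a) (h *: 1) -
    psi (rV_cons (a, y)))) =
  (fun h => h^-1 *: ((psi \o shift (rV_cons (a, y))) (h *: delta_mx ord0 ord0) -
     psi (rV_cons (a, y)))).
  apply/funext => h /=; congr (_ *: (psi _ - _)); apply/rowP => i.
  rewrite [RHS]mxE; case: (unliftP ord0 i) => [j|] ->.
    by rewrite !rV_consS !mxE /= mulr0 add0r.
  by rewrite !rV_cons0 !mxE eqxx.
by split; rewrite /derivable /derive e.
Qed.

Lemma is_derive_rV_consS n (psi : 'rV[R]_n.+1 -> R) (g : 'rV[R]_n.+1 -> R) a y i :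
  is_derive (rV_cons (a, y)) (delta_mx ord0 (lift ord0 i)) psi (g (rV_cons (a, y))) ->
  is_derive y (delta_mx ord0 i) (fun z => psi (rV_cons (a, z))) (g (rV_cons (a, y))).
Proof.
move=> [dpsi <-].
have e : (fun h : R => h^-1 *: (((fun z => psi (rV_cons (a, z))) \o shift y) (h *: delta_mx ord0 i) -
    psi (rV_cons (a, y)))) =
  (fun h => h^-1 *: ((psi \o shift (rV_cons (a, y))) (h *: delta_mx ord0 (lift ord0 i)) -
     psi (rV_cons (a, y)))).
  apply/funext => h /=; congr (_ *: (psi _ - _)); apply/rowP => k.
  rewrite [RHS]mxE; case: (unliftP ord0 k) => [j|] ->.
    by rewrite !rV_consS !mxE /= (inj_eq lift_inj).
  by rewrite !rV_cons0 !mxE /= mulr0 add0r.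
by split; rewrite /derivable /derive e.
Qed.

Lemma continuous_rV_consl n (y : 'rV[R]_n) : continuous (fun a : R => rV_cons (a, y)).
Proof.
move=> a /= A /nbhs_ballP[e /= e0 eA]; apply/nbhs_ballP; exists e => //= b ab.
apply: eA; split => // i j; rewrite ord1; case: (unliftP ord0 j) => [k|] ->.
  by rewrite !rV_consS; exact: ballxx.
by rewrite !rV_cons0.
Qed.

Lemma continuous_rV_consr n (a : R) : continuous (fun y : 'rV[R]_n => rV_cons (a, y)).
Proof.
move=> y /= A /nbhs_ballP[e /= e0 eA]; apply/nbhs_ballP; exists e => //= z [_ yz].
apply: eA; split => // i j; rewrite ord1; case: (unliftP ord0 j) => [k|] ->.
  by rewrite !rV_consS; exact: yz.
by rewrite !rV_cons0; exact: ballxx.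
Qed.

(** By Fubini's theorem the variable of differentiation can be integrated first,
    where the fundamental theorem of calculus gives 0. *)
Lemma integral_partial n (psi g : 'rV[R]_n -> R) (i : 'I_n) (M : R) :
  0 < M -> continuous g ->
  (forall x, is_derive x (delta_mx ord0 i) psi (g x)) ->
  (forall x, ~ box M x -> psi x = 0) -> (forall x, ~ box M x -> g x = 0) ->
  (\int[lebesgue_rV n]_x (g x)%:E = 0)%E.
Proof.
move=> M0; elim: n psi g i => [|n IH] psi g i; first by case: i.
move=> cg dpsi psi0 g0.
have ig := integrable_compact_support (@box_compact n.+1 M) (@subset_refl _ _) cg g0.
have [ic ->] := integral_rV_S ig.
case: (unliftP ord0 i) => [j|] ij; rewrite {}ij in dpsi.
  rewrite -(integral12_prod_meas1 ic) (eq_integral (cst 0%E)) ?integral0// => a _.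
  apply: (IH (fun y => psi (rV_cons (a, y))) (fun y => g (rV_cons (a, y))) j).
  - by move=> y; apply: continuous_comp; [exact: continuous_rV_consr|exact: cg].
  - by move=> y; exact: is_derive_rV_consS.
  - move=> y yM; apply: psi0 => h; apply: yM => k.
    by have := h (lift ord0 k); rewrite rV_consS.
  - move=> y yM; apply: g0 => h; apply: yM => k.
    by have := h (lift ord0 k); rewrite rV_consS.
rewrite -(integral21_prod_meas1 ic) (eq_integral (cst 0%E)) ?integral0// => y _.
apply: (@integral_derivative_box (fun a => psi (rV_cons (a, y))) (fun a => g (rV_cons (a, y))) M) => //.
- by move=> a; apply: continuous_comp; [exact: continuous_rV_consl|exact: cg].
- by move=> a; exact: is_derive_rV_cons0.
- move=> a aM; apply: psi0 => /(_ ord0); rewrite rV_cons0 -ler_norml => h.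
  by move: aM; rewrite ltNge h.
- move=> a aM; apply: g0 => /(_ ord0); rewrite rV_cons0 -ler_norml => h.
  by move: aM; rewrite ltNge h.
Qed.

(** A line parallel to the first axis meets the sphere in at most two points. *)
Lemma sphere_null n : (0 < n)%N ->
  lebesgue_rV n [set x : 'rV[R]_n | pev pw x = 0] = 0%E.
Proof.
case: n => // n _; set S := [set x | _].
have mS : measurable S.
  rewrite (_ : S = [set x | 0 <= pev pw x] `\` [set x | 0 < pev pw x]).
    apply: measurableD; first by apply: closed_rV_measurable; exact: closed_pw_ge.
    by rewrite -open_unit_ballE; exact: measurable_open_unit_ball.
  apply/seteqP; split => x /=; rewrite /S /=; first by move=> ->; rewrite ltxx.
  by move=> [h1 /negP]; rewrite -leNgt => h2; apply/eqP; rewrite eq_le h1 h2.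
have mT : measurable (@rV_cons R n @^-1` S).
  by rewrite -[X in measurable X]setTI; exact: measurable_rV_cons.
rewrite -(setIT S) -integral_indic//=.
have mi : measurable_fun setT (fun p => (\1_(@rV_cons R n @^-1` S) p : R)%:E).
  by apply/measurable_EFinP; exact: measurable_indic.
rewrite integral_indic// setIT.
rewrite -[LHS]/((lebesgue_measure \x lebesgue_rV n)%E (@rV_cons R n @^-1` S)).
rewrite -[X in _ X = _]setIT -integral_indic//= fubini_tonelli2//.
rewrite (eq_integral (cst 0%E)) ?integral0// => y _; rewrite /fubini_G /=.
pose c := 1 - \sum_(i < n) y ord0 i ^+ 2.
have F2 : [set a : R | S (rV_cons (a, y))] `<=` [set Num.sqrt c; - Num.sqrt c].
  move=> a; rewrite /S /= pev_pw enorm_sqr big_ord_recl rV_cons0 /=.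
  rewrite (eq_bigr (fun i => y ord0 i ^+ 2)) => [h|i _]; last by rewrite rV_consS.
  have ac : a ^+ 2 = c by apply/eqP; rewrite -subr_eq0 /c -oppr_eq0 -[X in _ == X]h; apply/eqP; ring.
  have [a0|a0] := lerP 0 a; [left|right]; rewrite /= -ac sqrtr_sqr.
    by rewrite ger0_norm.
  by rewrite ltr0_norm// opprK.
have fS : finite_set [set a : R | S (rV_cons (a, y))].
  by apply: sub_finite_set F2 _; exact: finite_set2.
rewrite -[LHS]/(\int[lebesgue_measure]_a
  (\1_[set a : measurableTypeR R | S (rV_cons (a, y))] a)%:E)%E.
rewrite integral_indic//; last first.
  apply: countable_measurable; last exact: finite_set_countable.
  by move=> t; exact: measurable_set1.
rewrite setIT; apply: countable_lebesgue_measure0; exact: finite_set_countable.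
Qed.

End Divergence.

(** * Smooth cutoffs of powers in one variable *)

Section Bumps.
Context {R : realType}.
Implicit Types (P : {poly R}) (a e t u v : R).

(** The polynomial P and the exponential are taken at u = 1/(v - 1). Letting P vary
    makes the class stable under differentiation, and P(0) is the limit for large
    v. *)
Definition bump P v : R :=
  if 1 < v then P.[(v - 1)^-1] * expR (- (v - 1)^-1) else 0.

Lemma bump0 P v : v <= 1 -> bump P v = 0.
Proof. by move=> v1; rewrite /bump ltNge v1. Qed.

Lemma pow_expR_le n u : 0 <= u -> u ^+ n * expR (- u) <= n%:R ^+ n.
Proof.
move=> u0; rewrite expRN ler_pdivrMr ?expR_gt0//.
case: n => [|n]; first by rewrite !expr0 mul1r -[leLHS]expR0 ler_expR.
have -> : u = n.+1%:R * (u / n.+1%:R) by rewrite mulrCA divff ?mulr1// pnatr_eq0.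
rewrite expRM_natl exprMn ler_wpM2l ?exprn_ge0//.
apply: lerXn2r; rewrite ?nnegrE ?expR_ge0 ?divr_ge0//.
by apply: le_trans (expR_ge1Dx _); rewrite lerDr.
Qed.

Lemma poly_expR_bounded P :
  exists2 C, 0 <= C & forall u, 0 <= u -> `|P.[u] * expR (- u)| <= C.
Proof.
exists (\sum_(i < size P) `|P`_i| * i%:R ^+ i).
  by apply: sumr_ge0 => i _; rewrite mulr_ge0// exprn_ge0.
move=> u u0; rewrite horner_coef mulr_suml.
apply: le_trans (ler_norm_sum _ _ _) _; apply: ler_sum => i _.
rewrite !normrM -mulrA (ger0_norm (expR_ge0 _)) (ger0_norm (exprn_ge0 _ u0)).
by rewrite ler_wpM2l// pow_expR_le.
Qed.

Lemma bump_bounded P : exists2 C, 0 <= C & forall v, `|bump P v| <= C.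
Proof.
have [C C0 hC] := poly_expR_bounded P; exists C => // v.
rewrite /bump; case: ifPn => [v1|_]; last by rewrite normr0.
by apply: hC; rewrite invr_ge0 subr_ge0 ltW.
Qed.

(** Flatness at v = 1, where the two branches of bump meet *)
Lemma bump_quadratic P : exists2 C, 0 <= C & forall v, `|bump P v| <= C * (v - 1) ^+ 2.
Proof.
have [C C0 hC] := poly_expR_bounded ('X^2 * P); exists C => // v.
rewrite /bump; case: ifPn => [v1|_]; last by rewrite normr0 mulr_ge0// sqr_ge0.
have v0 : 0 < v - 1 by rewrite subr_gt0.
have u0 : 0 <= (v - 1)^-1 by rewrite invr_ge0 ltW.
have h := hC _ u0.
rewrite !hornerE -mulrA normrM (ger0_norm (exprn_ge0 2 u0)) in h.
by rewrite -(ler_pdivrMr _ _ (exprn_gt0 2 v0)) mulrC -exprVn.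
Qed.

(** The derivative of bump P in terms of u = 1/(v - 1), for which du = - u^2 dv *)
Definition bder P : {poly R} := 'X^2 * (P - P^`()).

Lemma near_bump P v : 1 < v ->
  \near v, P.[(v - 1)^-1] * expR (- (v - 1)^-1) = bump P v.
Proof. by move=> v1; near=> y; rewrite /bump ifT//; near: y; exact: lt_nbhsr. Unshelve. all: by end_near. Qed.

Lemma is_derive_bump P v : is_derive v 1 (bump P) (bump (bder P) v).
Proof.
have [v1|v1|v1] := ltgtP v 1.
- rewrite (bump0 _ (ltW v1)); apply: (@near_eq_is_derive _ _ _ (cst 0)).
    near=> y; rewrite bump0//; near: y; apply: lt_le_nbhsl => //.
- apply: (near_eq_is_derive (near_bump _ v1)).
  have v0 : v - 1 != 0 by rewrite gt_eqF// subr_gt0.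
  have dinv : is_derive v 1 (fun y => (y - 1)^-1) (- (v - 1) ^- 2).
    have : is_derive v 1 (fun y : R => y - 1) 1.
      by rewrite -[X in is_derive _ _ _ X]subr0; apply: is_deriveB.
    move=> h; apply: is_derive_eq (@is_deriveV R (fun y : R => y - 1) v 1 1 v0 h) _.
    by rewrite /GRing.scale /= mulr1.
  have dP : is_derive v 1 (fun y => P.[(y - 1)^-1]) (P^`().[(v - 1)^-1] * - (v - 1) ^- 2).
    have hP : is_derive (v - 1)^-1 1 (horner P) (P^`().[(v - 1)^-1]).
      by rewrite derivE derive1E; apply: derivableP; exact: derivable_horner.
    exact: (@is_derive1_comp _ (horner P) (fun y => (y - 1)^-1) v _ _ hP dinv).
  have dE : is_derive v 1 (fun y => expR (- (y - 1)^-1)) ((v - 1) ^- 2 * expR (- (v - 1)^-1)).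
    have dN : is_derive v 1 (fun y => - (y - 1)^-1) ((v - 1) ^- 2).
      by rewrite -[X in is_derive _ _ _ X]opprK; apply: is_deriveN.
    rewrite [X in is_derive _ _ _ X]mulrC.
    exact: (@is_derive1_comp _ expR (fun y => - (y - 1)^-1) v _ _ (is_derive_expR _) dN).
  have -> : bump (bder P) v = P.[(v - 1)^-1] *: ((v - 1) ^- 2 * expR (- (v - 1)^-1))
     + expR (- (v - 1)^-1) *: (P^`().[(v - 1)^-1] * - (v - 1) ^- 2).
    by rewrite /bump v1 /bder !hornerE exprVn /GRing.scale /=; ring.
  exact: is_deriveM.
- rewrite {}v1 bump0//; have [C C0 hC] := bump_quadratic P.
  have cv : (fun h : R => h^-1 *: ((bump P \o shift 1) (h *: 1) - bump P 1))
      @ 0^' --> (0 : R).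
    apply/cvgrPdist_le => /= e e0.
    have C1 : 0 < C + 1 by rewrite ltr_wpDl.
    near=> h; rewrite sub0r normrN (bump0 _ (lexx 1)) subr0 normrM normfV.
    have h0 : h != 0 by near: h; exact: nbhs_dnbhs_neq.
    rewrite ler_pdivrMl ?normr_gt0//.
    apply: le_trans (hC _) _; rewrite /GRing.scale /= mulr1 addrK.
    rewrite -(real_normK (num_real h)) expr2 mulrA [leRHS]mulrC.
    rewrite ler_wpM2r//; apply: (@le_trans _ _ ((C + 1) * `|h|)).
      by rewrite ler_wpM2r// lerDl.
    rewrite -ler_pdivlMl// mulrC; near: h; apply: dnbhs0_le; exact: divr_gt0.
  split; first by apply/cvg_ex; exists 0.
  exact: cvg_lim cv.
Unshelve. all: by end_near. Qed.

(** The operator v d/dv in terms of u, where v = (1 + u) / u. Its values vanish at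
    u = 0, so that differentiating a cutoff leaves no trace in the limit. *)
Definition theta P : {poly R} := ('X + 'X^2) * (P - P^`()).

Lemma theta0 P : (theta P).[0] = 0.
Proof. by rewrite /theta !hornerE /=; ring. Qed.

Lemma bump_theta P v : v * bump (bder P) v = bump (theta P) v.
Proof.
rewrite /bump; case: ifPn => [v1|_]; last by rewrite mulr0.
have v0 : v - 1 != 0 by rewrite gt_eqF// subr_gt0.
have vu : v * (v - 1)^-1 ^+ 2 = (v - 1)^-1 + (v - 1)^-1 ^+ 2 by field.
rewrite /bder /theta !(hornerM, hornerD, hornerN, hornerX) -expr2 -vu; ring.
Qed.

Lemma bump_cvg P v : 0 < v -> bump P (n%:R * v) @[n --> \oo] --> P.[0].
Proof.
move=> v0; pose g u := P.[u] * expR (- u).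
have cg : {for 0, continuous g}.
  apply: cvgM; first exact: continuous_horner.
  by apply: continuous_comp; [exact: opp_continuous|exact: continuous_expR].
have gE : g 0 = P.[0] by rewrite /g oppr0 expR0 mulr1.
have cu : (n%:R * v - 1)^-1 @[n --> \oo] --> (0 : R).
  apply/cvgrPdist_le => /= e e0; near=> n.
  have h : e^-1 <= n%:R * v - 1.
    rewrite lerBrDr -ler_pdivrMr//; near: n; exact: nbhs_infty_ger.
  have h0 : 0 < e^-1 by rewrite invr_gt0.
  rewrite sub0r normrN ger0_norm ?invr_ge0 ?(le_trans (ltW h0))//.
  by rewrite -[leRHS]invrK lef_pV2// posrE// (lt_le_trans h0).
have := cvg_comp _ _ cu cg; rewrite gE; apply: cvg_trans.
apply: near_eq_cvg; near=> n; rewrite /= /bump ifT//.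
rewrite mulrC -ltr_pdivrMl// mulr1; near: n; exact: nbhs_infty_gtr.
Unshelve. all: by end_near. Qed.

(** The power t^a, set to 0 for t <= e and tending to P(0) t^a when e tends to 0 *)
Definition cutpow a P e t : R := t `^ a * bump P (t / e).

Lemma cutpow0 a P e t : 0 < e -> t <= e -> cutpow a P e t = 0.
Proof. by move=> e0 te; rewrite /cutpow bump0 ?mulr0// ler_pdivrMr// mul1r. Qed.

Lemma cutpowS a P e t : 0 < e -> cutpow (a + 1) P e t = t * cutpow a P e t.
Proof.
move=> e0; have [te|te] := leP t e; first by rewrite !cutpow0// mulr0.
have t0 : 0 < t by apply: lt_trans te.
rewrite /cutpow powRD; last by rewrite (lt0r_neq0 t0) implybT.
by rewrite powRr1 ?ltW//; ring.
Qed.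

Lemma is_derive_cutpow a P e t : 0 < e ->
  is_derive t 1 (cutpow (a + 1) P e)
    ((a + 1) * cutpow a P e t + cutpow a (theta P) e t).
Proof.
move=> e0; have [te|te] := ltP t e.
  rewrite !cutpow0 ?ltW// mulr0 add0r; apply: (@near_eq_is_derive _ _ _ (cst 0)).
    near=> y; rewrite cutpow0//; near: y; exact: lt_le_nbhsl.
have t0 : 0 < t by apply: lt_le_trans te.
have d1 := is_derive1_powR (a + 1) t0; rewrite addrK in d1.
have d2 : is_derive t 1 (fun y => bump P (y / e)) (bump (bder P) (t / e) / e).
  have dl : is_derive t 1 (fun y : R => y / e) e^-1.
    apply: is_derive_eq (@is_deriveM R R id (cst e^-1) t 1 1 0 (is_derive_id _ _) (is_derive_cst _ _ _)) _.
    by rewrite /GRing.scale /= mulr0 add0r mulr1.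
  exact: (@is_derive1_comp _ (bump P) (fun y => y / e) t _ _ (is_derive_bump _ _) dl).
have -> : (a + 1) * cutpow a P e t + cutpow a (theta P) e t =
  t `^ (a + 1) *: (bump (bder P) (t / e) / e) + bump P (t / e) *: ((a + 1) * t `^ a).
  rewrite /cutpow -bump_theta powRD; last by rewrite (lt0r_neq0 t0) implybT.
  by rewrite powRr1 ?ltW// /GRing.scale /=; field; rewrite gt_eqF.
exact: is_deriveM.
Unshelve. all: by end_near. Qed.

End Bumps.

(** * Cut off weighted polynomials as test functions *)

Section CutoffSums.
Context {R : realType} {d : nat}.
Local Notation P := (mpoly.mpoly d R).
Local Notation C c := (mpoly.mpolyC d c).
Implicit Types (a e : R) (i j : 'I_d) (L : seq (P * {poly R})) (x : 'rV[R]_d).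

Lemma is_derive_line (V : normedModType R) (f : V -> R) (x v : V) df :
  is_derive x v f df <-> is_derive (0 : R) 1 (fun h : R => f (h *: v + x)) df.
Proof.
have e : (fun h : R => h^-1 *: ((f \o shift x) (h *: v) - f x)) =
  (fun h : R => h^-1 *: (((fun h : R => f (h *: v + x)) \o shift 0) (h *: 1) -
     (fun h : R => f (h *: v + x)) 0)).
  by apply/funext => h /=; rewrite addr0 scale0r add0r /GRing.scale /= mulr1.
by split=> -[h1 h2]; split; move: h1 h2; rewrite /derivable /derive e.
Qed.

Lemma is_derive_comp_real (V : normedModType R) (f : V -> R) (g : R -> R) (x v : V) df dg :
  is_derive x v f df -> is_derive (f x) 1 g dg ->
  is_derive x v (g \o f) (dg * df).
Proof.
move=> /is_derive_line hf hg; apply/is_derive_line.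
apply: (@is_derive1_comp R g (fun h : R => f (h *: v + x)) 0) => //.
by rewrite scale0r add0r.
Qed.

(** The functions q w^a are not test functions. Their cutoffs q(x) w^a e_P(w) are,
    with e_P the bump of P at scale e, and sums of such terms over a list of pairs
    (q, P) form a class stable under all operators that are used here. *)
Definition atom e a (l : P * {poly R}) x : R :=
  pev l.1 x * cutpow a l.2 e (pev pw x).

Definition cutsum e a L x : R := \sum_(l <- L) atom e a l x.

(** The image under d_i of q w^(a+1) e_P(w) is
    w^a ((dq a i q) e_P(w) - 2 x_i q e_(theta P)(w)). *)
Definition step a i L : seq (P * {poly R}) :=
  [seq (dq a i l.1, l.2) | l <- L] ++
  [seq (- 2%:R * (pX i * l.1), theta l.2) | l <- L].

(** The polynomial factor of w^a that remains when e tends to 0 *)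
Definition head L : P := \sum_(l <- L) C (l.2).[0] * l.1.

Lemma dqD a i (p q : P) : dq a i (p + q) = dq a i p + dq a i q.
Proof. by rewrite /dq pDD; ring. Qed.

Lemma dqCM a i c (p : P) : dq a i (C c * p) = C c * dq a i p.
Proof. by rewrite /dq pDCM; ring. Qed.

Lemma dq0 a i : dq a i (0 : P) = 0.
Proof. by rewrite /dq /pD mpoly.mderiv0; ring. Qed.

Lemma head_step a i L : head (step a i L) = dq a i (head L).
Proof.
rewrite /head /step big_cat !big_map /= [X in _ + X]big1 ?addr0; last first.
  by move=> l _; rewrite theta0 mpoly.mpolyC0 mul0r.
elim: L => [|l L IH]; first by rewrite !big_nil dq0.
by rewrite !big_cons IH dqD dqCM.
Qed.

Lemma pev_dq a i (p : P) x : pev (dq a i p) x =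
  pev pw x * pev (pD i p) x - 2 * (a + 1) * (x ord0 i * pev p x).
Proof. by rewrite /dq pevB pevM pevM pevM pevC pevX. Qed.

Lemma pev_ang i j (p : P) x :
  pev (ang i j p) x = x ord0 i * pev (pD j p) x - x ord0 j * pev (pD i p) x.
Proof. by rewrite /ang pevB !pevM !pevX. Qed.

Lemma is_derive_atom e a i l x : 0 < e ->
  is_derive x (delta_mx ord0 i) (atom e (a + 1) l)
   (atom e a (dq a i l.1, l.2) x + atom e a (- 2%:R * (pX i * l.1), theta l.2) x).
Proof.
move=> e0; have d1 := is_derive_pev l.1 x i.
have d2 := is_derive_comp_real (is_derive_pev pw x i) (is_derive_cutpow a l.2 (pev pw x) e0).
apply: is_derive_eq (is_deriveM d1 d2) _.
rewrite /atom /GRing.scale /= cutpowS// pD_pw pev_dq !pevM pevX pevN pev_nat.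
ring.
Qed.

Lemma atomC0 e a (p : P) (Q : {poly R}) x : 0 < e -> pev pw x <= e ->
  atom e a (p, Q) x = 0.
Proof. by move=> e0 xe; rewrite /atom cutpow0// mulr0. Qed.

Lemma cutsum0 e a L x : 0 < e -> pev pw x <= e -> cutsum e a L x = 0.
Proof. by move=> e0 xe; rewrite /cutsum big1// => -[p Q] _; rewrite atomC0. Qed.

Lemma cutsum_cons e a l L : cutsum e a (l :: L) = atom e a l + cutsum e a L.
Proof. by apply/funext => x; rewrite /cutsum big_cons. Qed.

Lemma cutsum_nil e a : cutsum e a [::] = cst 0.
Proof. by apply/funext => x; rewrite /cutsum big_nil. Qed.

Lemma cutsum_step_cons e a i l L x : cutsum e a (step a i (l :: L)) x =
  atom e a (dq a i l.1, l.2) x + atom e a (- 2%:R * (pX i * l.1), theta l.2) x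
  + cutsum e a (step a i L) x.
Proof. by rewrite /cutsum /step /= !(big_cons, big_cat) /=; ring. Qed.

Lemma is_derive_cutsum e a i L x : 0 < e ->
  is_derive x (delta_mx ord0 i) (cutsum e (a + 1) L) (cutsum e a (step a i L) x).
Proof.
move=> e0; elim: L => [|l L IH].
  by rewrite cutsum_nil /step /= cutsum_nil; exact: is_derive_cst.
rewrite cutsum_cons cutsum_step_cons; apply: is_deriveD => //.
exact: is_derive_atom.
Qed.

Lemma partial_cutsum e a i L : 0 < e ->
  partial i (cutsum e (a + 1) L) = cutsum e a (step a i L).
Proof.
move=> e0; apply/funext => x; rewrite /partial.
by case: (is_derive_cutsum a i L x e0).
Qed.

Lemma differentiable_cutsum e a L x : 0 < e -> differentiable (cutsum e a L) x.
Proof.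
move=> e0; elim: L => [|l L IH].
  by rewrite cutsum_nil; exact: differentiable_cst.
rewrite cutsum_cons; apply: differentiableD => //.
rewrite (_ : atom e a l = pev l.1 * (cutpow a l.2 e \o pev pw)); last by apply/funext.
apply: differentiableM; first exact: differentiable_pev.
apply: differentiable_comp; first exact: differentiable_pev.
apply/derivable1_diffP; rewrite -(subrK 1 a).
by have [] := is_derive_cutpow (a - 1) l.2 (pev pw x) e0.
Qed.

Lemma continuous_cutsum e a L : 0 < e -> continuous (cutsum e a L).
Proof. by move=> e0 x; apply: differentiable_continuous; exact: differentiable_cutsum. Qed.

(** All iterated derivatives are again cutsums, for smaller exponents. *)
Lemma smooth_cutsum e a L : 0 < e -> smooth (cutsum e a L).
Proof.
move=> e0 s x.
have [a' [L' ->]] : exists a' L', foldr partial (cutsum e a L) s = cutsum e a' L'.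
  elim: s => [|i s [a' [L' /= ->]]]; first by exists a, L.
  by exists (a' - 1), (step (a' - 1) i L'); rewrite -partial_cutsum// subrK.
exact: differentiable_cutsum.
Qed.

Lemma test_cutsum e a L : 0 < e -> test_function (cutsum e a L).
Proof.
move=> e0; split; first exact: smooth_cutsum.
exists [set x : 'rV[R]_d | e <= pev pw x]; split.
- by apply: compact_pw_ge; exact: ltW.
- by move=> x /= ex; rewrite open_unit_ballE /=; exact: lt_le_trans ex.
- by move=> x /= /negP; rewrite -ltNge => ex; rewrite cutsum0// ltW.
Qed.

Definition lmul (p : P) L := [seq (p * l.1, l.2) | l <- L].

Lemma cutsum_lmul e a p L x : cutsum e a (lmul p L) x = pev p x * cutsum e a L x.
Proof.
rewrite /cutsum /lmul big_map mulr_sumr; apply: eq_bigr => l _.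
by rewrite /atom /= pevM mulrA.
Qed.

Lemma cutsum_cat e a L1 L2 x :
  cutsum e a (L1 ++ L2) x = cutsum e a L1 x + cutsum e a L2 x.
Proof. by rewrite /cutsum big_cat. Qed.

Lemma head_cat L1 L2 : head (L1 ++ L2) = head L1 + head L2.
Proof. by rewrite /head big_cat. Qed.

(** D_(i,j) annihilates functions of w, hence acts on the polynomial factors
    only. *)
Definition langular i j L := [seq (ang i j l.1, l.2) | l <- L].

Lemma head_langular i j L : head (langular i j L) = ang i j (head L).
Proof.
rewrite /head /langular big_map; elim: L => [|l L IH]; rewrite ?big_nil ?big_cons.
  by rewrite /ang /pD !mpoly.mderiv0 !mulr0 subrr.
by rewrite angD angCM IH.
Qed.

Lemma angular_cutsum e a i j L x : 0 < e ->
  x ord0 i * partial j (cutsum e a L) x - x ord0 j * partial i (cutsum e a L) x =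
  cutsum e a (langular i j L) x.
Proof.
move=> e0; rewrite -(subrK 1 a) !partial_cutsum// -!pevX -!cutsum_lmul.
elim: L => [|l L IH]; first by rewrite /cutsum !big_nil subrr.
move: IH; rewrite /cutsum /lmul /step /langular /= !map_cat /= !(big_cons, big_cat) /=.
rewrite /atom /= !cutpowS// !pevM !pevN !pev_nat !pev_dq !pev_ang !pevX.
move=> IH.
set S := \sum_(l0 <- [seq (ang i j l0.1, l0.2) | l0 <- L]) _ in IH *.
rewrite -IH; ring.
Qed.

End CutoffSums.

(** * Integrals over the open ball *)

Section BallIntegrals.
Context {R : realType} {d : nat}.
Local Notation P := (mpoly.mpoly d R).
Local Notation C c := (mpoly.mpolyC d c).
Local Notation V := 'rV[R]_d.
Local Notation O := (open_unit_ball : set 'rV[R]_d).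
Local Notation mO := (@measurable_open_unit_ball R d).
Implicit Types (a e : R) (i j : 'I_d) (L : seq (P * {poly R})) (x : V) (g h : V -> R).

Definition Oint h : R := \int[lebesgue_rV d]_(x in O) h x.
Definition Ointg h : Prop := (lebesgue_rV d).-integrable O (EFin \o h).

Lemma eq_Oint g h : (forall x, O x -> g x = h x) -> Oint g = Oint h.
Proof. by move=> gh; apply: eq_Rintegral => x; rewrite inE => /gh. Qed.

Lemma eq_Ointg g h : (forall x, O x -> g x = h x) -> Ointg g -> Ointg h.
Proof.
move=> gh; apply: eq_integrable; first exact: mO.
by move=> x; rewrite inE => /gh /= ->.
Qed.

Lemma Ointg_measurable h : Ointg h -> measurable_fun O h.
Proof. by move=> /measurable_int /measurable_EFinP. Qed.

Lemma le_Ointg g h : measurable_fun O g ->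
  (forall x, O x -> `|g x| <= h x) -> Ointg h -> Ointg g.
Proof.
move=> mg gh; apply: le_integrable; first exact: mO.
  exact/measurable_EFinP.
by move=> x Ox /=; rewrite lee_fin (le_trans (gh x Ox))// ler_norm.
Qed.

Lemma OintgD g h : Ointg g -> Ointg h -> Ointg (fun x => g x + h x).
Proof. by move=> ig ih; have := integrableD mO ig ih. Qed.

Lemma OintgZ (c : R) h : Ointg h -> Ointg (fun x => c * h x).
Proof. by move=> ih; have := integrableZl mO c ih. Qed.

Lemma OintgN h : Ointg h -> Ointg (fun x => - h x).
Proof. by move=> ih; apply: eq_Ointg (OintgZ (-1) ih) => x _; rewrite mulN1r. Qed.

Lemma OintgB g h : Ointg g -> Ointg h -> Ointg (fun x => g x - h x).
Proof. by move=> ig ih; exact: OintgD ig (OintgN ih). Qed.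

Lemma Ointg0 : Ointg (fun=> 0).
Proof. exact: integrable0. Qed.

Lemma Ointg_sum (I : Type) (r : seq I) (F : I -> V -> R) :
  (forall k, Ointg (F k)) -> Ointg (fun x => \sum_(k <- r) F k x).
Proof.
move=> h; elim: r => [|k r IH].
  by apply: eq_Ointg Ointg0 => x _; rewrite big_nil.
by apply: eq_Ointg (OintgD (h k) IH) => x _; rewrite big_cons.
Qed.

Lemma OintD g h : Ointg g -> Ointg h ->
  Oint (fun x => g x + h x) = Oint g + Oint h.
Proof. by move=> ig ih; apply: RintegralD => //; exact: mO. Qed.

Lemma OintB g h : Ointg g -> Ointg h ->
  Oint (fun x => g x - h x) = Oint g - Oint h.
Proof. by move=> ig ih; apply: RintegralB => //; exact: mO. Qed.

Lemma OintZ c h : Ointg h -> Oint (fun x => c * h x) = c * Oint h.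
Proof. by move=> ih; apply: RintegralZl => //; exact: mO. Qed.

Lemma OintN h : Ointg h -> Oint (fun x => - h x) = - Oint h.
Proof.
by move=> ih; rewrite -mulN1r -OintZ//; apply: eq_Oint => x _; rewrite mulN1r.
Qed.

Lemma Oint0 : Oint (fun=> 0) = 0.
Proof. by rewrite -(mulr0 0) OintZ ?mul0r//; exact: Ointg0. Qed.

Lemma Oint_sum (I : Type) (r : seq I) (F : I -> V -> R) :
  (forall k, Ointg (F k)) -> Oint (fun x => \sum_(k <- r) F k x) = \sum_(k <- r) Oint (F k).
Proof.
move=> h; elim: r => [|k r IH].
  rewrite [RHS]big_nil -[RHS]Oint0; apply: eq_Oint => x _; exact: big_nil.
rewrite big_cons -IH -OintD//; last exact: Ointg_sum.
by apply: eq_Oint => x _; rewrite big_cons.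
Qed.

Lemma Oint_ge0 h : (forall x, O x -> 0 <= h x) -> 0 <= Oint h.
Proof. exact: Rintegral_ge0. Qed.

Lemma le_Oint g h : Ointg g -> Ointg h -> (forall x, O x -> g x <= h x) ->
  Oint g <= Oint h.
Proof. by move=> ig ih; apply: le_Rintegral => //; exact: mO. Qed.

Lemma EFin_Oint h : Ointg h ->
  (Oint h)%:E = (\int[lebesgue_rV d]_(x in O) (h x)%:E)%E.
Proof. by move=> ih; rewrite fineK//; apply: integrable_fin_num; [exact: mO|]. Qed.

Lemma ge0_Ointg h : measurable_fun O h -> (forall x, O x -> 0 <= h x) ->
  (\int[lebesgue_rV d]_(x in O) (h x)%:E < +oo)%E -> Ointg h.
Proof.
move=> mh h0 hoo; apply/integrableP; split; first exact/measurable_EFinP.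
rewrite (eq_integral (EFin \o h)) => [|x]; first exact: hoo.
by rewrite inE => Ox /=; rewrite ger0_norm ?h0.
Qed.

Lemma Ointg_cst (c : R) : Ointg (fun=> c).
Proof.
apply: (@eq_Ointg (fun x => c * \1_unit_ball x)) => [x Ox|].
  by rewrite indicE mem_set ?mulr1//; exact: open_unit_ball_sub.
apply: OintgZ; apply: integrableS (@measurableT _ _) mO (@subsetT _ _) _.
by apply: integrable_indic_lty; [exact: measurable_unit_ball|exact: lebesgue_unit_ball_lty].
Qed.

Lemma Ointg_norm h : Ointg h -> Ointg (fun x => `|h x|).
Proof.
move=> ih; apply: (@le_integrable _ _ _ _ _ mO _ (EFin \o h)) => //.
  apply/measurable_EFinP; apply: measurableT_comp => //; exact: Ointg_measurable.
by move=> x _ /=; rewrite normr_id.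
Qed.

Lemma Ointg_bounded g h (M : R) : measurable_fun O g ->
  (forall x, O x -> `|g x| <= M) -> Ointg h -> Ointg (fun x => g x * h x).
Proof.
move=> mg gM ih; have mh := Ointg_measurable ih.
apply: (@le_Ointg _ (fun x => M * `|h x|)).
- exact: measurable_funM.
- by move=> x Ox; rewrite normrM ler_wpM2r// gM.
- exact: OintgZ (Ointg_norm ih).
Qed.

Lemma pev_bounded (p : P) : exists2 M : R, 0 <= M & forall x, O x -> `|pev p x| <= M.
Proof.
have [M M0 hM] := @compact_bounded_fun R d [set x | 0 <= pev pw x] (pev p)
  (compact_pw_ge (lexx 0)) (@continuous_pev R d p).
by exists M => // x; rewrite open_unit_ballE => /= /ltW; exact: hM.
Qed.

Lemma pevM_Ointg p h : Ointg h -> Ointg (fun x => pev p x * h x).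
Proof.
by move=> ih; have [M _ hM] := pev_bounded p; apply: Ointg_bounded hM ih; exact: measurable_pev.
Qed.

Lemma weightE a x : weight a x = pev pw x `^ a.
Proof. by rewrite /weight pev_pw. Qed.

Lemma weight_ge0 a x : 0 <= weight a x.
Proof. by rewrite weightE powR_ge0. Qed.

Lemma weightD a b x : O x -> weight (a + b) x = weight a x * weight b x.
Proof.
rewrite open_unit_ballE /= => h; rewrite !weightE powRD// (lt0r_neq0 h).
by rewrite implybT.
Qed.

Lemma weightS a x : O x -> weight (a + 1) x = weight a x * pev pw x.
Proof.
move=> Ox; rewrite weightD// [weight 1 x]weightE powRr1//.
by move: Ox; rewrite open_unit_ballE => /= /ltW.
Qed.

Lemma measurable_weight a (D : set V) : measurable_fun D (weight a).
Proof.
rewrite (_ : weight a = (@powR R ^~ a) \o pev pw); last first.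
  by apply/funext => x /=; rewrite weightE.
by apply: measurableT_comp; [exact: measurable_powR|exact: measurable_pev].
Qed.

Lemma measurable_cutsum e a L (D : set V) : 0 < e -> measurable_fun D (cutsum e a L).
Proof.
move=> e0; apply: (measurable_funS measurableT) => //.
by apply: continuous_rV_measurable; exact: continuous_cutsum.
Qed.

Lemma cutsum_support e a L x : 0 < e -> ~ box 1 x -> cutsum e a L x = 0.
Proof.
move=> e0 xb; apply: cutsum0 => //; rewrite leNgt; apply/negP => ex; apply: xb => i.
rewrite -ler_norml; apply: coord_le1; rewrite unit_ballE /=.
by rewrite (le_trans _ (ltW ex))// ltW.
Qed.

Lemma Ointg_cutsum e a L : 0 < e -> Ointg (cutsum e a L).
Proof.
move=> e0; apply: (integrableS (@measurableT _ _) mO (@subsetT _ _)).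
apply: (integrable_compact_support (@box_compact R d 1) (@subset_refl _ _)).
  exact: continuous_cutsum.
by move=> x; exact: cutsum_support.
Qed.

Lemma Oint_setT h : (forall x, ~ O x -> h x = 0) ->
  Oint h = \int[lebesgue_rV d]_x h x.
Proof.
move=> h0; rewrite /Oint Rintegral_mkcond; apply: eq_Rintegral => x _.
rewrite patchE; case: ifPn => // /negP xO; rewrite h0// => Ox; apply: xO.
by rewrite inE.
Qed.

(** The divergence theorem for a field that vanishes near the sphere *)
Lemma Oint_step e a i L : 0 < e -> Oint (cutsum e a (step a i L)) = 0.
Proof.
move=> e0; rewrite Oint_setT => [|x Ox]; last first.
  apply: cutsum0 => //; apply: le_trans (ltW e0); rewrite leNgt; apply/negP => h.
  by apply: Ox; rewrite open_unit_ballE.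
rewrite /Rintegral [X in fine X](_ : _ = 0%E)//.
apply: (@integral_partial R d (cutsum e (a + 1) L) _ i 1) => //.
- exact: continuous_cutsum.
- by move=> x; exact: is_derive_cutsum.
- by move=> x; exact: cutsum_support.
- by move=> x; exact: cutsum_support.
Qed.

End BallIntegrals.

(** * Integrability of the weights *)

Section WeightIntegrable.
Context {R : realType} {d : nat}.
Local Notation P := (mpoly.mpoly d R).
Local Notation C c := (mpoly.mpolyC d c).
Local Notation V := 'rV[R]_d.
Local Notation O := (open_unit_ball : set 'rV[R]_d).
Local Notation mO := (@measurable_open_unit_ball R d).
Implicit Types (a e : R) (i j : 'I_d) (L : seq (P * {poly R})) (x : V) (g h : V -> R).

Lemma cutpow_cvg a (Q : {poly R}) (t : R) : 0 < t ->
  cutpow a Q n.+1%:R^-1 t @[n --> \oo] --> t `^ a * Q.[0].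
Proof.
move=> t0; have h : (fun n => bump Q (n.+1%:R * t)) @ \oo --> Q.[0].
  rewrite (cvg_shiftS (fun n => bump Q (n%:R * t))); exact: bump_cvg.
rewrite /cutpow; apply: cvgM; first exact: cvg_cst.
by under eq_fun do rewrite invrK mulrC.
Qed.

(** The divergence of w^(a+1) e(w) x has integral 0 and is at most
    a constant minus 2 (a + 1) w^a e(w); this bounds the integral of the cut
    off weight independently of the cutoff. *)
Lemma Oint_cutweight_le a e : -1 < a -> 0 < e ->
  Oint (fun x : V => cutpow a 1 e (pev pw x)) <=
  (d%:R + 2 * (a + 1)) * Oint (fun _ : V => 1) / (2 * (a + 1)).
Proof.
move=> a1 e0; have a10 : 0 < a + 1 by lra.
pose k (x : V) := cutpow a 1 e (pev pw x).
pose k' (x : V) := cutpow a (theta 1) e (pev pw x).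
pose L i : seq (P * {poly R}) := [:: (pX i, 1)].
pose D x := \sum_(i < d) cutsum e a (step a i (L i)) x.
have DE x : D x = d%:R * (pev pw x * k x) - 2 * (a + 1) * ((1 - pev pw x) * k x)
    - 2 * ((1 - pev pw x) * k' x).
  pose F i := pev pw x * k x - 2 * (a + 1) * (x ord0 i ^+ 2 * k x)
    - 2 * (x ord0 i ^+ 2 * k' x).
  rewrite /D (eq_bigr F) => [|i _]; last first.
    rewrite /cutsum /step /L /= !big_cons big_nil /atom /= -/(k x) -/(k' x).
    rewrite pev_dq !pevM pevN pev_nat !pevX pDX eqxx pev_nat /F mulr1n; ring.
  rewrite /F !(big_split, sumrN) /= sumr_const card_ord -!mulr_sumr -!mulr_suml.
  by rewrite -enorm_sqr pev_pw -mulr_natl; ring.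
have iD : Ointg D by apply: Ointg_sum => i; exact: Ointg_cutsum.
have D0 : Oint D = 0.
  by rewrite /D Oint_sum ?big1// => i *; [exact: Oint_step|exact: Ointg_cutsum].
have ik : Ointg k.
  apply: (eq_Ointg _ (Ointg_cutsum a [:: (1, 1)] e0)) => x _.
  by rewrite /cutsum big_cons big_nil /atom /= pev1 mul1r addr0.
have bump1 v : 0 <= bump (1 : {poly R}) v <= 1.
  rewrite /bump; case: ifPn => [v1|]; last by rewrite lexx ler01.
  by rewrite hornerC mul1r expR_ge0 expR_le1 oppr_le0 invr_ge0 subr_ge0 ltW.
have th0 v : 0 <= bump (theta (1 : {poly R})) v.
  rewrite /bump; case: ifPn => // v1; rewrite mulr_ge0 ?expR_ge0//.
  have u0 : 0 <= (v - 1)^-1 by rewrite invr_ge0 subr_ge0 ltW.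
  rewrite /theta derivC subr0 mulr1 hornerD hornerX hornerXn.
  by rewrite addr_ge0// exprn_ge0.
have kle x : O x -> 2 * (a + 1) * k x <= (d%:R + 2 * (a + 1)) * 1 - D x.
  rewrite open_unit_ballE /= => wx; rewrite DE.
  have wk : pev pw x * k x <= 1.
    rewrite -cutpowS// /cutpow; have /andP[b0 b1] := bump1 (pev pw x / e).
    rewrite -[leRHS]mulr1 ler_pM ?powR_ge0//.
    have w1 : pev pw x `^ (a + 1) <= 1 `^ (a + 1).
      by rewrite ge0_ler_powR ?nnegrE ?(ltW a10) ?(ltW wx) ?pw_le1.
    by move: w1; rewrite powR1.
  have k0 : 0 <= (1 - pev pw x) * k' x.
    by rewrite mulr_ge0 ?subr_ge0 ?pw_le1// mulr_ge0 ?powR_ge0.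
  have dd : 0 <= d%:R :> R by [].
  nra.
have i1 : Ointg (fun _ : V => (d%:R + 2 * (a + 1)) * 1) by apply: OintgZ; exact: Ointg_cst.
have := le_Oint (OintgZ (2 * (a + 1)) ik) (OintgB i1 iD) kle.
rewrite OintZ// OintB// OintZ; last exact: Ointg_cst.
by rewrite D0 subr0 ler_pdivlMr ?mulr_gt0// mulrC.
Qed.

(** Fatou's lemma along the cutoffs *)
Lemma Ointg_weight a : -1 < a -> Ointg (fun x : V => weight a x).
Proof.
move=> a1; apply: ge0_Ointg; first exact: measurable_weight.
  by move=> x _; exact: weight_ge0.
pose M := (d%:R + 2 * (a + 1)) * Oint (fun _ : V => 1) / (2 * (a + 1)).
pose f n (x : V) := (cutpow a 1 n.+1%:R^-1 (pev pw x))%:E.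
have ik n : Ointg (fun x : V => cutpow a 1 n.+1%:R^-1 (pev pw x)).
  apply: (@eq_Ointg _ _ (cutsum n.+1%:R^-1 a [:: (1, 1)])) => [x _|].
    by rewrite /cutsum big_cons big_nil /atom /= pev1 mul1r addr0.
  by apply: Ointg_cutsum; rewrite invr_gt0.
have f0 n (x : V) : O x -> (0 <= f n x)%E.
  move=> _; rewrite lee_fin mulr_ge0 ?powR_ge0// /bump; case: ifPn => // _.
  by rewrite hornerC mul1r expR_ge0.
have mf n : measurable_fun O (f n) by exact: measurable_int (ik n).
have := @fatou _ _ _ (lebesgue_rV d) O mO f mf f0.
rewrite (eq_integral (fun x => (weight a x)%:E)) => [h|x]; last first.
  rewrite inE => Ox; apply: (cvg_limn_einf_sup _).1.
  apply: cvg_EFin; first by near=> n.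
  rewrite weightE -[X in _ --> X]mulr1 -(hornerC 1 0); apply: cutpow_cvg.
  by move: Ox; rewrite open_unit_ballE.
apply: le_lt_trans h _; apply: (@le_lt_trans _ _ M%:E); last exact: ltry.
rewrite limn_einf_lim; apply: lime_le; first exact: is_cvg_einfs.
near=> n; apply: (@le_trans _ _ (\int[lebesgue_rV d]_(x in O) f n x)%E).
  by apply: ereal_inf_lbound; exists n => /=.
by rewrite -EFin_Oint// lee_fin Oint_cutweight_le// invr_gt0.
Unshelve. all: by end_near. Qed.

End WeightIntegrable.

(** * The weighted inner products of polynomials *)

Section RemovingCutoffs.
Context {R : realType} {d : nat}.
Local Notation P := (mpoly.mpoly d R).
Local Notation C c := (mpoly.mpolyC d c).
Local Notation V := 'rV[R]_d.
Local Notation O := (open_unit_ball : set 'rV[R]_d).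
Local Notation mO := (@measurable_open_unit_ball R d).
Implicit Types (a e : R) (i j : 'I_d) (L : seq (P * {poly R})) (x : V) (g h : V -> R).

Lemma cutsum_cvg a L x : O x ->
  cutsum n.+1%:R^-1 a L x @[n --> \oo] --> weight a x * pev (head L) x.
Proof.
rewrite open_unit_ballE weightE /= => wx; elim: L => [|l L IH].
  rewrite /head big_nil pev0 mulr0.
  by under eq_fun do rewrite /cutsum big_nil; exact: cvg_cst.
rewrite /head big_cons -/(head L) [pev (_ * _ + head L) x]pevD mulrDr.
under eq_fun do rewrite cutsum_cons /=.
apply: cvgD => //; rewrite /atom pevM pevC.
rewrite (_ : _ * _ = pev l.1 x * (pev pw x `^ a * l.2.[0])); last by ring.
by apply: cvgM; [exact: cvg_cst|exact: cutpow_cvg].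
Qed.

Lemma cutsum_bounded a L : exists2 M : R, 0 <= M & forall e x, 0 < e -> O x ->
  `|cutsum e a L x| <= M * weight a x.
Proof.
elim: L => [|l L [M M0 hM]].
  by exists 0 => // e x _ _; rewrite /cutsum big_nil normr0 mul0r.
have [A A0 hA] := pev_bounded l.1; have [B B0 hB] := bump_bounded l.2.
exists (A * B + M) => [|e x e0 Ox]; first by rewrite addr_ge0// mulr_ge0.
rewrite cutsum_cons mulrDl; apply: le_trans (ler_normD _ _) _.
apply: lerD; last exact: hM.
rewrite /atom /cutpow !normrM -weightE (ger0_norm (weight_ge0 a x)).
rewrite [leRHS]mulrAC -mulrA; apply: ler_pM => //.
  by apply: mulr_ge0 => //; exact: weight_ge0.
  exact: hA.
by apply: ler_wpM2l => //; exact: weight_ge0.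
Qed.

(** Dominated convergence: the cutoffs are bounded uniformly in e. *)
Lemma Oint_cutsum_cvg a L g : measurable_fun O g ->
  Ointg (fun x => g x * weight a x) ->
  Oint (fun x => g x * cutsum n.+1%:R^-1 a L x) @[n --> \oo] -->
  Oint (fun x => g x * (weight a x * pev (head L) x)).
Proof.
move=> mg ig; have [M M0 hM] := cutsum_bounded a L.
pose f_ n x := (g x * cutsum n.+1%:R^-1 a L x)%:E.
pose f x := (g x * (weight a x * pev (head L) x))%:E.
have mf_ n : measurable_fun O (f_ n).
  apply/measurable_EFinP; apply: measurable_funM => //.
  by apply: measurable_cutsum; rewrite invr_gt0.
have mf : measurable_fun O f.
  apply/measurable_EFinP; apply: measurable_funM => //.
  by apply: measurable_funM; [exact: measurable_weight|exact: measurable_pev].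
pose G x := M * `|g x * weight a x|.
have iG : Ointg G by exact: OintgZ (Ointg_norm ig).
have [||i1 _ h] := dominated_convergence mO mf_ mf _ iG.
- apply: aeW => x Ox; apply: cvg_EFin; first by near=> n.
  by apply: cvgM; [exact: cvg_cst|exact: cutsum_cvg].
- apply: aeW => x n Ox; rewrite lee_fin normrM /G normrM (ger0_norm (weight_ge0 a x)).
  by rewrite mulrCA ler_wpM2l// hM// invr_gt0.
have hf : (fun n => Oint (fun x => g x * cutsum n.+1%:R^-1 a L x)) =
  fine \o (fun n => (\int[lebesgue_rV d]_(x in O) f_ n x)%E) by [].
rewrite hf; apply: fine_cvg; rewrite EFin_Oint//.
Unshelve. all: by end_near. Qed.

Lemma partial_coordM i j (phi : V -> R) x : differentiable phi x ->
  partial j (fun y => y ord0 i * phi y) x =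
  x ord0 i * partial j phi x + (i == j)%:R * phi x.
Proof.
move=> dphi; rewrite /partial.
have h1 := is_derive_pev (pX i) x j.
have h2 : is_derive x (delta_mx ord0 j) phi ('D_(delta_mx ord0 j) phi x).
  by apply: derivableP; exact: diff_derivable.
have [_] := is_deriveM h1 h2.
rewrite (_ : pev (pX i) * phi = (fun y => y ord0 i * phi y)) => [->|]; last first.
  by apply/funext => y; rewrite -pevX.
rewrite /GRing.scale /= pDX pevX eq_sym; congr (_ + _).
by rewrite mulrC; case: eqP => _; rewrite ?pev1 ?pev0.
Qed.

Lemma partial_coordM_neq i j (phi : V -> R) x : differentiable phi x -> i != j ->
  partial j (fun y => y ord0 i * phi y) x = x ord0 i * partial j phi x.
Proof. by move=> dphi ij; rewrite partial_coordM// (negbTE ij) mulr0n mul0r addr0. Qed.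

Lemma Oint_partial_cutsum e a i L : 0 < e -> Oint (partial i (cutsum e a L)) = 0.
Proof. by move=> e0; rewrite -(subrK 1 a) partial_cutsum// Oint_step. Qed.

Definition ip a (p q : P) : R := Oint (fun x => pev p x * pev q x * weight a x).

Lemma Ointg_pev_weight a p : -1 < a -> Ointg (fun x => pev p x * weight a x).
Proof. by move=> a1; apply: pevM_Ointg; exact: Ointg_weight. Qed.

Lemma ip_pev a p q : ip a p q = Oint (fun x => pev (p * q) x * weight a x).
Proof. by apply: eq_Oint => x _; rewrite pevM. Qed.

Lemma Oint_weight_cvg a L : -1 < a ->
  Oint (cutsum n.+1%:R^-1 a L) @[n --> \oo] --> Oint (fun x => pev (head L) x * weight a x).
Proof.
move=> a1; have := @Oint_cutsum_cvg a L (fun=> 1) (measurable_cst _).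
rewrite (_ : Oint (fun x => 1 * (weight a x * _)) = Oint (fun x => pev (head L) x * weight a x)).
  rewrite (_ : (fun n : nat => Oint _) = fun n => Oint (cutsum n.+1%:R^-1 a L)).
    apply; apply: eq_Ointg (Ointg_weight a1) => x _; by rewrite mul1r.
  by apply/funext => n; apply: eq_Oint => x _; rewrite mul1r.
by apply: eq_Oint => x _; rewrite mul1r mulrC.
Qed.

(** The integrand is the i-th derivative of w^(a+1) r. *)
Lemma Oint_dq a i r : -1 < a -> Oint (fun x => pev (dq a i r) x * weight a x) = 0.
Proof.
move=> a1; have := @Oint_weight_cvg a (step a i [:: (r, 1)]) a1.
rewrite head_step /head big_cons big_nil addr0 /= hornerC mpoly.mpolyC1 mul1r.
under eq_fun do rewrite Oint_step ?invr_gt0//.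
by move/(cvg_lim (@Rhausdorff R)) => <-; exact: lim_cst.
Qed.

Lemma Oint_ang a i j r : -1 < a -> i != j ->
  Oint (fun x => pev (ang i j r) x * weight a x) = 0.
Proof.
move=> a1 ij; pose L : seq (P * {poly R}) := [:: (r, 1)].
have hL : head L = r by rewrite /head big_cons big_nil addr0 /= hornerC mpoly.mpolyC1 mul1r.
have h n : Oint (cutsum n.+1%:R^-1 a (langular i j L)) = 0.
  have e0 : 0 < n.+1%:R^-1 :> R by rewrite invr_gt0.
  rewrite (@eq_Oint _ _ _ (fun x =>
      partial j (cutsum n.+1%:R^-1 a (lmul (pX i) L)) x -
      partial i (cutsum n.+1%:R^-1 a (lmul (pX j) L)) x)).
    rewrite OintB ?Oint_partial_cutsum ?subrr// -(subrK 1 a) partial_cutsum//;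
      exact: Ointg_cutsum.
  move=> x _; rewrite -angular_cutsum//.
  have lE k : cutsum n.+1%:R^-1 a (lmul (pX k) L) =
      fun y => y ord0 k * cutsum n.+1%:R^-1 a L y.
    by apply/funext => y; rewrite cutsum_lmul pevX.
  rewrite !lE (partial_coordM_neq _ ij); last exact: differentiable_cutsum.
  by rewrite partial_coordM_neq 1?eq_sym//; exact: differentiable_cutsum.
have := @Oint_weight_cvg a (langular i j L) a1; rewrite head_langular hL.
under eq_fun do rewrite h.
by move/(cvg_lim (@Rhausdorff R)) => <-; exact: lim_cst.
Qed.

(** Both adjunctions are product rules integrated by Oint_dq and Oint_ang. *)
Lemma ip_ball_form : ball_form ip.
Proof.
split.
- by move=> a p q _; apply: eq_Oint => x _; ring.
- move=> a p q g a1; rewrite !ip_pev -OintD; try exact: Ointg_pev_weight.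
  by apply: eq_Oint => x _; rewrite mulrDl pevD mulrDl.
- move=> a c p q a1; rewrite !ip_pev -OintZ; last exact: Ointg_pev_weight.
  by apply: eq_Oint => x _; rewrite -mulrA pevM pevC mulrA.
- by move=> a p _; apply: Oint_ge0 => x _; rewrite mulr_ge0 ?weight_ge0// -expr2 sqr_ge0.
- move=> a i p q a1; apply/eqP; rewrite -addr_eq0 !ip_pev.
  rewrite -OintD; [|by apply: Ointg_pev_weight; lra|exact: Ointg_pev_weight].
  rewrite -(Oint_dq i (p * q) a1); apply/eqP; apply: eq_Oint => x Ox.
  by rewrite weightS// !pevM !pev_dq pDM [pev (_ * _ + _) x]pevD ?pevM; ring.
- move=> a i j p q a1 ij; apply/eqP; rewrite -addr_eq0 !ip_pev.
  rewrite -OintD; try exact: Ointg_pev_weight.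
  rewrite -(Oint_ang (p * q) a1 ij); apply/eqP; apply: eq_Oint => x Ox.
  by rewrite !pevM !pev_ang !pDM ![pev (_ + _) x]pevD !pevM; ring.
Qed.

End RemovingCutoffs.

(** * Weighted norms *)

Section Norms.
Context {R : realType} {d : nat}.
Local Notation P := (mpoly.mpoly d R).
Local Notation V := 'rV[R]_d.
Local Notation O := (open_unit_ball : set 'rV[R]_d).
Local Notation B := (unit_ball : set 'rV[R]_d).
Local Notation mO := (@measurable_open_unit_ball R d).
Local Notation mB := (@measurable_unit_ball R d).
Implicit Types (a e : R) (i j : 'I_d) (x : V) (f g h : V -> R).
Hypothesis d0 : (0 < d)%N.

Lemma ge0_integral_unit_ball (F : V -> \bar R) : measurable_fun B F ->
  (forall x, B x -> (0 <= F x)%E) ->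
  (\int[lebesgue_rV d]_(x in B) F x = \int[lebesgue_rV d]_(x in O) F x)%E.
Proof.
move=> mF F0; pose S := [set x : V | pev pw x = 0].
have SE : B `\` S = O.
  rewrite unit_ballE open_unit_ballE; apply/seteqP; split => x /=.
    by rewrite /S /= => -[h1 /eqP h2]; rewrite lt_neqAle eq_sym h2.
  by move=> h; split; [exact: ltW|rewrite /S /=; apply/eqP; rewrite gt_eqF].
have mS : measurable S.
  rewrite (_ : S = B `\` O).
    by apply: measurableD; [exact: mB|exact: mO].
  by rewrite -SE setDD setIidr// unit_ballE => x; rewrite /S /= => ->.
rewrite (@ge0_negligible_integral _ _ _ _ B S)// ?SE//; first exact: mB.
exact: sphere_null.
Qed.

Lemma Oint_weight_gt0 a : -1 < a -> 0 < Oint (fun x : V => weight a x).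
Proof.
move=> a1; pose c : R := (2 * d%:R)^-1.
have dR : 1 <= d%:R :> R by rewrite ler1n.
have c0 : 0 < c by rewrite invr_gt0; lra.
(* On this box the weight is bounded below: d c^2 <= 1/2, so w lies in [1/2, 1]. *)
have cw x : box c x -> 2^-1 <= pev pw x.
  move=> xc; rewrite pev_pw enorm_sqr.
  suff : \sum_(i < d) x ord0 i ^+ 2 <= 2^-1 by lra.
  apply: (@le_trans _ _ (\sum_(i < d) c ^+ 2)).
    apply: ler_sum => i _; rewrite -(real_normK (num_real _)).
    by apply: lerXn2r; rewrite ?nnegrE ?(ltW c0)// ler_norml xc.
  have dc : d%:R * c = 2^-1 by rewrite /c; field; rewrite gt_eqF//; lra.
  rewrite sumr_const card_ord -[_ *+ d]mulr_natl expr2 mulrA dc ler_piMr//.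
  by rewrite invf_le1//; lra.
pose m0 : R := Num.min 1 (2^-1 `^ a).
have m00 : 0 < m0 by rewrite /m0 lt_min ltr01 powR_gt0.
have wm x : box c x -> m0 <= weight a x.
  move=> /cw hw; rewrite weightE /m0 ge_min; have [a0|a0] := leP 0 a.
    by rewrite ge0_ler_powR ?orbT ?nnegrE//; lra.
  apply/orP; left; rewrite -[a]opprK powRN; have w0 : 0 < pev pw x by lra.
  rewrite -[leLHS]invr1 lef_pV2 ?posrE ?powR_gt0//.
  have := @ge0_ler_powR R (- a) _ (pev pw x) 1; rewrite powR1; apply; rewrite ?nnegrE ?pw_le1//; lra.
have bO : box c `<=` O by move=> x /cw; rewrite open_unit_ballE /=; lra.
have mb : measurable (box c : set V) by apply: compact_rV_measurable; exact: box_compact.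
have ib : Ointg (\1_(box c) : V -> R).
  apply: (integrableS (@measurableT _ _) mO (@subsetT _ _)).
  by apply: integrable_indic_lty => //; apply: box_lty; exact: ltW.
have : Oint (fun x => m0 * \1_(box c) x) <= Oint (fun x : V => weight a x).
  apply: le_Oint; [exact: OintgZ|exact: Ointg_weight|move=> x Ox].
  rewrite indicE; have [xb|_] := boolP (x \in _).
    by rewrite mulr1 wm//; exact: set_mem.
  by rewrite mulr0 weight_ge0.
apply: lt_le_trans; rewrite OintZ//; apply: mulr_gt0 => //.
rewrite -lte_fin EFin_Oint// integral_indic//; last exact: mO.
rewrite setIidl//.
pose a' : V := \row_i (- c); pose b' : V := \row_i c.
rewrite (_ : box c = [set x : V | forall i, a' ord0 i <= x ord0 i <= b' ord0 i]); last first.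
  by apply/seteqP; split => x /= h i; have := h i; rewrite !mxE.
have ab i : a' ord0 i <= b' ord0 i by rewrite !mxE; lra.
apply: (@lt_le_trans _ _ (\prod_(i < d) (b' ord0 i - a' ord0 i))%:E).
  rewrite lte_fin; apply: prodr_gt0 => i _; rewrite !mxE; lra.
by rewrite -(lebesgue_rV_box ab).
Qed.

Lemma bconstE a : @bconst R d a = (Oint (fun x : V => weight a x))^-1.
Proof.
rewrite /bconst /Oint /Rintegral ge0_integral_unit_ball//.
  by apply/measurable_EFinP; exact: measurable_weight.
by move=> x _; rewrite lee_fin weight_ge0.
Qed.

Lemma bconst_gt0 a : -1 < a -> 0 < @bconst R d a.
Proof. by move=> a1; rewrite bconstE invr_gt0 Oint_weight_gt0. Qed.

Definition sqint a f : Prop := Ointg (fun x => f x ^+ 2 * weight a x).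
Definition sqnorm a f : R := Oint (fun x => f x ^+ 2 * weight a x).

Lemma sqnorm_ge0 a f : 0 <= sqnorm a f.
Proof. by apply: Oint_ge0 => x _; rewrite mulr_ge0 ?sqr_ge0 ?weight_ge0. Qed.

Lemma measurable_unit_open f : measurable_fun B f -> measurable_fun O f.
Proof. by apply: measurable_funS; [exact: mB|exact: open_unit_ball_sub]. Qed.

Lemma measurable_sq_weight a f (D : set V) : measurable_fun D f ->
  measurable_fun D (fun x => f x ^+ 2 * weight a x).
Proof.
move=> mf; apply: measurable_funM; last exact: measurable_weight.
exact: measurable_funX.
Qed.

Lemma wnormE a f : measurable_fun B f -> sqint a f ->
  wnorm a f = (Num.sqrt (@bconst R d a * sqnorm a f))%:E.
Proof.
move=> mf iff; rewrite /wnorm ge0_integral_unit_ball; last 2 first.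
- apply/measurable_EFinP; under eq_fun do rewrite real_normK ?num_real//.
  exact: measurable_sq_weight.
- by move=> x _; rewrite lee_fin mulr_ge0 ?sqr_ge0 ?weight_ge0.
under eq_integral do rewrite real_normK ?num_real//.
rewrite -EFin_Oint// -EFinM poweR_EFin powR12_sqrt// mulr_ge0 ?sqnorm_ge0//.
rewrite bconstE invr_ge0; apply: Oint_ge0 => x _; exact: weight_ge0.
Qed.

Lemma wnorm_lty a f : -1 < a -> measurable_fun B f -> (wnorm a f < +oo)%E -> sqint a f.
Proof.
move=> a1 mf foo; apply: ge0_Ointg.
- by apply: measurable_sq_weight; exact: measurable_unit_open.
- by move=> x _; rewrite mulr_ge0 ?sqr_ge0 ?weight_ge0.
rewrite ltey; apply/negP => /eqP oo; move: foo.
rewrite /wnorm ge0_integral_unit_ball; last 2 first.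
- apply/measurable_EFinP; under eq_fun do rewrite real_normK ?num_real//.
  exact: measurable_sq_weight.
- by move=> x _; rewrite lee_fin mulr_ge0 ?sqr_ge0 ?weight_ge0.
under eq_integral do rewrite real_normK ?num_real//.
by rewrite oo gt0_muley ?lte_fin ?bconst_gt0// poweRyr ?invr_eq0 ?pnatr_eq0// ltxx.
Qed.

Lemma sqintM a f g : measurable_fun O f -> measurable_fun O g ->
  sqint a f -> sqint a g -> Ointg (fun x => f x * g x * weight a x).
Proof.
move=> mf mg iff ig; apply: le_Ointg (OintgD iff ig).
  by apply: measurable_funM; [exact: measurable_funM|exact: measurable_weight].
move=> x Ox; rewrite -mulrDl normrM (ger0_norm (weight_ge0 a x)).
rewrite ler_wpM2r ?weight_ge0// normrM.
rewrite -(real_normK (num_real (f x))) -(real_normK (num_real (g x))).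
have := sqr_ge0 (`|f x| - `|g x|); have := sqr_ge0 `|f x|; have := sqr_ge0 `|g x|; nra.
Qed.

Lemma sqintZ a c f : sqint a f -> sqint a (fun x => c * f x).
Proof.
by move=> iff; apply: eq_Ointg (OintgZ (c ^+ 2) iff) => x _; rewrite exprMn mulrA.
Qed.

Lemma sqintD a f g : measurable_fun O f -> measurable_fun O g ->
  sqint a f -> sqint a g -> sqint a (fun x => f x + g x).
Proof.
move=> mf mg iff ig.
apply: eq_Ointg (OintgD (OintgD iff ig) (OintgZ 2 (sqintM mf mg iff ig))) => x _.
by rewrite sqrrD; ring.
Qed.

Lemma sqintB a f g : measurable_fun O f -> measurable_fun O g ->
  sqint a f -> sqint a g -> sqint a (fun x => f x - g x).
Proof.
move=> mf mg iff ig; have mg' : measurable_fun O (fun x => -1 * g x).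
  by apply: measurable_funM.
have := sqintD mf mg' iff (sqintZ (-1) ig).
by apply: eq_Ointg => x _; rewrite /= mulN1r.
Qed.

Lemma sqint_pev a p : -1 < a -> sqint a (pev p).
Proof.
move=> a1; apply: eq_Ointg (Ointg_pev_weight (p * p) a1) => x _.
by rewrite pevM expr2.
Qed.

Lemma sqnorm_pev a p : sqnorm a (pev p) = ip a p p.
Proof. by apply: eq_Oint => x _; rewrite expr2. Qed.

Definition wpair a f (p : P) : R := Oint (fun x => f x * pev p x * weight a x).

(** Cauchy-Schwarz in additive form, from the square of f - p *)
Lemma wpair_ub a f p : -1 < a -> measurable_fun O f -> sqint a f ->
  2 * wpair a f p <= sqnorm a f + ip a p p.
Proof.
move=> a1 mf iff; rewrite -sqnorm_pev -OintD//; last exact: sqint_pev.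
have ifp : Ointg (fun x => f x * pev p x * weight a x).
  by apply: sqintM => //; [exact: measurable_pev|exact: sqint_pev].
rewrite -OintZ//; apply: le_Oint.
- exact: OintgZ.
- by apply: OintgD => //; exact: sqint_pev.
move=> x Ox; have := weight_ge0 a x; have := sqr_ge0 (f x - pev p x).
move: (f x) (pev p x) (weight a x) => u v w h1 h2.
have : 0 <= (u - v) ^+ 2 * w by exact: mulr_ge0.
nra.
Qed.

End Norms.

(** * Mixed partial derivatives and test functions *)

Section TestFunctions.
Context {R : realType} {d : nat}.
Local Notation V := 'rV[R]_d.
Local Notation O := (open_unit_ball : set 'rV[R]_d).
Local Notation bv i := (delta_mx ord0 i : V).
Implicit Types (i j : 'I_d) (x y : V) (phi : V -> R) (s : seq 'I_d).

Lemma is_derive_ray phi (v y : V) (t : R) : (forall x, differentiable phi x) ->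
  is_derive t 1 (fun u : R => phi (u *: v + y)) ('D_v phi (t *: v + y)).
Proof.
move=> dphi; apply/is_derive_line.
have /derivableP/is_derive_line : derivable phi (t *: v + y) v by exact: diff_derivable.
rewrite (_ : (fun h : R => phi (h *: v + (t *: v + y))) =
  (fun h : R => phi ((h *: 1 + t) *: v + y)))//.
by apply/funext => h; rewrite [_%:A]mulr1 scalerDl addrA.
Qed.

Lemma mean_value (g dg : R -> R) (h : R) : 0 < h ->
  (forall t : R, is_derive t (1 : R) g (dg t)) -> exists2 c, 0 < c < h & g h - g 0 = h * dg c.
Proof.
move=> h0 dg_; have cg : {within `[0, h], continuous g}.
  apply: continuous_subspaceT => t; apply/differentiable_continuous/derivable1_diffP.
  by case: (dg_ t).
have [c] := @MVT R g dg 0 h h0 (fun t _ => dg_ t) cg.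
by rewrite in_itv /= subr0 => ch gE; exists c => //; rewrite gE mulrC.
Qed.

(** The mean value theorem in direction i, then in direction j; the left-hand side
    is symmetric in i and j. *)
Lemma mixed_difference phi i j x (h : R) : smooth phi -> 0 < h ->
  exists c c' : R, [/\ 0 < c < h, 0 < c' < h &
   phi (h *: bv i + (h *: bv j + x)) - phi (h *: bv i + x) - phi (h *: bv j + x)
     + phi x = h ^+ 2 * partial j (partial i phi) (c' *: bv j + (c *: bv i + x))].
Proof.
move=> sphi h0; have d0 := sphi [::]; have d1 := sphi [:: i].
pose g (t : R) := phi (t *: bv i + (h *: bv j + x)) - phi (t *: bv i + x).
pose dg (t : R) := partial i phi (t *: bv i + (h *: bv j + x)) - partial i phi (t *: bv i + x).
have gd (t : R) : is_derive t (1 : R) g (dg t) by apply: is_deriveB; exact: is_derive_ray.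
have [c ch gc] := mean_value h0 gd.
pose k (t : R) := partial i phi (t *: bv j + (c *: bv i + x)).
have kd (t : R) : is_derive t (1 : R) k (partial j (partial i phi) (t *: bv j + (c *: bv i + x))).
  exact: is_derive_ray.
have [c' ch' kc] := mean_value h0 kd.
exists c, c'; split => //; rewrite expr2 -mulrA -kc.
have -> : k h - k 0 = dg c by rewrite /k /dg scale0r add0r addrCA.
by rewrite -gc /g !scale0r !add0r; ring.
Qed.

(** Schwarz's theorem on mixed partial derivatives *)
Lemma partial_comm phi i j : smooth phi -> partial i (partial j phi) = partial j (partial i phi).
Proof.
move=> sphi; apply/funext => x; apply/eqP; rewrite -subr_eq0 -normr_le0.
apply/ler_addgt0Pr => e e0; rewrite add0r.
have cont k l : {for x, continuous (partial k (partial l phi))}.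
  exact: differentiable_continuous (sphi [:: k; l] x).
have [r r0 hr] : exists2 r : R, 0 < r & forall y, ball x r y ->
   `|partial i (partial j phi) x - partial i (partial j phi) y| <= e / 2 /\
   `|partial j (partial i phi) x - partial j (partial i phi) y| <= e / 2.
  have e2 : 0 < e / 2 by rewrite divr_gt0.
  have /cvgrPdist_le/(_ _ e2)/nbhs_ballP[r1 /= r10 h1] := cont i j.
  have /cvgrPdist_le/(_ _ e2)/nbhs_ballP[r2 /= r20 h2] := cont j i.
  exists (Num.min r1 r2) => [|y]; first by rewrite lt_min r10 r20.
  move=> xy; split; [apply: h1|apply: h2]; apply: le_ball xy.
    by rewrite ge_min lexx.
  by rewrite ge_min lexx orbT.
pose h := r / 2; have h0 : 0 < h by rewrite divr_gt0.
have near c c' k l : 0 < c < h -> 0 < c' < h -> ball x r (c' *: bv k + (c *: bv l + x)).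
  move=> /andP[c0 ch] /andP[c0' ch']; split => // a b; rewrite ord1 /ball /= !mxE eqxx /=.
  rewrite (_ : _ - _ = - (c' * (b == k)%:R + c * (b == l)%:R)); last by ring.
  rewrite normrN; have bl (u : R) (q : bool) : 0 < u < h -> 0 <= u * q%:R < h.
    by case: q => /andP[u0 uh]; rewrite ?mulr1 ?mulr0 ?lexx ?h0// ltW.
  have /andP[u1 u2] := bl c' (b == k) (introT andP (conj c0' ch')).
  have /andP[v1 v2] := bl c (b == l) (introT andP (conj c0 ch)).
  by rewrite ger0_norm ?addr_ge0// (splitr r) ltrD.
have [c [c' [ch ch' E1]]] := mixed_difference i j x sphi h0.
have [b [b' [bh bh' E2]]] := mixed_difference j i x sphi h0.
have E : partial j (partial i phi) (c' *: bv j + (c *: bv i + x)) =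
         partial i (partial j phi) (b' *: bv i + (b *: bv j + x)).
  apply: (@mulfI _ (h ^+ 2)); first by rewrite expf_neq0// gt_eqF.
  have xE : h *: bv i + (h *: bv j + x) = h *: bv j + (h *: bv i + x) by rewrite addrCA.
  apply: etrans (esym E1) _; apply: etrans _ E2; rewrite xE; congr (_ + _).
  by rewrite addrAC.
have [_ n1] := hr _ (near _ _ j i ch ch').
have [n2 _] := hr _ (near _ _ i j bh bh').
have fin (u v w z : R) : `|v - w| <= e / 2 -> `|u - z| <= e / 2 -> w = z -> `|u - v| <= e.
  move=> h1 h2 wz; rewrite (_ : u - v = (u - z) - (v - w)); last by rewrite wz; ring.
  by apply: le_trans (ler_normB _ _) _; rewrite (splitr e) lerD.
exact: fin n1 n2 E.
Qed.

Lemma smooth_foldr phi s : smooth phi -> smooth (foldr partial phi s).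
Proof. by move=> h s' x; rewrite -foldr_cat; exact: h. Qed.

Lemma foldr_partial_perm phi s1 s2 : smooth phi -> perm_eq s1 s2 ->
  foldr partial phi s1 = foldr partial phi s2.
Proof.
move=> sphi; move: s1 s2.
have swap i s : forall t, foldr partial phi (s ++ i :: t) = foldr partial phi (i :: s ++ t).
  move=> t; elim: s => //= j s ->; rewrite /= partial_comm//.
  exact: smooth_foldr.
elim=> [|i s1 IH] s2; first by rewrite perm_sym => /perm_nilP ->.
move=> p; have i2 : i \in s2 by rewrite -(perm_mem p) mem_head.
case/splitPr: i2 p => t1 t2 p; rewrite swap /=; congr (partial i _).
apply: IH; rewrite -(perm_cons i); apply: perm_trans p _.
by rewrite -cat1s perm_catCA.
Qed.

Lemma mpartial_foldr (m : 'I_d -> nat) phi :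
  mpartial m phi = foldr partial phi (flatten [seq nseq (m i) i | i <- enum 'I_d]).
Proof.
rewrite /mpartial; elim: (enum _) => //= i s ->; rewrite foldr_cat.
by elim: (m i) => //= k ->.
Qed.

(** mpartial differentiates in the order of the indices, and Schwarz's theorem makes
    the order of s immaterial. *)
Lemma mpartial_count phi s : smooth phi ->
  mpartial (fun i => count_mem i s) phi = foldr partial phi s.
Proof.
move=> sphi; rewrite mpartial_foldr; apply: foldr_partial_perm => //.
apply/allP => i _ /=; apply/eqP; rewrite count_flatten -map_comp.
rewrite (eq_map (g := fun j => (j == i) * count_mem i s)%N); last first.
  by move=> j /=; rewrite count_nseq /=; case: (j =P i) => [->|_]; rewrite ?mul1n ?mul0n.
rewrite sumnE big_map big_enum /= (bigD1 i)//= eqxx mul1n big1 ?addn0//.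
by move=> j /negbTE ->.
Qed.

Lemma mlen_count s : mlen (fun i => count_mem i s) = size s.
Proof.
rewrite /mlen; elim: s => [|j s IH] /=; first by rewrite big1.
rewrite big_split /= IH (bigD1 j)//= eqxx big1 ?add1n// => i.
by rewrite eq_sym => /negbTE ->.
Qed.

Lemma partial_count i phi : smooth phi ->
  mpartial (fun j => (j == i) : nat) phi = partial i phi.
Proof.
move=> sphi; rewrite -[RHS]/(foldr partial phi [:: i]) -(mpartial_count _ sphi).
by congr mpartial; apply/funext => j /=; rewrite addn0 eq_sym.
Qed.

Lemma test_support phi : test_function phi -> exists K : set V,
  [/\ compact K, K `<=` O & forall x, ~ K x -> phi x = 0].
Proof. by case. Qed.

Lemma test_continuous phi : test_function phi -> continuous phi.
Proof. by move=> [sphi _] x; exact: differentiable_continuous (sphi [::] x). Qed.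

Lemma test_partial i phi : test_function phi -> test_function (partial i phi).
Proof.
move=> [sphi [K [cK KO K0]]]; split; first exact: (@smooth_foldr phi [:: i]).
exists K; split => // x xK; rewrite /partial.
have oK : open (~` K) by apply: closed_openC; exact: compact_closed.
rewrite (@near_eq_derive _ _ _ phi (cst 0)); first by rewrite derive_cst.
have : nbhs x (~` K) by apply: open_nbhs_nbhs.
by apply: filterS => y; exact: K0.
Qed.

Lemma test_foldr s phi : test_function phi -> test_function (foldr partial phi s).
Proof. by move=> tphi; elim: s => //= i s; exact: test_partial. Qed.

Lemma differentiable_pevM p phi x : differentiable phi x ->
  differentiable (fun y => pev p y * phi y) x.
Proof.
move=> dphi; rewrite (_ : (fun y => _) = pev p * phi); last by apply/funext.
by apply: differentiableM => //; exact: differentiable_pev.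
Qed.

Lemma differentiable_sumseq (I : Type) (r : seq I) (F : I -> V -> R) x :
  (forall k, differentiable (F k) x) -> differentiable (fun y => \sum_(k <- r) F k y) x.
Proof.
move=> h; elim: r => [|k r IH].
  by under eq_fun do rewrite big_nil; exact: differentiable_cst.
by under eq_fun do rewrite big_cons; exact: differentiableD.
Qed.

Lemma partialD i phi psi x : differentiable phi x -> differentiable psi x ->
  partial i (fun y => phi y + psi y) x = partial i phi x + partial i psi x.
Proof. by move=> h1 h2; apply: deriveD; exact: diff_derivable. Qed.

Lemma partial_sumseq i (I : Type) (r : seq I) (F : I -> V -> R) x :
  (forall k, differentiable (F k) x) ->
  partial i (fun y => \sum_(k <- r) F k y) x = \sum_(k <- r) partial i (F k) x.
Proof.
move=> h; elim: r => [|k r IH].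
  under eq_fun do rewrite big_nil.
  by rewrite big_nil /partial derive_cst.
under eq_fun do rewrite big_cons.
by rewrite big_cons partialD ?IH//; exact: differentiable_sumseq.
Qed.

Lemma foldr_partial_coordM i phi s : smooth phi -> exists ts : seq (seq 'I_d),
  foldr partial (fun y => y ord0 i * phi y) s =
  fun x => x ord0 i * foldr partial phi s x + \sum_(t <- ts) foldr partial phi t x.
Proof.
move=> sphi; elim: s => [|j s [ts /= ->]].
  by exists [::]; apply/funext => x; rewrite big_nil addr0.
exists ((if i == j then [:: s] else [::]) ++ [seq j :: t | t <- ts]).
apply/funext => x; have ds t : differentiable (foldr partial phi t) x := sphi t x.
have dM : differentiable (fun y : V => y ord0 i * foldr partial phi s y) x.
  by under eq_fun do rewrite -pevX; exact: differentiable_pevM.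
rewrite partialD//; last exact: differentiable_sumseq.
rewrite partial_coordM// partial_sumseq// big_cat big_map /= addrA; congr (_ + _ + _).
by case: eqP => _; rewrite ?big_seq1 ?big_nil ?mul1r ?mul0r.
Qed.

Lemma test_coordM i phi : test_function phi -> test_function (fun x => x ord0 i * phi x).
Proof.
move=> [sphi [K [cK KO K0]]]; split.
  move=> s x; have [ts ->] := foldr_partial_coordM i s sphi.
  have ds t : differentiable (foldr partial phi t) x := sphi t x.
  apply: differentiableD; last exact: differentiable_sumseq.
  by under eq_fun do rewrite -pevX; exact: differentiable_pevM.
by exists K; split => // x xK; rewrite K0// mulr0.
Qed.

End TestFunctions.

(** * Iterated weak derivatives *)

Section WeakDerivatives.
Context {R : realType} {d : nat}.
Local Notation P := (mpoly.mpoly d R).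
Local Notation C c := (mpoly.mpolyC d c).
Local Notation V := 'rV[R]_d.
Local Notation O := (open_unit_ball : set 'rV[R]_d).
Local Notation B := (unit_ball : set 'rV[R]_d).
Local Notation mO := (@measurable_open_unit_ball R d).
Local Notation mB := (@measurable_unit_ball R d).
Local Notation locint := (@locally_integrable_ball R d).
Implicit Types (a e : R) (i j : 'I_d) (x : V) (f g h phi : V -> R) (s : seq 'I_d)
  (k : nat) (L : seq (P * {poly R})).

Lemma locint_compact h (K : set V) : locint h -> compact K -> K `<=` O ->
  (lebesgue_rV d).-integrable K (EFin \o h).
Proof.
move=> [mh hK] cK KO; have mK := compact_rV_measurable cK.
apply/integrableP; split; last exact: hK.
apply/measurable_EFinP; apply: (measurable_funS mB) mh.
by apply: subset_trans KO _; exact: open_unit_ball_sub.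
Qed.

Lemma locintP h : measurable_fun B h ->
  (forall K : set V, compact K -> K `<=` O ->
     (lebesgue_rV d).-integrable K (EFin \o h)) -> locint h.
Proof. by move=> mh hK; split => // K cK KO; case/integrableP: (hK K cK KO). Qed.

Lemma locint_measurable h : locint h -> measurable_fun B h.
Proof. by case. Qed.

Lemma locint0 : locint (cst 0).
Proof.
by apply: locintP => // K cK KO; apply: integrable0.
Qed.

Lemma locintD g h : locint g -> locint h -> locint (fun x => g x + h x).
Proof.
move=> lg lh; apply: locintP => [|K cK KO].
  by apply: measurable_funD; exact: locint_measurable.
have := integrableD (compact_rV_measurable cK) (locint_compact lg cK KO) (locint_compact lh cK KO).
exact.
Qed.

Lemma locintZ c h : locint h -> locint (fun x => c * h x).
Proof.
move=> lh; apply: locintP => [|K cK KO].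
  by apply: measurable_funM => //; exact: locint_measurable.
exact: (integrableZl (compact_rV_measurable cK) c (locint_compact lh cK KO)).
Qed.

Lemma locint_coordM i h : locint h -> locint (fun x => x ord0 i * h x).
Proof.
move=> lh; have mX D : measurable_fun D (fun x : V => x ord0 i).
  by under eq_fun do rewrite -pevX; exact: measurable_pev.
apply: locintP => [|K cK KO].
  by apply: measurable_funM => //; exact: locint_measurable.
have ih := locint_compact lh cK KO; have mK := compact_rV_measurable cK.
apply: (@le_integrable _ _ _ _ _ mK _ (EFin \o h)) => //.
  apply/measurable_EFinP; apply: measurable_funM => //.
  by apply/measurable_EFinP; exact: measurable_int ih.
move=> x Kx /=; rewrite lee_fin normrM ler_piMl//; apply: coord_le1.
exact/open_unit_ball_sub/KO.
Qed.

Lemma test_Ointg h phi : locint h -> test_function phi -> Ointg (fun x => h x * phi x).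
Proof.
move=> lh tphi; have [K [cK KO K0]] := test_support tphi.
have cphi := test_continuous tphi; have [M M0 hM] := compact_bounded_fun cK cphi.
have mK := compact_rV_measurable cK.
have ih := locint_compact lh cK KO.
have : (lebesgue_rV d).-integrable K (EFin \o (fun x => h x * phi x)).
  apply: (@le_integrable _ _ _ _ _ mK _ (fun x => M%:E * (h x)%:E)%E).
  - apply/measurable_EFinP; apply: measurable_funM.
      by apply/measurable_EFinP; exact: measurable_int ih.
    by apply: measurable_funTS; exact: continuous_rV_measurable.
  - move=> x Kx /=; rewrite lee_fin !normrM mulrC ler_wpM2r//.
    by rewrite (le_trans (hM x Kx))// ler_norm.
  - exact: integrableZl.
move=> /(integrable_mkcond _ mK) iK; apply/(integrable_mkcond _ mO).
apply: eq_integrable iK => // x _; rewrite !patchE /=.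
have [xK|xK] := boolP (x \in K).
  by rewrite mem_set//; apply: KO; exact: set_mem.
by case: ifP => //; rewrite K0 ?mulr0// => /mem_set; exact/negP.
Qed.

(** Weak derivatives for all sequences of at most k indices. Sequences, unlike
    multi-indices, follow the nesting of wpartial; the sign (-1)^|s| is absorbed
    in g. *)
Definition weakly k h : Prop := locint h /\
  forall s, (size s <= k)%N -> exists2 g, locint g &
    forall phi, test_function phi ->
      Oint (fun x => h x * foldr partial phi s x) = Oint (fun x => g x * phi x).

Lemma weakly_locint k h : weakly k h -> locint h.
Proof. by case. Qed.

Lemma weaklyW k l h : (l <= k)%N -> weakly k h -> weakly l h.
Proof. by move=> lk [lh hk]; split => // s sl; apply: hk; exact: leq_trans lk. Qed.

Lemma weaklyD k g h : weakly k g -> weakly k h -> weakly k (fun x => g x + h x).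
Proof.
move=> [lg hg] [lh hh]; split=> [|s sk]; first exact: locintD.
have [G lG GE] := hg s sk; have [H lH HE] := hh s sk.
exists (fun x => G x + H x) => [|phi tphi]; first exact: locintD.
have tf := test_foldr s tphi.
rewrite (@eq_Oint _ _ _ (fun x => g x * foldr partial phi s x + h x * foldr partial phi s x)).
  rewrite OintD ?GE ?HE -?OintD//; try exact: test_Ointg.
  by apply: eq_Oint => x _; rewrite mulrDl.
by move=> x _; rewrite mulrDl.
Qed.

Lemma weaklyZ k c h : weakly k h -> weakly k (fun x => c * h x).
Proof.
move=> [lh hh]; split=> [|s sk]; first exact: locintZ.
have [H lH HE] := hh s sk.
exists (fun x => c * H x) => [|phi tphi]; first exact: locintZ.
have tf := test_foldr s tphi.
rewrite (@eq_Oint _ _ _ (fun x => c * (h x * foldr partial phi s x))).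
  rewrite OintZ ?HE -?OintZ//; try exact: test_Ointg.
  by apply: eq_Oint => x _; rewrite mulrA.
by move=> x _; rewrite mulrA.
Qed.

Lemma weaklyB k g h : weakly k g -> weakly k h -> weakly k (fun x => g x - h x).
Proof.
move=> wg wh; under eq_fun do rewrite -mulN1r.
by apply: weaklyD => //; exact: weaklyZ.
Qed.

Lemma weakly0 k : weakly k (cst 0).
Proof.
split=> [|s _]; first exact: locint0.
by exists (cst 0) => [|phi _]; [exact: locint0|apply: eq_Oint => x _; rewrite !mul0r].
Qed.

Lemma weakly_sum k (I : Type) (r : seq I) (Q : pred I) (F : I -> V -> R) :
  (forall l, Q l -> weakly k (F l)) -> weakly k (fun x => \sum_(l <- r | Q l) F l x).
Proof.
move=> h; elim: r => [|l r IH].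
  by under eq_fun do rewrite big_nil; exact: weakly0.
under eq_fun do rewrite big_cons.
case Ql : (Q l) => //; apply: weaklyD => //.
exact: h.
Qed.

Lemma mlen1 i : mlen (fun j => (j == i) : nat) = 1%N.
Proof. by rewrite /mlen (bigD1 i)//= eqxx big1 ?addn0// => j /negbTE ->. Qed.

Lemma weakly_wpartial k i h : weakly k.+1 h ->
  locint (wpartial i h) /\ forall phi, test_function phi ->
    Oint (fun x => wpartial i h x * phi x) = - Oint (fun x => h x * partial i phi x).
Proof.
move=> [lh hh]; have [g lg gE] := hh [:: i] isT.
have : is_weak_derivative (fun j => (j == i) : nat) h (wpartial i h).
  apply: (@xgetPex _ (cst 0) [set g | is_weak_derivative (fun j => (j == i) : nat) h g]).
  exists (fun x => -1 * g x); split => //; first exact: locintZ.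
  move=> phi tphi; rewrite partial_count; last by case: tphi.
  rewrite mlen1 expr1 -![\int[_]_(x in _) _]/(Oint _) -OintZ; last first.
    by apply: test_Ointg => //; exact: locintZ.
  rewrite -[LHS]/(Oint (fun x => h x * foldr partial phi [:: i] x)) gE//.
  by apply: eq_Oint => x _; ring.
move=> [_ lw hw]; split => // phi tphi; have := hw phi tphi.
rewrite partial_count; last by case: tphi.
by rewrite mlen1 expr1 -![\int[_]_(x in _) _]/(Oint _) => ->; rewrite mulN1r opprK.
Qed.

Lemma weaklyS_wpartial k i h : weakly k.+1 h -> weakly k (wpartial i h).
Proof.
move=> wh; have [lw hw] := weakly_wpartial i wh; split => // s sk.
have [_ /(_ (rcons [::] i ++ s))] := wh; rewrite /= => /(_ sk)[g lg gE].
exists (fun x => -1 * g x) => [|phi tphi]; first exact: locintZ.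
rewrite hw; last exact: test_foldr.
rewrite gE// -OintN; last exact: test_Ointg.
by apply: eq_Oint => x _; ring.
Qed.

(** The product rule for x_i phi on the test functions, by induction on the number of
    derivatives *)
Lemma weakly_coordM k i h : weakly k h -> weakly k (fun x => x ord0 i * h x).
Proof.
move=> wh; split; first exact/locint_coordM/(weakly_locint wh).
move=> s; elim: s k h wh => [|j s IH] k h wh sk.
  by exists (fun x => x ord0 i * h x) => //; exact/locint_coordM/(weakly_locint wh).
case: k wh sk => // k wh sk; have lh := weakly_locint wh.
have [lw hw] := weakly_wpartial j wh.
have [G1 lG1 E1] := IH k _ (weaklyS_wpartial j wh) sk.
have [_ /(_ s (leqW sk))[G2 lG2 E2]] := wh.
exists (fun x => -1 * G1 x + (- (i == j)%:R) * G2 x) => [|phi tphi].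
  by apply: locintD; exact: locintZ.
have tps := test_foldr s tphi; set psi := foldr partial phi s in tps E1 E2 *.
have txp := test_coordM i tps.
rewrite (@eq_Oint _ _ _ (fun x => h x * partial j (fun y => y ord0 i * psi y) x
    - (i == j)%:R * (h x * psi x))); last first.
  move=> x _; rewrite /= -/psi partial_coordM; first by ring.
  by case: tps => sm _; exact: (sm [::]).
have i1 := test_Ointg lh (test_partial j txp); have i2 := test_Ointg lh tps.
rewrite OintB//; last exact: OintgZ.
rewrite OintZ// E2//.
have -> : Oint (fun x => h x * partial j (fun y => y ord0 i * psi y) x) =
    - Oint (fun x => G1 x * phi x).
  rewrite -E1// -[LHS]opprK -hw//; congr (- _); apply: eq_Oint => x _.
  by rewrite -/psi; ring.
have i3 := test_Ointg lG1 tphi; have i4 := test_Ointg lG2 tphi.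
rewrite -OintN// -OintZ// -OintB//; [|exact: OintgN|exact: OintgZ].
by apply: eq_Oint => x _; ring.
Qed.

Lemma sobolev_weakly k mu f : sobolev k mu f -> weakly k f.
Proof.
move=> [_ hf]; split.
  have [|g [lf _ _] _] := hf (fun=> 0%N); last exact: lf.
  by rewrite /mlen big1.
move=> s sk; have [|g [lf lg hg] _] := hf (fun i => count_mem i s).
  by rewrite mlen_count.
exists (fun x => (-1) ^+ size s * g x) => [|phi tphi]; first exact: locintZ.
have := hg phi tphi; rewrite mpartial_count; last by case: tphi.
rewrite -![\int[_]_(x in _) _]/(Oint _) mlen_count => ->.
rewrite -OintZ; last exact: test_Ointg.
by apply: eq_Oint => x _; rewrite mulrA.
Qed.

Lemma weakly_laplacian k h : weakly k.+2 h -> weakly k (laplacian h).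
Proof.
by move=> wh; apply: weakly_sum => i _; do 2!apply: weaklyS_wpartial.
Qed.

Lemma weakly_angular k i j h : weakly k.+1 h -> weakly k (angular i j h).
Proof.
by move=> wh; apply: weaklyB; apply: weakly_coordM; exact: weaklyS_wpartial.
Qed.

Lemma weakly_laplace_beltrami k h : weakly k.+2 h -> weakly k (laplace_beltrami h).
Proof.
move=> wh; apply: weakly_sum => i _; apply: weakly_sum => j _.
by do 2!apply: weakly_angular.
Qed.

Lemma weakly_iter_laplacian k l h : weakly (2 * l + k) h -> weakly k (iter l laplacian h).
Proof.
elim: l k => [|l IH] k wh; first by rewrite muln0 in wh.
by apply: weakly_laplacian; apply: IH; apply: weaklyW wh; rewrite mulnS; lia.
Qed.

Lemma weakly_iter_laplace_beltrami k l h : weakly (2 * l + k) h ->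
  weakly k (iter l laplace_beltrami h).
Proof.
elim: l k => [|l IH] k wh; first by rewrite muln0 in wh.
by apply: weakly_laplace_beltrami; apply: IH; apply: weaklyW wh; rewrite mulnS; lia.
Qed.

End WeakDerivatives.

(** * Weak derivatives paired with weighted polynomials *)

Section Adjoints.
Context {R : realType} {d : nat}.
Local Notation P := (mpoly.mpoly d R).
Local Notation C c := (mpoly.mpolyC d c).
Local Notation V := 'rV[R]_d.
Local Notation O := (open_unit_ball : set 'rV[R]_d).
Implicit Types (a e : R) (i j : 'I_d) (x : V) (f g h phi : V -> R)
  (k : nat) (L : seq (P * {poly R})) (p q : P).

Lemma wpartial_cutsum k i h e a L : weakly k.+1 h -> 0 < e ->
  Oint (fun x => wpartial i h x * cutsum e (a + 1) L x) =
  - Oint (fun x => h x * cutsum e a (step a i L) x).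
Proof.
move=> wh e0; have [_ ->] := weakly_wpartial i wh; last exact: test_cutsum.
by rewrite partial_cutsum.
Qed.

Definition lapstep a L : seq (P * {poly R}) :=
  flatten [seq step a i (step (a + 1) i L) | i <- index_enum 'I_d].

Definition dlap a q : P := \sum_(i < d) dq a i (dq (a + 1) i q).

Lemma head_flatten (I : Type) (r : seq I) (F : I -> seq (P * {poly R})) :
  head (flatten [seq F l | l <- r]) = \sum_(l <- r) head (F l).
Proof.
elim: r => [|i r IH] /=; first by rewrite big_nil /head big_nil.
by rewrite head_cat IH big_cons.
Qed.

Lemma cutsum_flatten e a (I : Type) (r : seq I) (F : I -> seq (P * {poly R})) x :
  cutsum e a (flatten [seq F l | l <- r]) x = \sum_(l <- r) cutsum e a (F l) x.
Proof.
elim: r => [|i r IH] /=; first by rewrite big_nil cutsum_nil.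
by rewrite cutsum_cat IH big_cons.
Qed.

Lemma head_lapstep a L : head (lapstep a L) = dlap a (head L).
Proof. by rewrite /lapstep head_flatten; apply: eq_bigr => i _; rewrite !head_step. Qed.

Lemma laplacian_cutsum k h e a L : weakly k.+2 h -> 0 < e ->
  Oint (fun x => laplacian h x * cutsum e (a + 2) L x) =
  Oint (fun x => h x * cutsum e a (lapstep a L) x).
Proof.
move=> wh e0; have tc b M : test_function (cutsum e b M) by exact: test_cutsum.
have lh := weakly_locint wh.
have lhi i : locally_integrable_ball (wpartial i (wpartial i h)).
  by apply: (@weakly_locint _ _ k); do 2!apply: weaklyS_wpartial.
transitivity (\sum_(i < d) Oint (fun x => wpartial i (wpartial i h) x * cutsum e (a + 2) L x)).
  rewrite -Oint_sum => [|i]; last exact: test_Ointg.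
  by apply: eq_Oint => x _; rewrite /laplacian mulr_suml.
transitivity (\sum_(i < d) Oint (fun x => h x * cutsum e a (step a i (step (a + 1) i L)) x)).
  apply: eq_bigr => i _; rewrite (_ : a + 2 = a + 1 + 1); last by ring.
  have w1 := weaklyS_wpartial i wh.
  by rewrite (wpartial_cutsum i _ _ w1 e0) (wpartial_cutsum i _ _ wh e0) opprK.
rewrite -Oint_sum => [|i]; last exact: test_Ointg.
by apply: eq_Oint => x _; rewrite /lapstep cutsum_flatten mulr_sumr.
Qed.

(** The adjoint of Delta^s from the weight w^(a+2s) to the weight w^a *)
Fixpoint dlapn s a q : P :=
  if s is s'.+1 then dlapn s' a (dlap (a + (2 * s')%:R) q) else q.

Lemma iter_laplacian_cutsum s k h a L : weakly (2 * s + k) h ->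
  exists2 L', head L' = dlapn s a (head L) & forall e, 0 < e ->
   Oint (fun x => iter s laplacian h x * cutsum e (a + (2 * s)%:R) L x) =
   Oint (fun x => h x * cutsum e a L' x).
Proof.
elim: s L k => [|s IH] L k wh; first by exists L => // e e0; rewrite muln0 addr0.
have wh' : weakly (2 * s + k.+2) h by apply: weaklyW wh; lia.
have [L' hL' EL'] := IH (lapstep (a + (2 * s)%:R) L) _ wh'.
exists L' => [|e e0]; first by rewrite hL' head_lapstep.
rewrite -EL'// -(laplacian_cutsum _ _ (weakly_iter_laplacian wh') e0).
by apply: eq_Oint => x _; congr (_ * cutsum _ _ _ _); rewrite mulnS natrD; ring.
Qed.

Lemma angular_cutsum_adjoint k i j h e a L : weakly k.+1 h -> 0 < e -> i != j ->
  Oint (fun x => angular i j h x * cutsum e a L x) =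
  - Oint (fun x => h x * cutsum e a (langular i j L) x).
Proof.
move=> wh e0 ij; have lh := weakly_locint wh.
have tc M : test_function (cutsum e a M) by exact: test_cutsum.
have xw l m : Oint (fun x => (x ord0 l * wpartial m h x) * cutsum e a L x) =
    - Oint (fun x => h x * partial m (cutsum e a (lmul (pX l) L)) x).
  have [_ <-//] := weakly_wpartial m wh; apply: eq_Oint => x _.
  by rewrite cutsum_lmul pevX; ring.
have lw m := weakly_locint (weaklyS_wpartial m wh).
transitivity (Oint (fun x => (x ord0 i * wpartial j h x) * cutsum e a L x) -
   Oint (fun x => (x ord0 j * wpartial i h x) * cutsum e a L x)).
  rewrite -OintB; try (apply: test_Ointg => //; exact: locint_coordM).
  by apply: eq_Oint => x _; rewrite /angular mulrBl.
rewrite !xw opprK addrC -opprB; congr (- _).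
rewrite -OintB; try (apply: test_Ointg => //; exact: test_partial).
apply: eq_Oint => x _; rewrite -mulrBr -angular_cutsum//; congr (_ * _).
have lE l : cutsum e a (lmul (pX l) L) = fun y => y ord0 l * cutsum e a L y.
  by apply/funext => y; rewrite cutsum_lmul pevX.
rewrite !lE (partial_coordM_neq _ ij); last exact: differentiable_cutsum.
by rewrite partial_coordM_neq 1?eq_sym//; exact: differentiable_cutsum.
Qed.

Definition llb L : seq (P * {poly R}) :=
  flatten [seq flatten [seq langular i j (langular i j L) | j : 'I_d <- index_enum 'I_d & (i < j)%N]
     | i : 'I_d <- index_enum 'I_d].

Lemma head_llb L : head (llb L) = lb (head L).
Proof.
rewrite /llb head_flatten; apply: eq_bigr => i _; rewrite head_flatten big_filter.
by apply: eq_bigr => j _; rewrite !head_langular.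
Qed.

Lemma laplace_beltrami_cutsum k h e a L : weakly k.+2 h -> 0 < e ->
  Oint (fun x => laplace_beltrami h x * cutsum e a L x) =
  Oint (fun x => h x * cutsum e a (llb L) x).
Proof.
move=> wh e0; have tc b M : test_function (cutsum e b M) by exact: test_cutsum.
have lh := weakly_locint wh.
have wij i j : weakly k (angular i j (angular i j h)) by do 2!apply: weakly_angular.
pose r i := [seq j : 'I_d <- index_enum 'I_d | (i < j)%N].
transitivity (\sum_(i < d) \sum_(j <- r i)
    Oint (fun x => angular i j (angular i j h) x * cutsum e a L x)).
  under [RHS]eq_bigr => i _.
    rewrite -Oint_sum => [|j]; last exact: (test_Ointg (weakly_locint (wij i j))).
    over.
  rewrite -Oint_sum => [|i]; last first.
    by apply: Ointg_sum => j; exact: (test_Ointg (weakly_locint (wij i j))).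
  apply: eq_Oint => x _; rewrite /laplace_beltrami mulr_suml.
  by apply: eq_bigr => i _; rewrite mulr_suml big_filter.
transitivity (\sum_(i < d) \sum_(j <- r i)
    Oint (fun x => h x * cutsum e a (langular i j (langular i j L)) x)).
  apply: eq_bigr => i _; rewrite !big_filter; apply: eq_bigr => j ij.
  have ij' : i != j by rewrite neq_ltn ij.
  by rewrite (angular_cutsum_adjoint a _ (weakly_angular i j wh) e0 ij')
    (angular_cutsum_adjoint a _ wh e0 ij') opprK.
under eq_bigr => i _.
  rewrite -Oint_sum => [|j]; last exact: test_Ointg.
  over.
rewrite -Oint_sum => [|i]; last by apply: Ointg_sum => j; exact: test_Ointg.
apply: eq_Oint => x _; rewrite /llb cutsum_flatten mulr_sumr; apply: eq_bigr => i _.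
by rewrite cutsum_flatten mulr_sumr.
Qed.

Lemma iter_laplace_beltrami_cutsum s k h a L : weakly (2 * s + k) h ->
  exists2 L', head L' = iter s lb (head L) & forall e, 0 < e ->
   Oint (fun x => iter s laplace_beltrami h x * cutsum e a L x) =
   Oint (fun x => h x * cutsum e a L' x).
Proof.
elim: s L k => [|s IH] L k wh; first by exists L.
have wh' : weakly (2 * s + k.+2) h by apply: weaklyW wh; lia.
have [L' hL' EL'] := IH (llb L) _ wh'.
exists L' => [|e e0]; first by rewrite hL' head_llb -iterSr.
by rewrite -EL'// -(laplace_beltrami_cutsum _ _ (weakly_iter_laplace_beltrami wh') e0).
Qed.

Lemma head1 q : head [:: (q, 1)] = q.
Proof. by rewrite /head big_cons big_nil addr0 /= hornerC mpoly.mpolyC1 mul1r. Qed.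

Lemma sqint_Ointg a f : -1 < a -> measurable_fun O f -> sqint a f ->
  Ointg (fun x => f x * weight a x).
Proof.
move=> a1 mf iff; have := sqintM mf (measurable_pev 1 (D := O)) iff (sqint_pev 1 a1).
by apply: eq_Ointg => x _; rewrite pev1 mulr1.
Qed.

Lemma cutsum_wpair_cvg a f L : -1 < a -> measurable_fun O f -> sqint a f ->
  Oint (fun x => f x * cutsum n.+1%:R^-1 a L x) @[n --> \oo] --> wpair a f (head L).
Proof.
move=> a1 mf iff.
rewrite (_ : wpair a f (head L) = Oint (fun x => f x * (weight a x * pev (head L) x))).
  by apply: Oint_cutsum_cvg => //; exact: sqint_Ointg.
by apply: eq_Oint => x _; ring.
Qed.

(** For a cut off weighted polynomial the identity is the definition of weak
    derivatives. Square integrability of both sides allows the cutoff to be removed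
    by dominated convergence. *)
Lemma wpartial_laplacian_adjoint s mu f i q : -1 < mu -> weakly (2 * s + 1) f ->
  measurable_fun O f -> sqint mu f ->
  sqint (mu + (2 * s + 1)%:R) (wpartial i (iter s laplacian f)) ->
  wpair (mu + (2 * s + 1)%:R) (wpartial i (iter s laplacian f)) q =
  - wpair mu f (dlapn s mu (dq (mu + (2 * s)%:R) i q)).
Proof.
move=> mu1 wf mf if2 iF; set F := wpartial _ _ in iF *.
have wl := weakly_iter_laplacian wf.
have mF : measurable_fun O F.
  apply: measurable_unit_open; apply: locint_measurable.
  exact: weakly_locint (weaklyS_wpartial i wl).
have b1 : -1 < mu + (2 * s + 1)%:R by rewrite ltr_wpDr.
have := @cutsum_wpair_cvg _ F [:: (q, 1)] b1 mF iF; rewrite head1.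
have [L' hL' EL'] := iter_laplacian_cutsum mu (step (mu + (2 * s)%:R) i [:: (q, 1)]) wf.
rewrite head_step head1 in hL'.
under eq_fun => n.
  rewrite natrD addrA (wpartial_cutsum i _ _ wl); last by rewrite invr_gt0.
  rewrite EL' ?invr_gt0//; over.
have /cvgN := @cutsum_wpair_cvg _ f L' mu1 mf if2; rewrite hL' => c1 c2.
by rewrite -(cvg_lim (@Rhausdorff R) c2); exact: (cvg_lim (@Rhausdorff R) c1).
Qed.

Lemma angular_beltrami_adjoint s mu f i j q : -1 < mu -> i != j ->
  weakly (2 * s + 1) f -> measurable_fun O f -> sqint mu f ->
  sqint mu (angular i j (iter s laplace_beltrami f)) ->
  wpair mu (angular i j (iter s laplace_beltrami f)) q =
  - wpair mu f (iter s lb (ang i j q)).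
Proof.
move=> mu1 ij wf mf if2 iF; set F := angular _ _ _ in iF *.
have wl := weakly_iter_laplace_beltrami wf.
have mF : measurable_fun O F.
  apply: measurable_unit_open; apply: locint_measurable.
  exact: weakly_locint (weakly_angular i j wl).
have := @cutsum_wpair_cvg _ F [:: (q, 1)] mu1 mF iF; rewrite head1.
have [L' hL' EL'] := iter_laplace_beltrami_cutsum mu (langular i j [:: (q, 1)]) wf.
rewrite head_langular head1 in hL'.
under eq_fun => n.
  rewrite (angular_cutsum_adjoint mu _ wl _ ij); last by rewrite invr_gt0.
  rewrite EL' ?invr_gt0//; over.
have /cvgN := @cutsum_wpair_cvg _ f L' mu1 mf if2; rewrite hL' => c1 c2.
by rewrite -(cvg_lim (@Rhausdorff R) c2); exact: (cvg_lim (@Rhausdorff R) c1).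
Qed.

End Adjoints.

(** * Polynomial approximation of a step *)

Section StepPolynomials.
Context {R : realType}.
Implicit Types (x y : R) (n N : nat).

Lemma bernoulli_sub y N : 0 <= y <= 1 -> 1 - N%:R * y <= (1 - y) ^+ N.
Proof.
move=> /andP[y0 y1]; elim: N => [|N IH]; first by rewrite mul0r subr0 expr0.
rewrite exprS -natr1; apply: (@le_trans _ _ ((1 - y) * (1 - N%:R * y))).
  have : 0 <= N%:R * y * y by rewrite !mulr_ge0.
  lra.
by rewrite ler_wpM2l// subr_ge0.
Qed.

Lemma bernoulli_add y N : 0 <= y -> 1 + N%:R * y <= (1 + y) ^+ N.
Proof.
move=> y0; elim: N => [|N IH]; first by rewrite mul0r addr0 expr0.
rewrite exprS -natr1; apply: (@le_trans _ _ ((1 + y) * (1 + N%:R * y))).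
  have : 0 <= N%:R * y * y by rewrite !mulr_ge0.
  lra.
by rewrite ler_wpM2l// addr_ge0.
Qed.

Lemma cvg_natM_expr y : 0 <= y < 1 -> n%:R * y ^+ n @[n --> \oo] --> (0 : R).
Proof.
move=> /andP[y0 y1]; have [->|yn0] := eqVneq y 0.
  apply: cvg_near_cst; near=> n; rewrite expr0n gtn_eqF ?mulr0//.
  by near: n; exists 1%N.
have yp : 0 < y by rewrite lt_neqAle eq_sym yn0.
pose z := Num.sqrt y; have zz : z ^+ 2 = y by rewrite sqr_sqrtr.
have zp : 0 < z by rewrite sqrtr_gt0.
have z1 : z < 1 by rewrite -(@expr_lt1 _ 2) ?zz ?(ltW zp).
pose c := z^-1 - 1; have c0 : 0 < c by rewrite subr_gt0 invf_gt1.
have bd n : n%:R * z ^+ n <= c^-1.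
  have c1 : 1 + c = z^-1 by rewrite /c addrC subrK.
  have := @bernoulli_add c n (ltW c0); rewrite c1 exprVn => h.
  have zn : 0 < z ^+ n by rewrite exprn_gt0.
  have h1 : n%:R * c <= (z ^+ n)^-1 by apply: le_trans h; rewrite lerDr.
  rewrite -[leRHS]mul1r ler_pdivlMr// mulrAC.
  by rewrite -[leRHS](mulVf (lt0r_neq0 zn)) ler_wpM2r// ltW.
have cz : c^-1 * z ^+ n @[n --> \oo] --> (0 : R).
  rewrite -[X in _ --> X](mulr0 c^-1); apply: cvgM; first exact: cvg_cst.
  by apply: cvg_expr; rewrite ger0_norm// ltW.
apply: (squeeze_cvgr _ (cvg_cst 0) cz); near=> n.
rewrite mulr_ge0 ?exprn_ge0//= -zz -exprM mulnC exprM expr2 mulrA.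
by apply: ler_wpM2r; [exact: exprn_ge0 (ltW zp)|exact: bd].
Unshelve. all: by end_near. Qed.

(** For N = n 2^n, Bernoulli's inequality shows that (1 - x^n)^N tends to 1 when
    N x^n tends to 0, as for x < 1/2, and to 0 when N x^n tends to infinity, as
    for x >= 1/2. *)
Definition stepv n x : R := (1 - x ^+ n) ^+ (n * 2 ^ n).

Lemma stepv_bounds n x : 0 <= x <= 1 -> 0 <= stepv n x <= 1.
Proof.
move=> /andP[x0 x1]; have h0 : 0 <= 1 - x ^+ n by rewrite subr_ge0 exprn_ile1.
by rewrite exprn_ge0//= exprn_ile1// gerBl exprn_ge0.
Qed.

Lemma stepv_cvg1 x : 0 <= x < 2^-1 -> stepv n x @[n --> \oo] --> (1 : R).
Proof.
move=> /andP[x0 x2]; have x1 : x <= 1 by lra.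
have y1 : 0 <= 2 * x < 1 by apply/andP; split; lra.
have c1 : 1 - n%:R * (2 * x) ^+ n @[n --> \oo] --> (1 : R).
  rewrite -[X in _ --> X]subr0; apply: cvgB; first exact: cvg_cst.
  exact: cvg_natM_expr.
apply: (squeeze_cvgr _ c1 (cvg_cst (1 : R))); near=> n.
have /andP[_ ->] : 0 <= stepv n x <= 1 by apply: stepv_bounds; rewrite x0.
rewrite andbT; apply: le_trans (@bernoulli_sub (x ^+ n) (n * 2 ^ n) _); last first.
  by rewrite exprn_ge0//= exprn_ile1.
by rewrite natrM natrX exprMn mulrA.
Unshelve. all: by end_near. Qed.

Lemma stepv_cvg0 x : 2^-1 <= x <= 1 -> stepv n x @[n --> \oo] --> (0 : R).
Proof.
move=> /andP[x2 x1]; have x0 : 0 <= x by lra.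
have cz : n.+1%:R^-1 @[n --> \oo] --> (0 : R).
  by have := @cvg_harmonic R.
apply: (squeeze_cvgr _ (cvg_cst 0) cz); near=> n.
have xn1 : x ^+ n <= 1 by rewrite exprn_ile1.
have /andP[-> _] /= : 0 <= stepv n x <= 1 by apply: stepv_bounds; rewrite x0.
set N := (n * 2 ^ n)%N; have xn0 : 0 <= x ^+ n by exact: exprn_ge0.
have h1 : n.+1%:R <= (1 + x ^+ n) ^+ N.
  apply: le_trans (@bernoulli_add (x ^+ n) N xn0).
  rewrite -natr1 addrC lerD2l /N natrM natrX -mulrA -exprMn ler_peMr//.
  by apply: exprn_ege1; lra.
have h2 : (1 - x ^+ n) ^+ N * (1 + x ^+ n) ^+ N <= 1.
  rewrite -exprMn -subr_sqr expr1n; apply: exprn_ile1.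
    by rewrite subr_ge0 exprn_ile1.
  by rewrite gerBl sqr_ge0.
rewrite -[leRHS]mul1r ler_pdivlMr//; apply: le_trans h2.
by rewrite ler_wpM2l// exprn_ge0// subr_ge0.
Unshelve. all: by end_near. Qed.

End StepPolynomials.

(** * Density of the polynomials *)

Import HBNNSimple.

Section Density.
Context {R : realType} {d : nat}.
Local Notation P := (mpoly.mpoly d R).
Local Notation C c := (mpoly.mpolyC d c).
Local Notation V := 'rV[R]_d.
Local Notation O := (open_unit_ball : set 'rV[R]_d).
Local Notation mO := (@measurable_open_unit_ball R d).
Implicit Types (i j : 'I_d) (x : V) (f g h : V -> R) (p q : P).
Variable a : R.
Hypothesis a1 : -1 < a.

Lemma sqnorm_triangle f g : measurable_fun O f -> measurable_fun O g ->
  sqint a f -> sqint a g ->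
  sqnorm a (fun x => f x + g x) <= 2 * sqnorm a f + 2 * sqnorm a g.
Proof.
move=> mf mg iF ig; rewrite -!OintZ// -OintD; try exact: OintgZ.
apply: le_Oint; [exact: sqintD|by apply: OintgD; exact: OintgZ|move=> x Ox].
rewrite !mulrA -mulrDl ler_wpM2r ?weight_ge0//.
have := sqr_ge0 (f x - g x); nra.
Qed.

Lemma eq_sqnorm f g : (forall x, O x -> f x = g x) -> sqnorm a f = sqnorm a g.
Proof. by move=> fg; apply: eq_Oint => x /fg ->. Qed.

Definition poly_closure f := [/\ measurable_fun O f, sqint a f &
  forall eta : R, 0 < eta -> exists p, sqnorm a (fun x => f x - pev p x) <= eta].

Lemma poly_closure_pev p : poly_closure (pev p).
Proof.
split; [exact: measurable_pev|exact: sqint_pev|move=> eta eta0; exists p].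
rewrite (@eq_sqnorm _ (fun=> 0)) => [|x _]; last by rewrite subrr.
rewrite /sqnorm (@eq_Oint _ _ _ (fun=> 0)) ?Oint0 ?ltW// => x _.
by rewrite expr0n mul0r.
Qed.

Lemma poly_closure_closed f : measurable_fun O f -> sqint a f ->
  (forall eta : R, 0 < eta -> exists2 g, poly_closure g &
     sqnorm a (fun x => f x - g x) <= eta) -> poly_closure f.
Proof.
move=> mf iF h; split => // eta eta0.
have e4 : 0 < eta / 4 by rewrite divr_gt0.
have [g [mg ig gP] fg] := h _ e4; have [p gp] := gP _ e4; exists p.
rewrite (@eq_sqnorm _ (fun x => (f x - g x) + (g x - pev p x))) => [|x _]; last by ring.
apply: le_trans (sqnorm_triangle _ _ _ _) _; try exact: measurable_funB.
- by apply: measurable_funB => //; exact: measurable_pev.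
- exact: sqintB.
- by apply: sqintB => //; [exact: measurable_pev|exact: sqint_pev].
lra.
Qed.

Lemma poly_closureZ c f : poly_closure f -> poly_closure (fun x => c * f x).
Proof.
move=> [mf iF fP]; split => [||eta eta0]; first exact: measurable_funM.
  exact: sqintZ.
have c1 : 0 < c ^+ 2 + 1 by rewrite ltr_wpDl ?sqr_ge0.
have [p fp] := fP (eta / (c ^+ 2 + 1)) (divr_gt0 eta0 c1); exists (C c * p).
have -> : sqnorm a (fun x => c * f x - pev (C c * p) x) =
    c ^+ 2 * sqnorm a (fun x => f x - pev p x).
  rewrite -OintZ; last by apply: sqintB => //; [exact: measurable_pev|exact: sqint_pev].
  by apply: eq_Oint => x _; rewrite pevM pevC -mulrBr exprMn mulrA.
apply: le_trans (ler_wpM2l (sqr_ge0 c) fp) _.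
by rewrite mulrCA ger_pMr// ler_pdivrMr// mul1r lerDl.
Qed.

Lemma poly_closureD f g : poly_closure f -> poly_closure g ->
  poly_closure (fun x => f x + g x).
Proof.
move=> [mf iF fP] [mg ig gP]; split => [||eta eta0]; first exact: measurable_funD.
  exact: sqintD.
have e4 : 0 < eta / 4 by rewrite divr_gt0.
have [p fp] := fP _ e4; have [q gq] := gP _ e4; exists (p + q).
rewrite (@eq_sqnorm _ (fun x => (f x - pev p x) + (g x - pev q x))) => [|x _]; last first.
  by rewrite pevD; ring.
have mp r : measurable_fun O (pev r) by exact: measurable_pev.
apply: le_trans (sqnorm_triangle _ _ _ _) _; try exact: measurable_funB.
- by apply: sqintB => //; exact: sqint_pev.
- by apply: sqintB => //; exact: sqint_pev.
lra.
Qed.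

Lemma poly_closureB f g : poly_closure f -> poly_closure g ->
  poly_closure (fun x => f x - g x).
Proof.
move=> hf hg; have := poly_closureD hf (poly_closureZ (-1) hg).
by under eq_fun do rewrite mulN1r.
Qed.

Lemma poly_closure_sum (I : Type) (r : seq I) (F : I -> V -> R) :
  (forall k, poly_closure (F k)) -> poly_closure (fun x => \sum_(k <- r) F k x).
Proof.
move=> h; elim: r => [|k r IH].
  under eq_fun do rewrite big_nil.
  rewrite (_ : (fun _ => _) = pev 0); first exact: poly_closure_pev.
  by apply/funext => x; rewrite pev0.
by under eq_fun do rewrite big_cons; exact: poly_closureD.
Qed.

Lemma le_sqint f g : measurable_fun O f -> (forall x, O x -> `|f x| <= `|g x|) ->
  sqint a g -> sqint a f.
Proof.
move=> mf fg ig; apply: le_Ointg ig; first exact: measurable_sq_weight.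
move=> x Ox; rewrite normrM (ger0_norm (weight_ge0 a x)) ler_wpM2r ?weight_ge0//.
rewrite normrX -(real_normK (num_real (g x))).
by apply: lerXn2r; rewrite ?nnegrE// fg.
Qed.

Lemma poly_closure_lim (F : nat -> V -> R) f g : measurable_fun O f ->
  measurable_fun O g -> sqint a g ->
  (forall n, poly_closure (F n)) -> (forall n x, O x -> `|F n x| <= `|g x|) ->
  (forall x, O x -> F n x @[n --> \oo] --> f x) -> poly_closure f.
Proof.
move=> mf mg ig hF Fg Ff.
have mF n : measurable_fun O (F n) by have [] := hF n.
have fg x : O x -> `|f x| <= `|g x|.
  move=> Ox; have c : `|F n x| @[n --> \oo] --> `|f x| by apply: cvg_norm; exact: Ff.
  by apply: (cvgr_to_le c); near=> n; exact: Fg.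
have iF : sqint a f by exact: le_sqint ig.
apply: poly_closure_closed => // eta eta0.
pose D n x := ((f x - F n x) ^+ 2 * weight a x)%:E.
have iG : Ointg (fun x => 4 * (g x ^+ 2 * weight a x)) by exact: OintgZ.
have mD n : measurable_fun O (D n).
  by apply/measurable_EFinP; apply: measurable_sq_weight; exact: measurable_funB.
have Dle x n : O x -> (f x - F n x) ^+ 2 * weight a x <= 4 * (g x ^+ 2 * weight a x).
  move=> Ox; rewrite mulrA ler_wpM2r ?weight_ge0//.
  have h1 := fg x Ox; have h2 := Fg n x Ox.
  rewrite -(real_normK (num_real (g x))) -(real_normK (num_real (f x - F n x))).
  have h3 : `|f x - F n x| <= 2 * `|g x|.
    by apply: le_trans (ler_normB _ _) _; lra.
  rewrite (_ : 4 * `|g x| ^+ 2 = (2 * `|g x|) ^+ 2); last by ring.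
  by apply: lerXn2r; rewrite ?nnegrE ?mulr_ge0.
have [||_ _ h] := dominated_convergence mO mD (measurable_cst 0%E) _ iG.
- apply: aeW => x Ox; apply: cvg_EFin; first by near=> n.
  rewrite -[X in _ --> X](mul0r (weight a x)); apply: cvgM; last exact: cvg_cst.
  rewrite -[X in _ --> X](expr0n R 2) expr2; under eq_fun do rewrite expr2.
  rewrite -(subrr (f x)); apply: cvgM; apply: cvgB => //; try exact: cvg_cst; exact: Ff.
- apply: aeW => x n Ox; rewrite lee_fin ger0_norm; first exact: Dle.
  by rewrite mulr_ge0 ?sqr_ge0 ?weight_ge0.
have iD n : Ointg (fun x => (f x - F n x) ^+ 2 * weight a x).
  by apply: sqintB => //; have [] := hF n.
rewrite integral0 in h.
have {}h : (fun n => sqnorm a (fun x => f x - F n x)) @ \oo --> (0 : R).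
  have -> : (fun n => sqnorm a (fun x => f x - F n x)) =
    fine \o (fun n => \int[lebesgue_rV d]_(x in O) D n x)%E by [].
  by apply: fine_cvg; exact: h.
move: h => /cvgrPdist_le/(_ _ eta0)[N _ hN].
exists (F N) => //; have := hN N (leqnn N).
by rewrite /= sub0r normrN ger0_norm// sqnorm_ge0.
Unshelve. all: by end_near. Qed.

Lemma poly_closure_pevM f q : poly_closure f -> poly_closure (fun x => f x * pev q x).
Proof.
move=> [mf iF fP]; have [M M0 hM] := pev_bounded q.
have mfq g : measurable_fun O g -> measurable_fun O (fun x => g x * pev q x).
  by move=> mg; apply: measurable_funM => //; exact: measurable_pev.
have bnd g x : O x -> `|g x * pev q x| <= `|M * g x|.
  by move=> Ox; rewrite !normrM mulrC (ger0_norm M0) ler_wpM2r// hM.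
split => [||eta eta0]; first exact: mfq.
  by apply: le_sqint (bnd f) _; [exact: mfq|exact: sqintZ].
have M1 : 0 < M ^+ 2 + 1 by rewrite ltr_wpDl ?sqr_ge0.
have [p fp] := fP (eta / (M ^+ 2 + 1)) (divr_gt0 eta0 M1); exists (p * q).
have ifp : sqint a (fun x => f x - pev p x).
  by apply: sqintB => //; [exact: measurable_pev|exact: sqint_pev].
have mfp : measurable_fun O (fun x => f x - pev p x).
  by apply: measurable_funB => //; exact: measurable_pev.
apply: (@le_trans _ _ (M ^+ 2 * sqnorm a (fun x => f x - pev p x))).
  rewrite -OintZ//; apply: le_Oint.
  - apply: (@eq_Ointg _ _ (fun x => ((f x - pev p x) * pev q x) ^+ 2 * weight a x)).
      by move=> x _; rewrite pevM -mulrBl.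
    by apply: le_sqint (bnd (fun x => f x - pev p x)) _; [exact: mfq|exact: sqintZ].
  - exact: OintgZ.
  move=> x Ox; rewrite pevM -mulrBl mulrA ler_wpM2r ?weight_ge0//.
  rewrite exprMn mulrC ler_wpM2r ?sqr_ge0//.
  by rewrite -(real_normK (num_real (pev q x))); apply: lerXn2r; rewrite ?nnegrE// hM.
apply: le_trans (ler_wpM2l (sqr_ge0 M) fp) _.
by rewrite mulrCA ger_pMr// ler_pdivrMr// mul1r lerDl.
Qed.

Lemma pev_exp p n x : pev (p ^+ n) x = pev p x ^+ n.
Proof. by elim: n => [|n IH]; rewrite ?expr0 ?pev1// !exprS pevM IH. Qed.

(** On the ball, an affine function X of x_i takes values in [0, 1] and is below 1/2
    exactly when x_i < b; compose it with stepv. *)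
Lemma poly_closure_halfspace f i (b : R) : poly_closure f ->
  poly_closure (fun x => f x * ((x ord0 i < b)%R : bool)%:R).
Proof.
move=> hf; have [mf iF _] := hf.
(* K is twice a bound of |x_i - b| on the ball. *)
pose K := 2 * (1 + `|b|); have K0 : 0 < K by rewrite mulr_gt0// ltr_wpDr.
pose X : P := C (2^-1 - b / K) + C K^-1 * pX i.
have XE x : pev X x = 2^-1 + (x ord0 i - b) / K.
  by rewrite pevD pevM !pevC pevX; ring.
have Xb x : O x -> 0 <= pev X x <= 1.
  move=> /open_unit_ball_sub xB; have xi := coord_le1 i xB; rewrite XE.
  have : `|(x ord0 i - b) / K| <= 2^-1.
    rewrite normrM [`|K^-1|]gtr0_norm ?invr_gt0// ler_pdivrMr//.
    by apply: le_trans (ler_normB _ _) _; rewrite /K; lra.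
  by rewrite ler_norml => /andP[h1 h2]; apply/andP; split; lra.
pose q n : P := (1 - X ^+ n) ^+ (n * 2 ^ n).
have qE n x : pev (q n) x = stepv n (pev X x).
  by rewrite pev_exp pevB pev1 pev_exp.
have mi : measurable_fun O (fun x : V => ((x ord0 i < b)%R : bool)%:R : R).
  rewrite (_ : (fun _ => _) = \1_[set x : V | x ord0 i < b]); last first.
    by apply/funext => x; rewrite indicE; congr (_ : bool)%:R; apply/idP/idP; rewrite inE.
  apply: measurable_indic.
  rewrite (_ : mkset _ = rV_coord i @^-1` `]-oo, b[%classic); last first.
    by apply/seteqP; split => x /=; rewrite in_itv.
  rewrite -[X in measurable X]setTI.
  exact: (measurable_rV_coord i measurableT (measurable_itv _)).
apply: (@poly_closure_lim (fun n x => f x * pev (q n) x) _ f) => //.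
- exact: measurable_funM.
- by move=> n; exact: poly_closure_pevM.
- move=> n x Ox; rewrite normrM ler_piMr// qE.
  by have /andP[h0 h1] := stepv_bounds n (Xb x Ox); rewrite ger0_norm.
move=> x Ox; apply: cvgM; first exact: cvg_cst.
under eq_fun do rewrite qE; have /andP[X0 X1] := Xb x Ox.
have [xb|xb] := ltP (x ord0 i) b.
  apply: stepv_cvg1; rewrite X0 XE /= gtrDl pmulr_llt0 ?invr_gt0//.
  by rewrite subr_lt0.
apply: stepv_cvg0; rewrite X1 andbT XE lerDl divr_ge0 ?subr_ge0//.
exact: ltW.
Qed.

(** Finite intersections of half-spaces x_i < b: a class stable under intersection
    that generates the Borel sets. *)
Definition corner (l : seq ('I_d * R)) : set V :=
  [set x | all (fun ib => x ord0 ib.1 < ib.2) l].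

Lemma poly_closure_corner l : poly_closure (\1_(corner l) : V -> R).
Proof.
elim: l => [|[i b] l IH].
  rewrite (_ : \1_(corner [::]) = pev 1); first exact: poly_closure_pev.
  by apply/funext => x; rewrite pev1 indicE mem_set.
rewrite (_ : \1_(corner _) = fun x => \1_(corner l) x * ((x ord0 i < b)%R : bool)%:R).
  exact: poly_closure_halfspace.
apply/funext => x; rewrite !indicE -natrM mulnb; congr (_%:R).
rewrite andbC; congr (nat_of_bool _); apply/idP/idP.
  by move=> /set_mem /andP[xb xl]; apply/andP; split=> //; exact/mem_set.
by move=> /andP[xb /set_mem xl]; apply/mem_set/andP.
Qed.

Lemma measurable_corner : @measurable _ V = <<s range corner >>.
Proof.
apply/seteqP; split; last first.
  apply: smallest_sub; first exact: sigma_algebra_measurable.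
  move=> _ [l _ <-]; elim: l => [|[i b] l IH].
    by rewrite (_ : corner [::] = setT)//; apply/seteqP; split.
  rewrite (_ : corner _ = (rV_coord i @^-1` `]-oo, b[%classic) `&` corner l); last first.
    by apply/seteqP; split => x /=; rewrite /corner /= in_itv => /andP.
  apply: measurableI => //; rewrite -[X in measurable X]setTI.
  exact: (measurable_rV_coord i measurableT (measurable_itv _)).
apply: smallest_sub; first exact: smallest_sigma_algebra.
rewrite -bigcup_seq; apply: bigcup_sub => i _ A [B mB <-].
have mc : measurable_fun setT (rV_coord i : g_sigma_algebraType (range corner) -> R).
  apply: (measurability _ (RGenInftyO.measurableE R)).
  move=> _ [_ [b ->] <-]; rewrite setTI; apply: sub_sigma_algebra.
  exists [:: (i, b)] => //; apply/seteqP; split => x; rewrite /corner /= in_itv/= andbT//.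
exact: mc.
Qed.

(** Dynkin's theorem, starting from the corners *)
Lemma poly_closure_indic (A : set V) : measurable A -> poly_closure (\1_A : V -> R).
Proof.
rewrite measurable_corner; move: A; apply: dynkin_induction measurable_corner _ _ _ _ _.
- move=> _ _ [l1 _ <-] [l2 _ <-]; exists (l1 ++ l2) => //.
  by apply/seteqP; split => x; rewrite /corner /= all_cat => /andP.
- by have := poly_closure_corner [::]; congr (poly_closure \1__); apply/seteqP; split.
- by move=> _ [l _ <-]; exact: poly_closure_corner.
- move=> A mA hA; have := poly_closureB (poly_closure_pev 1) hA.
  congr poly_closure; apply/funext => x; rewrite pev1 !indicE in_setC.
  by case: (x \in A); rewrite ?subrr ?subr0.
move=> F mF tF hF; pose S n (x : V) : R := \sum_(k < n) \1_(F k) x.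
have S1 x k n : F k x -> S n x = (k < n)%:R.
  move=> Fx; rewrite /S (eq_bigr (fun j : 'I_n => (j == k :> nat)%:R)).
    elim: n => [|n IH]; first by rewrite big_ord0.
    rewrite big_ord_recr /= IH ltnS -natrD.
    by congr (_%:R); case: ltngtP.
  move=> j _; rewrite indicE; congr (nat_of_bool _)%:R; apply/idP/eqP => [|->]; last by rewrite inE.
  by rewrite inE => Fj; apply: (tF j k) => //; exists x.
have S0 x n : ~ (\bigcup_k F k) x -> S n x = 0.
  move=> Fx; rewrite /S big1// => k _; rewrite indicE memNset//.
  by move=> Fk; apply: Fx; exists k.
apply: (@poly_closure_lim S _ (pev 1)).
- by apply: measurable_indic; exact: bigcup_measurable.
- exact: measurable_pev.
- exact: sqint_pev.
- by move=> n; apply: poly_closure_sum => k; exact: hF.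
- move=> n x _; rewrite pev1 normr1; have [[k _ Fk]|Fx] := pselect ((\bigcup_k F k) x).
    by rewrite (S1 x k n Fk); case: ltnP; rewrite ?normr1 ?normr0.
  by rewrite S0// normr0.
move=> x _; rewrite indicE; have [[k _ Fk]|Fx] := pselect ((\bigcup_k F k) x).
  rewrite mem_set; last by exists k.
  apply: cvg_near_cst; near=> n; rewrite (S1 x k n Fk).
  by rewrite (_ : (k < n)%N = true)//; near: n; exists k.+1.
by rewrite memNset//; apply: cvg_near_cst; near=> n; rewrite S0.
Unshelve. all: by end_near. Qed.

Lemma ge0_poly_closure f : measurable_fun O f -> sqint a f ->
  (forall x, O x -> 0 <= f x) -> poly_closure f.
Proof.
move=> mf iF f0; have mfE : measurable_fun O (EFin \o f) by exact/measurable_EFinP.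
pose G n : {nnsfun V >-> R} := nnsfun_approx mO mfE n.
pose F n (x : V) : R := G n x.
have F0 n x : 0 <= F n x by exact: fun_ge0.
have Ff x : O x -> F n x @[n --> \oo] --> f x.
  move=> Ox; have := @cvg_nnsfun_approx _ _ _ _ mO _ mfE _ x Ox.
  move=> h; have /fine_cvg := h (fun y Oy => f0 y Oy); exact.
apply: (@poly_closure_lim F _ f) => //.
- move=> n; rewrite (_ : F n = fun x => \sum_(r <- finmap.enum_fset (fset_set (range (G n))))
    r * \1_(G n @^-1` [set r]) x); last first.
    by apply/funext => x; rewrite /F fimfunE fsbig_finite.
  apply: poly_closure_sum => r; apply: poly_closureZ; apply: poly_closure_indic.
  exact: measurable_sfunP.
move=> n x Ox; rewrite ger0_norm// ger0_norm ?f0//.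
have nd : nondecreasing_seq (F ^~ x).
  by move=> m k mk; have /lefP := nd_nnsfun_approx mO mfE mk; exact.
have /(nondecreasing_cvgn_le nd)/(_ n) := cvgP _ (Ff x Ox).
by rewrite (cvg_lim _ (Ff x Ox)).
Qed.

(** The absolute value makes f a difference of two nonnegative functions, which are
    increasing limits of simple functions. *)
Theorem poly_dense f : measurable_fun O f -> sqint a f -> poly_closure f.
Proof.
move=> mf iF; have mn : measurable_fun O (fun x => `|f x|) by exact: measurableT_comp.
have iN : sqint a (fun x => `|f x|).
  by apply: eq_Ointg iF => x _; rewrite real_normK ?num_real.
have hN : poly_closure (fun x => `|f x|) by exact: ge0_poly_closure.
have hD : poly_closure (fun x => `|f x| + f x).
  apply: ge0_poly_closure; [exact: measurable_funD|exact: sqintD|move=> x _].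
  by rewrite -lerBlDr sub0r (le_trans (ler_norm _))// normrN.
by have := poly_closureB hD hN; under eq_fun do rewrite addrAC subrr add0r.
Qed.

End Density.

(** * Projections for a semidefinite form *)

Section Projections.
Context {R : realType} {d : nat}.
Local Notation P := (mpoly.mpoly d R).
Local Notation C c := (mpoly.mpolyC d c).
Local Notation msize p := (mpoly.msize p).
Implicit Types (a b c : R) (i j : 'I_d) (n N k e m : nat) (p q r u v : P) (l : seq P).

Record subspace (S : P -> Prop) : Prop := Subspace {
  subspace0 : S 0;
  subspaceD : forall p q, S p -> S q -> S (p + q);
  subspaceC : forall c p, S p -> S (C c * p) }.

(** The span as the intersection of the subspaces containing l: inclusions need no
    coefficients. *)
Definition inspan l p := forall S, subspace S -> {in l, forall q, S q} -> S p.

Lemma subspace_inspan l : subspace (inspan l).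
Proof.
split=> [S hS _|p q hp hq S hS lS|c p hp S hS lS]; first exact: subspace0.
  by apply: subspaceD => //; [exact: hp|exact: hq].
by apply: subspaceC => //; exact: hp.
Qed.

Lemma inspan_sub l v p : inspan l p -> inspan (v :: l) p.
Proof. by move=> h S hS lS; apply: h => // q ql; apply: lS; rewrite inE ql orbT. Qed.

Lemma msize_spanning n : exists2 l : seq P,
  {in l, forall p, (msize p <= n)%N} & forall p, (msize p <= n)%N -> inspan l p.
Proof.
exists [seq mpoly.mpolyX R (mpoly.bmnm m) | m : mpoly.bmultinom d n].
  by move=> p /mapP[m _ ->]; rewrite mpoly.msizeX; exact: mpoly.bmdeg.
move=> p pn S hS lS; rewrite (mpoly.mpolywE pn).
apply: (big_ind S) => [|q r|m _]; [exact: subspace0|exact: subspaceD|].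
rewrite -mpoly.mul_mpolyC; apply: subspaceC => //; apply: lS; apply/mapP.
by exists m; rewrite ?mem_enum.
Qed.

Variable ip : R -> P -> P -> R.
Hypothesis H : ball_form ip.
Variable a : R.
Hypothesis a1 : -1 < a.

(** The linear functionals that a semidefinite form can represent *)
Record form_functional (L : P -> R) : Prop := FormFunctional {
  functionalD : forall p q, L (p + q) = L p + L q;
  functionalC : forall c p, L (C c * p) = c * L p;
  functional_null : forall p, ip a p p = 0 -> L p = 0 }.

Lemma subspace_eq (L M : P -> R) : form_functional L -> form_functional M ->
  subspace (fun p => L p = M p).
Proof.
have F0 K : form_functional K -> K 0 = 0.
  by move=> hK; rewrite -[X in K X](mul0r 0) -mpoly.mpolyC0 (functionalC hK) mul0r.
move=> hL hM; split => [|p q Ep Eq|c p Ep]; first by rewrite !F0.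
  by rewrite (functionalD hL) (functionalD hM) Ep Eq.
by rewrite (functionalC hL) (functionalC hM) Ep.
Qed.

Lemma form_functional_ip v : form_functional (ip a v).
Proof.
split=> [p q|c p|p p0]; [exact: (formDr H)|exact: (formCr H)|].
by rewrite (formC H)//; exact: (form_null H).
Qed.

(** Gram-Schmidt. The new vector v is replaced by its component u orthogonal to the
    previous ones; if u is null it contributes nothing, as L u = 0. *)
Lemma form_representative l (L : P -> R) : form_functional L ->
  exists2 p, inspan l p & forall q, inspan l q -> ip a p q = L q.
Proof.
elim: l L => [|v l IH] L hL.
  exists 0 => [S hS _|q hq]; first exact: subspace0.
  by rewrite (hq _ (subspace_eq (form_functional_ip 0) hL)).
have [v0 sv0 hv0] := IH _ (form_functional_ip v).
have [p sp hp] := IH _ hL.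
pose u := v - v0; have vE : v = u + v0 by rewrite subrK.
have u0 q : inspan l q -> ip a u q = 0 by move=> hq; rewrite (formBl H)// hv0// subrr.
have su : inspan (v :: l) u.
  rewrite /u -mulN1r -mpoly.mpolyC1 -mpoly.mpolyCN => S hS lS.
  apply: subspaceD => //; first by apply: lS; rewrite mem_head.
  by apply: subspaceC => //; exact: (@inspan_sub l v _ sv0).
suff [p' sp' hp'] : exists2 p', inspan (v :: l) p' &
    ip a p' u = L u /\ (forall q, inspan l q -> ip a p' q = L q).
  exists p' => // q sq; apply: (sq _ (subspace_eq (form_functional_ip p') hL)) => w.
  rewrite inE => /predU1P[->|wl]; last by apply: hp'.2 => S _; exact.
  by rewrite vE (formDr H)// (functionalD hL) hp'.1 hp'.2.
have [uu|uu] := eqVneq (ip a u u) 0.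
  exists p; [exact: inspan_sub|split => //].
  by rewrite (formC H)// u0// (functional_null hL uu).
exists (p + C (L u / ip a u u) * u).
  have hS := subspace_inspan (v :: l); apply: (subspaceD hS).
    exact: inspan_sub.
  exact: (subspaceC hS).
split=> [|q sq]; rewrite (formDl H)// (formCl H)//.
  by rewrite (formC H)// u0// add0r divfK.
by rewrite (u0 q sq) mulr0 addr0 hp.
Qed.

(** In terms of degrees, the index n stands for degree at most n - 1. *)
Definition is_projection (L : P -> R) n p :=
  (msize p <= n)%N /\ forall q, (msize q <= n)%N -> ip a p q = L q.

Lemma projection_exists (L : P -> R) n : form_functional L -> exists p, is_projection L n p.
Proof.
move=> hL; have [l ln nl] := msize_spanning n.
have [p sp hp] := form_representative l hL; exists p; split.
  apply: (sp (fun q => msize q <= n)%N) => //; split => [|p1 p2|c p1]; [by rewrite mpoly.msize0|exact: msizeD_leq|].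
  exact: msizeCM_leq.
by move=> q qn; apply: hp; exact: nl.
Qed.

Record adjoint_pair b e (T S : P -> P) : Prop := AdjointPair {
  adjointD : {morph T : p q / p + q};
  adjointE : forall p q, ip b (T p) q = - ip a p (S q);
  msize_adjointl : forall k p, (msize p <= k)%N -> (msize (T p) <= k - e)%N;
  msize_adjointr : forall k q, (msize q <= k)%N -> (msize (S q) <= k + e)%N }.

Section Gap.
Variables (L : P -> R) (pr : nat -> P).
Hypothesis prP : forall n, is_projection L n (pr n).

Lemma orthodeg_increment k : orthodeg ip a k (pr k.+1 - pr k).
Proof.
have [s1 o1] := prP k.+1; have [s0 o0] := prP k; split.
  by apply: msizeB_leq => //; exact: leqW.
by move=> q qk; rewrite (formBl H)// o1 ?o0 ?subrr//; exact: leqW.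
Qed.

Lemma projection_gap_orthogonal n N q : (n <= N)%N -> (msize q <= n)%N ->
  ip a (pr N - pr n) q = 0.
Proof.
move=> nN qn; have [_ oN] := prP N; have [_ on] := prP n.
by rewrite (formBl H)// oN ?on ?subrr//; exact: leq_trans nN.
Qed.

Lemma projection_gap_form n N : (n <= N)%N ->
  ip a (pr N - pr n) (pr N - pr n) = ip a (pr N) (pr N) - ip a (pr n) (pr n).
Proof.
move=> nN; have [sn on] := prP n.
rewrite (formBr H)// [X in _ - X](projection_gap_orthogonal nN sn) subr0.
have -> : ip a (pr n) (pr n) = ip a (pr N) (pr n).
  by rewrite on// (proj2 (prP N))//; exact: leq_trans nN.
by rewrite (formBl H)// (formC H (pr n)).
Qed.

(** The images of the increments are mutually orthogonal: S (T g) has degree below k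
    when g has, hence is orthogonal to the k-th increment. *)
Lemma adjoint_gap b e T S n N : -1 < b -> adjoint_pair b e T S ->
  (e <= n <= N)%N ->
  ip b (T (pr N - pr n)) (T (pr N - pr n)) =
  \sum_(n <= k < N) ip b (T (pr k.+1 - pr k)) (T (pr k.+1 - pr k)).
Proof.
move=> b1 hT /andP[en nN]; pose G k := pr k.+1 - pr k.
have T0 : T 0 = 0 by apply: (@addIr _ (T 0)); rewrite -(adjointD hT) !add0r.
have Tsum m : T (\sum_(n <= k < m) G k) = \sum_(n <= k < m) T (G k).
  exact: (big_morph T (adjointD hT) T0).
have GE m : (n <= m)%N -> \sum_(n <= k < m) G k = pr m - pr n by exact: telescope_sumr.
have orth m : (n <= m)%N -> ip b (T (pr m - pr n)) (T (G m)) = 0.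
  move=> nm; rewrite (formC H)// (adjointE hT) (proj2 (orthodeg_increment m)) ?oppr0//.
  have sm : (msize (pr m - pr n) <= m)%N.
    by apply: msizeB_leq; [exact: (proj1 (prP m))|exact: leq_trans (proj1 (prP n)) nm].
  have := msize_adjointr hT (msize_adjointl hT sm).
  by rewrite subnK//; exact: leq_trans nm.
rewrite -GE// -/(G _); elim: N nN => [|m IH] nm.
  by rewrite !big_geq// T0 (form0l H).
move: nm; rewrite leq_eqVlt => /predU1P[<-|nm]; first by rewrite !big_geq// T0 (form0l H).
rewrite [in RHS]big_nat_recr//= -IH// big_nat_recr//= -/(G m).
have o := orth _ nm; rewrite -GE// in o; move: (G m) o => g o.
rewrite (adjointD hT) (formDl H)// !(formDr H)// o (formC H (T g))// o.
by rewrite addr0 add0r.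
Qed.

End Gap.
End Projections.

(** * Increments of the projections *)

Section AdjointPairs.
Context {R : realType} {d : nat}.
Local Notation P := (mpoly.mpoly d R).
Local Notation C c := (mpoly.mpolyC d c).
Local Notation msize p := (mpoly.msize p).
Implicit Types (a b c : R) (i j : 'I_d) (n N k e m s : nat) (p q r u v : P).
Variable ip : R -> P -> P -> R.
Hypothesis H : ball_form ip.

Lemma msize_iter_lap s k p : (msize p <= k)%N -> (msize (iter s lap p) <= k - 2 * s)%N.
Proof.
move=> pk; elim: s => [|s IH]; first by rewrite muln0 subn0.
by rewrite iterS; apply: leq_trans (msize_lap IH) _; lia.
Qed.

Lemma msize_iter_lb s k p : (msize p <= k)%N -> (msize (iter s lb p) <= k)%N.
Proof. by move=> pk; elim: s => // s IH; rewrite iterS; exact: msize_lb. Qed.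

Lemma msize_dlap a k q : (msize q <= k)%N -> (msize (dlap a q) <= k.+2)%N.
Proof. by move=> qk; apply: msize_sum_leq => i _; do 2!apply: msize_dq. Qed.

Lemma msize_dlapn s a k q : (msize q <= k)%N -> (msize (dlapn s a q) <= k + 2 * s)%N.
Proof.
elim: s k q => [|s IH] k q qk; first by rewrite muln0 addn0.
by apply: leq_trans (IH _ _ (msize_dlap _ qk)) _; lia.
Qed.

Lemma form_lap a p q : -1 < a -> ip (a + 2) (lap p) q = ip a p (dlap a q).
Proof.
move=> a1; have a2 : -1 < a + 1 by lra.
rewrite (_ : a + 2 = a + 1 + 1); last by ring.
rewrite /dlap (form_suml H); last lra; rewrite (form_sumr H)//; apply: eq_bigr => i _.
by rewrite (form_pD H)// (form_pD H)// opprK.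
Qed.

Lemma form_iter_lap s a p q : -1 < a ->
  ip (a + (2 * s)%:R) (iter s lap p) q = ip a p (dlapn s a q).
Proof.
move=> a1; elim: s q => [|s IH] q; first by rewrite muln0 addr0.
rewrite -IH iterS -form_lap; last by rewrite ltr_wpDr.
by congr (ip _ _ _); rewrite mulnS natrD; ring.
Qed.

Lemma form_iter_lb s a p q : -1 < a -> ip a (iter s lb p) q = ip a p (iter s lb q).
Proof.
move=> a1; elim: s q => // s IH q.
by rewrite iterS (form_lbC H)// IH -iterSr.
Qed.

Lemma adjoint_pair_pD_lap mu s i : -1 < mu ->
  adjoint_pair ip mu (mu + (2 * s + 1)%:R) (2 * s + 1)
    (fun p => pD i (iter s lap p)) (fun q => dlapn s mu (dq (mu + (2 * s)%:R) i q)).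
Proof.
move=> mu1; have b1 : -1 < mu + (2 * s)%:R by rewrite ltr_wpDr.
split=> [p q|p q|k p pk|k q qk].
- by elim: s p q {b1} => [|s IH] p q; rewrite ?pDD// !iterSr lapD IH.
- by rewrite natrD addrA (form_pD H)// form_iter_lap.
- by apply: leq_trans (msize_pD i (msize_iter_lap s pk)) _; lia.
by apply: leq_trans (msize_dlapn s mu (msize_dq _ i qk)) _; lia.
Qed.

Lemma iter_lbD s : {morph iter s (@lb R d) : p q / p + q}.
Proof. by elim: s => // s IH p q; rewrite !iterS IH lbD. Qed.

Lemma adjoint_pair_ang_lb mu s i j : -1 < mu -> i != j ->
  adjoint_pair ip mu mu 0 (fun p => ang i j (iter s lb p)) (fun q => iter s lb (ang i j q)).
Proof.
move=> mu1 ij; split=> [p q|p q|k p pk|k q qk].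
- by rewrite iter_lbD angD.
- by rewrite (form_ang H)// form_iter_lb.
- by rewrite subn0; apply: msize_ang; exact: msize_iter_lb.
by rewrite addn0; apply: msize_iter_lb; exact: msize_ang.
Qed.

Lemma adjoint_pair_id a : -1 < a -> adjoint_pair ip a a 0 id -%R.
Proof.
move=> a1; split=> [p q|p q|k p pk|k q qk] //.
- by rewrite (formC H _ (- q))// (formNl H)// opprK (formC H).
- by rewrite subn0.
by rewrite mpoly.msizeN addn0.
Qed.

(** The increments pr (k + 1) - pr k are orthogonal polynomials of degree k > n, so
    key_inequality applies to each; adjoint_gap sums the results. *)
Lemma projection_gap_energy mu s : (2 <= d)%N -> -1 < mu ->
  exists2 c : R, 0 < c & forall L pr n N, form_functional ip mu L ->
  (forall n, is_projection ip mu L n (pr n)) -> (2 * s + 1 <= n)%N -> (n <= N)%N ->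
  forall g, g = pr N.+1 - pr n.+1 ->
  n%:R ^+ (4 * s + 2) * ip mu g g <= c *
    (\sum_(i < d) ip (mu + (2 * s + 1)%:R) (pD i (iter s lap g)) (pD i (iter s lap g)) +
     \sum_(i < d) \sum_(j < d | (i < j)%N)
        ip mu (ang i j (iter s lb g)) (ang i j (iter s lb g))).
Proof.
move=> hd mu1; have [c c0 hc] := key_inequality H hd s mu1.
exists c => // L pr n N hL prP sn nN g ->.
have b1 : -1 < mu + (2 * s + 1)%:R by rewrite ltr_wpDr.
have sum0 := adjoint_gap H mu1 prP mu1 (adjoint_pair_id mu1) (n := n.+1) (N := N.+1) nN.
have sum1 i := adjoint_gap H mu1 prP b1 (adjoint_pair_pD_lap s i mu1) (n := n.+1) (N := N.+1).
have sum2 i j (ij : i != j) :=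
  adjoint_gap H mu1 prP mu1 (adjoint_pair_ang_lb s mu1 ij) (n := n.+1) (N := N.+1) nN.
rewrite /= in sum0; rewrite sum0.
under [X in c * (X + _)]eq_bigr => i _.
  rewrite sum1; last by rewrite leqW//= ltnS.
  over.
under [X in c * (_ + X)]eq_bigr => i _.
  under eq_bigr => j ij.
    rewrite sum2; last by rewrite neq_ltn ij.
    over.
  rewrite exchange_big /=; over.
rewrite [X in c * (X + _)]exchange_big [X in c * (_ + X)]exchange_big /=.
rewrite -big_split /= !mulr_sumr !big_nat; apply: ler_sum => k /andP[nk kN].
have := hc k _ _ (orthodeg_increment H mu1 prP k).
rewrite /grad /tang natrD addrA => h; apply: le_trans (h _); last by clear -sn nk; lia.
rewrite ler_wpM2r ?(form_ge0 H)//; apply: lerXn2r; rewrite ?nnegrE// ler_nat.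
exact: ltnW.
Qed.

End AdjointPairs.

Section ProjectionError.
Context {R : realType} {d : nat}.
Local Notation P := (mpoly.mpoly d R).
Local Notation C c := (mpoly.mpolyC d c).
Local Notation msize p := (mpoly.msize p).
Local Notation V := 'rV[R]_d.
Local Notation O := (open_unit_ball : set 'rV[R]_d).
Implicit Types (a b c : R) (i j : 'I_d) (n N k e m s : nat) (p q r u v : P).
Implicit Types (f g F : V -> R).

Lemma wpairD a f p q : -1 < a -> measurable_fun O f -> sqint a f ->
  wpair a f (p + q) = wpair a f p + wpair a f q.
Proof.
move=> a1 mf iF; rewrite -OintD; try
  by apply: sqintM => //; [exact: measurable_pev|exact: sqint_pev].
by apply: eq_Oint => x _; rewrite pevD; ring.
Qed.

Lemma wpairC a f c p : -1 < a -> measurable_fun O f -> sqint a f ->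
  wpair a f (C c * p) = c * wpair a f p.
Proof.
move=> a1 mf iF; rewrite -OintZ; last
  by apply: sqintM => //; [exact: measurable_pev|exact: sqint_pev].
by apply: eq_Oint => x _; rewrite pevM pevC; ring.
Qed.

Lemma wpairBl a f g p : -1 < a -> measurable_fun O f -> sqint a f ->
  measurable_fun O g -> sqint a g ->
  wpair a (fun x => f x - g x) p = wpair a f p - wpair a g p.
Proof.
move=> a1 mf iF mg ig; rewrite -OintB; try
  by apply: sqintM => //; [exact: measurable_pev|exact: sqint_pev].
by apply: eq_Oint => x _; ring.
Qed.

(** On a null polynomial p, wpair_ub for large multiples of p leaves only 0. *)
Lemma wpair_functional a f : -1 < a -> measurable_fun O f -> sqint a f ->
  form_functional ip a (wpair a f).
Proof.
move=> a1 mf iF; split=> [p q|c p|p p0]; [exact: wpairD|exact: wpairC|].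
apply/eqP/negPn/negP => L0; set L := wpair a f p in L0.
have := wpair_ub (C ((sqnorm a f + 1) / (2 * L)) * p) a1 mf iF.
rewrite wpairC// (formCl ip_ball_form)// (formCr ip_ball_form)// p0 !mulr0 addr0 -/L.
have -> : 2 * ((sqnorm a f + 1) / (2 * L) * L) = sqnorm a f + 1 by field.
by rewrite gerDl ler10.
Qed.

Lemma sqnormB_pev a f p : -1 < a -> measurable_fun O f -> sqint a f ->
  sqnorm a (fun x => f x - pev p x) = sqnorm a f - 2 * wpair a f p + ip a p p.
Proof.
move=> a1 mf iF; rewrite -sqnorm_pev.
have ifp : Ointg (fun x => f x * pev p x * weight a x).
  by apply: sqintM => //; [exact: measurable_pev|exact: sqint_pev].
rewrite -OintZ// -OintB//; last exact: OintgZ.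
rewrite -OintD; [|by apply: OintgB => //; exact: OintgZ|exact: sqint_pev].
by apply: eq_Oint => x _; ring.
Qed.

(** With g = pr N - pr n and u = T g, the square of u is - <g, S u>. As pr N
    represents f on S u, this is <F, u>, up to a term of degree so low that u is
    orthogonal to it; for the same reason r may be subtracted from F. Then
    wpair_ub gives the bound. *)
Lemma projection_gap_le mu b e (T S : P -> P) f F (pr : nat -> P) r n N :
  -1 < mu -> -1 < b -> measurable_fun O f -> sqint mu f ->
  measurable_fun O F -> sqint b F ->
  adjoint_pair ip mu b e T S ->
  (forall q, wpair b F q = - wpair mu f (S q)) ->
  (forall n, is_projection ip mu (wpair mu f) n (pr n)) ->
  (e <= n)%N -> (n <= N)%N -> (msize r <= n - e)%N ->
  ip b (T (pr N - pr n)) (T (pr N - pr n)) <= sqnorm b (fun x => F x - pev r x).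
Proof.
move=> mu1 b1 mf iF mF iFF hT hF prP en nN rn.
have B := @ip_ball_form R d; set g := pr N - pr n; set u := T g.
have [sN oN] := prP N; have [sn on] := prP n.
have sg : (msize g <= N)%N by apply: msizeB_leq => //; exact: leq_trans nN.
have eN : (e <= N)%N by exact: leq_trans nN.
have su : (msize (S u) <= N)%N.
  by have := msize_adjointr hT (msize_adjointl hT sg); rewrite subnK.
have u0 q : (msize q <= n - e)%N -> ip b u q = 0.
  move=> qn; rewrite (adjointE hT) (projection_gap_orthogonal B mu1 prP nN) ?oppr0//.
  by have := msize_adjointr hT qn; rewrite subnK.
have uF : ip b u u = wpair b F u.
  have z : ip mu (pr n) (S u) = 0.
    apply: oppr_inj; rewrite -(adjointE hT) oppr0 (formC B)// u0//.
    exact: (msize_adjointl hT).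
  by rewrite {1}/u (adjointE hT) (formBl B)// oN// hF z subr0.
have mr : measurable_fun O (pev r) by exact: measurable_pev.
have ir : sqint b (pev r) by exact: sqint_pev.
have uFr : wpair b (fun x => F x - pev r x) u = ip b u u.
  have z : wpair b (pev r) u = 0 by rewrite -[LHS]/(ip b r u) (formC B)// u0.
  by rewrite wpairBl// -uF z subr0.
have := @wpair_ub R d b (fun x => F x - pev r x) u b1 (measurable_funB mF mr) (sqintB mF mr iFF ir).
by rewrite uFr; lra.
Qed.

(** By Pythagoras the squared distance of f to pr (n + 1) is that to pr (N + 1) plus
    a gap bounded by K, and the distance to pr (N + 1) tends to 0 by density. *)
Lemma projection_error mu f (pr : nat -> P) (K : R) n :
  -1 < mu -> measurable_fun O f -> sqint mu f ->
  (forall n, is_projection ip mu (wpair mu f) n (pr n)) ->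
  (forall N, (n <= N)%N -> ip mu (pr N.+1 - pr n.+1) (pr N.+1 - pr n.+1) <= K) ->
  sqnorm mu (fun x => f x - pev (pr n.+1) x) <= K.
Proof.
move=> mu1 mf iF prP hK; have B := @ip_ball_form R d.
apply/ler_addgt0Pr => eta eta0.
have [_ _ /(_ eta eta0)[p hp]] := poly_dense mu1 mf iF.
have [N nN pN] : exists2 N, (n <= N)%N & (msize p <= N.+1)%N.
  by exists (maxn n (msize p)); [exact: leq_maxl|apply/leqW; exact: leq_maxr].
have prE m : wpair mu f (pr m) = ip mu (pr m) (pr m).
  by have [sm om] := prP m; rewrite om.
(* p has degree at most N, hence is not closer to f than the projection pr (N + 1). *)
have := hK N nN; rewrite (projection_gap_form B mu1 prP (n := n.+1) (N := N.+1))//.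
rewrite sqnormB_pev// prE; move: hp; rewrite sqnormB_pev//.
have [_ /(_ p pN) <-] := prP N.+1.
have := form_ge0 B (pr N.+1 - p) mu1.
rewrite (formBl B)// !(formBr B)// (formC B p)//; lra.
Qed.

End ProjectionError.

(** * Best approximation *)

Section BestApproximation.
Context {R : realType} {d : nat}.
Local Notation P := (mpoly.mpoly d R).
Local Notation msize p := (mpoly.msize p).
Local Notation V := 'rV[R]_d.
Local Notation O := (open_unit_ball : set 'rV[R]_d).
Local Notation B := (unit_ball : set 'rV[R]_d).
Implicit Types (a b c : R) (i j : 'I_d) (n N k m s : nat) (p q r : P).
Implicit Types (f g F : V -> R).

(** The estimate for squared integrals. The polynomial p, a projection of f, does not
    depend on the competitors r and t. *)
Lemma sqnorm_estimate mu s : (2 <= d)%N -> -1 < mu ->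
  exists2 c : R, 0 < c & forall f n, weakly (2 * s + 1) f -> sqint mu f ->
  (forall i, sqint (mu + (2 * s + 1)%:R) (wpartial i (iter s laplacian f))) ->
  (forall i j, (i < j)%N -> sqint mu (angular i j (iter s laplace_beltrami f))) ->
  (2 * s + 1 <= n)%N ->
  exists2 p, (msize p <= n.+1)%N & forall (r : 'I_d -> P) (t : 'I_d -> 'I_d -> P),
    (forall i, (msize (r i) <= (n - (2 * s + 1)).+1)%N) ->
    (forall i j, (i < j)%N -> (msize (t i j) <= n.+1)%N) ->
    n%:R ^+ (4 * s + 2) * sqnorm mu (fun x => f x - pev p x) <= c *
    (\sum_(i < d) sqnorm (mu + (2 * s + 1)%:R)
        (fun x => wpartial i (iter s laplacian f) x - pev (r i) x) +
     \sum_(i < d) \sum_(j < d | (i < j)%N) sqnorm mu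
        (fun x => angular i j (iter s laplace_beltrami f) x - pev (t i j) x)).
Proof.
move=> hd mu1; have B := @ip_ball_form R d.
have [c c0 hc] := projection_gap_energy B s hd mu1; exists c => //.
move=> f n wf iF iF1 iF2 sn; have mf := measurable_unit_open (locint_measurable (weakly_locint wf)).
have b1 : -1 < mu + (2 * s + 1)%:R by rewrite ltr_wpDr.
have hL := wpair_functional mu1 mf iF.
have /choice[pr prP] := fun m => projection_exists B mu1 m hL.
exists (pr n.+1); first exact: (proj1 (prP n.+1)).
move=> r t hr ht.
have n0 : 0 < n%:R ^+ (4 * s + 2) :> R by rewrite exprn_gt0// ltr0n; clear -sn; lia.
rewrite mulrC -ler_pdivlMr//; apply: (projection_error mu1 mf iF prP) => N nN.
rewrite ler_pdivlMr// mulrC; apply: le_trans (hc _ _ _ _ hL prP sn nN _ erefl) _.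
rewrite ler_wpM2l ?(ltW c0)//; apply: lerD; apply: ler_sum => i _.
  have wl := weakly_iter_laplacian wf.
  have mF := measurable_unit_open (locint_measurable (weakly_locint (weaklyS_wpartial i wl))).
  apply: (projection_gap_le mu1 b1 mf iF mF (iF1 i) (adjoint_pair_pD_lap B s i mu1) _ prP) => //.
  - by move=> q; exact: wpartial_laplacian_adjoint.
  - exact: leqW.
  - by rewrite subSn.
apply: ler_sum => j ij; have ij' : i != j by rewrite neq_ltn ij.
have wl := weakly_iter_laplace_beltrami wf.
have mF := measurable_unit_open (locint_measurable (weakly_locint (weakly_angular i j wl))).
apply: (projection_gap_le mu1 mu1 mf iF mF (iF2 i j ij) (adjoint_pair_ang_lb B s mu1 ij') _ prP) => //.
- by move=> q; exact: (angular_beltrami_adjoint q mu1 ij' wf mf iF (iF2 i j ij)).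
- by rewrite subn0; exact: ht.
Qed.

Lemma wnorm_ge0 a f : (0 <= wnorm a f)%E.
Proof. exact: poweR_ge0. Qed.

Lemma best_approx_ge0 m a f : (0 <= best_approx m a f)%E.
Proof. by apply: le_ereal_inf_tmp => _ [p _ <-]; exact: wnorm_ge0. Qed.

Hypothesis d0 : (0 < d)%N.

(** A finite error means that some f - p has finite norm, and polynomials are square
    integrable. *)
Lemma best_approx_sqint m a f : -1 < a -> measurable_fun B f ->
  best_approx m a f \is a fin_num -> sqint a f.
Proof.
move=> a1 mf; rewrite ge0_fin_numE ?best_approx_ge0// => /ereal_inf_lt[_ [p _ <-] foo].
have mB : measurable_fun B (fun x => f x - pev p x).
  by apply: measurable_funB => //; exact: measurable_pev.
have := wnorm_lty d0 a1 mB foo => h.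
have mO g : measurable_fun B g -> measurable_fun O g by exact: measurable_unit_open.
have := sqintD (mO _ mB) (measurable_pev p (D := O)) h (sqint_pev p a1).
by apply: eq_Ointg => x _; rewrite subrK.
Qed.

Lemma best_approx_adherent m a f (eps : R) : 0 < eps -> best_approx m a f \is a fin_num ->
  exists2 p, (msize p <= m.+1)%N &
    (wnorm a (fun x => (f x - pev p x)%R) <= (fine (best_approx m a f) + eps)%R%:E)%E.
Proof.
move=> e0 hfin; have [_ [p pm <-] h] := lb_ereal_inf_adherent e0 hfin.
by exists p => //; rewrite EFinD fineK//; exact: ltW.
Qed.

Lemma wnorm_pev a f p : -1 < a -> measurable_fun B f -> sqint a f ->
  wnorm a (fun x => f x - pev p x) =
  (Num.sqrt (@bconst R d a * sqnorm a (fun x => f x - pev p x)))%:E.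
Proof.
move=> a1 mf iF; apply: wnormE => //.
  by apply: measurable_funB => //; exact: measurable_pev.
apply: sqintB => //; [exact: measurable_unit_open|exact: measurable_pev|exact: sqint_pev].
Qed.

Lemma sqnorm_le_wnorm a f p (E : R) : -1 < a -> measurable_fun B f -> sqint a f -> 0 <= E ->
  (wnorm a (fun x => (f x - pev p x)%R) <= E%:E)%E ->
  sqnorm a (fun x => f x - pev p x) <= (@bconst R d a)^-1 * E ^+ 2.
Proof.
move=> a1 mf iF E0; rewrite wnorm_pev// lee_fin => h.
have b0 := @bconst_gt0 R d d0 a a1.
rewrite ler_pdivlMl// -[leLHS]sqr_sqrtr; last by rewrite mulr_ge0 ?(ltW b0)// sqnorm_ge0.
by apply: lerXn2r; rewrite ?nnegrE ?sqrtr_ge0.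
Qed.

End BestApproximation.

Section FiniteSums.
Context {R : realType}.

Lemma ler_sum_sqr (I : Type) (r : seq I) (Q : pred I) (F : I -> R) :
  (forall k, Q k -> 0 <= F k) ->
  \sum_(k <- r | Q k) F k ^+ 2 <= (\sum_(k <- r | Q k) F k) ^+ 2.
Proof.
move=> F0; elim: r => [|k r IH]; first by rewrite !big_nil expr0n.
rewrite !big_cons; case: ifP => // Qk; rewrite sqrrD -addrA lerD2l.
apply: le_trans IH _; rewrite lerDr mulrn_wge0// mulr_ge0 ?F0//.
exact: sumr_ge0.
Qed.

Lemma ler_sum_sqr2 n (u : 'I_n -> R) (v : 'I_n -> 'I_n -> R) (x : 'I_n -> R)
    (y : 'I_n -> 'I_n -> R) (A B : R) : 0 <= A -> 0 <= B ->
  (forall i, 0 <= x i) -> (forall i j, 0 <= y i j) ->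
  (forall i, u i <= A * x i ^+ 2) ->
  (forall i j : 'I_n, (i < j)%N -> v i j <= B * y i j ^+ 2) ->
  \sum_(i < n) u i + \sum_(i < n) \sum_(j < n | (i < j)%N) v i j <=
  (A + B) * (\sum_(i < n) x i + \sum_(i < n) \sum_(j < n | (i < j)%N) y i j) ^+ 2.
Proof.
move=> A0 B0 x0 y0 ux vy; set X := \sum_(i < n) x i.
set Y := \sum_(i < n) \sum_(j < n | (i < j)%N) y i j.
have X0 : 0 <= X by apply: sumr_ge0 => i _; exact: x0.
have Yi (i : 'I_n) : 0 <= \sum_(j < n | (i < j)%N) y i j by apply: sumr_ge0 => j _; exact: y0.
have Y0 : 0 <= Y by apply: sumr_ge0 => i _; exact: Yi.
have hu : \sum_(i < n) u i <= A * X ^+ 2.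
  apply: (@le_trans _ _ (A * \sum_(i < n) x i ^+ 2)).
    by rewrite mulr_sumr; apply: ler_sum => i _; exact: ux.
  by apply: ler_wpM2l => //; apply: ler_sum_sqr.
have hv : \sum_(i < n) \sum_(j < n | (i < j)%N) v i j <= B * Y ^+ 2.
  apply: (@le_trans _ _ (B * \sum_(i < n) \sum_(j < n | (i < j)%N) y i j ^+ 2)).
    rewrite mulr_sumr; apply: ler_sum => i _; rewrite mulr_sumr; apply: ler_sum => j.
    exact: vy.
  apply: ler_wpM2l => //; apply: (@le_trans _ _ (\sum_(i < n) (\sum_(j < n | (i < j)%N) y i j) ^+ 2)).
    by apply: ler_sum => i _; apply: ler_sum_sqr => j _; exact: y0.
  by apply: ler_sum_sqr => i _; exact: Yi.
have XY : 0 <= X * Y by exact: mulr_ge0.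
apply: le_trans (lerD hu hv) _; rewrite mulrDl; apply: lerD; apply: ler_wpM2l => //.
  have := sqr_ge0 Y; nra.
have := sqr_ge0 X; nra.
Qed.

(** If one of the E1 i, E2 i j is infinite, so is the right-hand side; otherwise let
    eps tend to 0. *)
Lemma le_sum_adherent n (z : \bar R) (k : R) (E1 : 'I_n -> \bar R)
    (E2 : 'I_n -> 'I_n -> \bar R) : 0 < k ->
  (forall i, (0 <= E1 i)%E) -> (forall i j, (0 <= E2 i j)%E) ->
  ((forall i, E1 i \is a fin_num) ->
   (forall i j : 'I_n, (i < j)%N -> E2 i j \is a fin_num) ->
   forall eps : R, 0 < eps ->
   (z <= (k * (\sum_(i < n) (fine (E1 i) + eps) +
      \sum_(i < n) \sum_(j < n | (i < j)%N) (fine (E2 i j) + eps)))%R%:E)%E) ->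
  (z <= k%:E * (\sum_(i < n) E1 i +
                \sum_(i < n) \sum_(j < n | (i < j)%N) E2 i j))%E.
Proof.
move=> k0 E10 E20 h.
set T1 := (\sum_(i < n) E1 i)%E.
set T2 := (\sum_(i < n) \sum_(j < n | (i < j)%N) E2 i j)%E.
have T10 : (0 <= T1)%E by apply: sume_ge0 => i _; exact: E10.
have T20 : (0 <= T2)%E by apply: sume_ge0 => i _; apply: sume_ge0 => j _; exact: E20.
have [fT|nT] := boolP (T1 + T2 \is a fin_num)%E; last first.
  suff -> : (T1 + T2 = +oo)%E by rewrite gt0_muley ?lte_fin// leey.
  by move: nT; rewrite ge0_fin_numE ?adde_ge0// -leNgt leye_eq => /eqP.
move: (fT); rewrite fin_numD => /andP[/sum_fin_numP f1 /sum_fin_numP f2].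
have fin1 i : E1 i \is a fin_num by apply: f1; rewrite ?mem_index_enum.
have fin2 (i j : 'I_n) : (i < j)%N -> E2 i j \is a fin_num.
  by move=> ij; have /sum_fin_numP := f2 i (mem_index_enum _) isT; apply; rewrite ?mem_index_enum.
(* N counts the errors, each of which has slack eps. *)
pose N : R := \sum_(i < n) 1 + \sum_(i < n) \sum_(j < n | (i < j)%N) 1.
have N0 : 0 <= N by rewrite addr_ge0//; apply: sumr_ge0 => // i _; exact: sumr_ge0.
have TE : (T1 + T2 = (\sum_(i < n) fine (E1 i) +
    \sum_(i < n) \sum_(j < n | (i < j)%N) fine (E2 i j))%R%:E)%E.
  rewrite EFinD -!sumEFin; congr (_ + _)%E.
    by apply: eq_bigr => i _; rewrite fineK.
  apply: eq_bigr => i _; rewrite -sumEFin; apply: eq_bigr => j ij.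
  by rewrite fineK// fin2.
rewrite TE -EFinM; apply/lee_addgt0Pr => eta eta0.
have kN : 0 < k * N + 1 by rewrite ltr_wpDl// mulr_ge0// ltW.
apply: le_trans (h fin1 fin2 (eta / (k * N + 1)) (divr_gt0 eta0 kN)) _.
set eps := eta / _; rewrite -EFinD lee_fin big_split /=.
under [X in _ + _ + X]eq_bigr do rewrite big_split /=.
rewrite big_split /= addrACA mulrDr lerD2l.
rewrite (_ : _ + _ = N * eps); last first.
  rewrite /N mulrDl mulr_suml; congr (_ + _); first by apply: eq_bigr => i _; rewrite mul1r.
  rewrite mulr_suml; apply: eq_bigr => i _; rewrite mulr_suml.
  by apply: eq_bigr => j _; rewrite mul1r.
rewrite /eps !mulrA ler_pdivrMr// [leLHS]mulrC ler_pM2l//.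
by rewrite lerDl.
Qed.

End FiniteSums.

Section Final.
Context {R : realType} {d : nat}.
Implicit Types (f : 'rV[R]_d -> R).

(** Near-minimizers for the errors on the right are the competitors of
    sqnorm_estimate; the constant K collects the normalizations b_mu and
    b_(mu+2s+1) of the two norms. *)
Lemma best_approx_estimate (mu : R) s (hd : (2 <= d)%N) (hmu : -1 < mu) :
  exists2 c : R, 0 < c & forall f n, sobolev (2 * s + 1) mu f -> (2 * s + 1 <= n)%N ->
  let E1 i := best_approx (n - (2 * s + 1)) (mu + (2 * s + 1)%:R)
                (wpartial i (iter s laplacian f)) in
  let E2 i j := best_approx n mu (angular i j (iter s laplace_beltrami f)) in
  (forall i, E1 i \is a fin_num) -> (forall i j : 'I_d, (i < j)%N -> E2 i j \is a fin_num) ->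
  forall eps : R, 0 < eps ->
  (best_approx n mu f <= (c / n%:R ^+ (2 * s + 1) *
    (\sum_(i < d) (fine (E1 i) + eps) +
     \sum_(i < d) \sum_(j < d | (i < j)%N) (fine (E2 i j) + eps)))%R%:E)%E.
Proof.
have d0 : (0 < d)%N by exact: ltnW.
have b1 : -1 < mu + (2 * s + 1)%:R by rewrite ltr_wpDr.
have [c c0 hc] := sqnorm_estimate s hd hmu.
set be1 := @bconst R d (mu + (2 * s + 1)%:R); have be10 : 0 < be1 by exact: bconst_gt0.
set be0 := @bconst R d mu; have be00 : 0 < be0 by exact: bconst_gt0.
pose K : R := be0 * (c * (be1^-1 + be0^-1)).
have K0 : 0 < K.
  apply: (mulr_gt0 be00); apply: (mulr_gt0 c0).
  by apply: addr_gt0; rewrite invr_gt0; [exact: be10|exact: be00].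
exists (Num.sqrt K); first by rewrite sqrtr_gt0.
move=> f n sf sn E1 E2 fin1 fin2 eps eps0.
have wf := sobolev_weakly sf; have mf := locint_measurable (weakly_locint wf).
have iF : sqint mu f by case: sf => -[_ foo] _; exact: wnorm_lty.
have mF1 i : measurable_fun unit_ball (wpartial i (iter s laplacian f)).
  exact: (locint_measurable (weakly_locint (weaklyS_wpartial i (weakly_iter_laplacian wf)))).
have mF2 i j : measurable_fun unit_ball (angular i j (iter s laplace_beltrami f)).
  exact: (locint_measurable (weakly_locint (weakly_angular i j (weakly_iter_laplace_beltrami wf)))).
have iF1 i := best_approx_sqint d0 b1 (mF1 i) (fin1 i).
have iF2 (i j : 'I_d) (ij : (i < j)%N) := best_approx_sqint d0 hmu (mF2 i j) (fin2 i j ij).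
have [p pn hp] := hc f n wf iF iF1 iF2 sn.
have ge1 i : 0 <= fine (E1 i) + eps.
  by rewrite addr_ge0 ?(ltW eps0)// fine_ge0// best_approx_ge0.
have ge2 i j : 0 <= fine (E2 i j) + eps.
  by rewrite addr_ge0 ?(ltW eps0)// fine_ge0// best_approx_ge0.
have /choice[r hr] : forall i, exists r, (mpoly.msize r <= (n - (2 * s + 1)).+1)%N /\
    sqnorm (mu + (2 * s + 1)%:R) (fun x => wpartial i (iter s laplacian f) x - pev r x) <=
    be1^-1 * (fine (E1 i) + eps) ^+ 2.
  move=> i; have [r rn h] := best_approx_adherent eps0 (fin1 i); exists r; split => //.
  exact: (sqnorm_le_wnorm d0 b1 (mF1 i) (iF1 i) (ge1 i) h).
have /choice[t ht] : forall ij : 'I_d * 'I_d, exists t, (ij.1 < ij.2)%N ->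
    (mpoly.msize t <= n.+1)%N /\
    sqnorm mu (fun x => angular ij.1 ij.2 (iter s laplace_beltrami f) x - pev t x) <=
    be0^-1 * (fine (E2 ij.1 ij.2) + eps) ^+ 2.
  move=> [i j] /=; have [ij|] := boolP (i < j)%N; last by exists 0.
  have [t tn h] := best_approx_adherent eps0 (fin2 i j ij); exists t => _; split => //.
  exact: (sqnorm_le_wnorm d0 hmu (mF2 i j) (iF2 i j ij) (ge2 i j) h).
have be1V : 0 <= be1^-1 by rewrite invr_ge0; exact: ltW be10.
have be0V : 0 <= be0^-1 by rewrite invr_ge0; exact: ltW be00.
pose x i := fine (E1 i) + eps; pose y i j := fine (E2 i j) + eps.
pose U := \sum_(i < d) x i + \sum_(i < d) \sum_(j < d | (i < j)%N) y i j.
change (best_approx n mu f <= (Num.sqrt K / n%:R ^+ (2 * s + 1) * U)%R%:E)%E.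
have U0 : 0 <= U.
  rewrite addr_ge0//; apply: sumr_ge0 => i _; first exact: ge1.
  by apply: sumr_ge0 => j _; exact: ge2.
have main := le_trans (hp r (fun i j => t (i, j)) (fun i => proj1 (hr i))
    (fun i j ij => proj1 (ht (i, j) ij)))
  (ler_wpM2l (ltW c0) (ler_sum_sqr2 be1V be0V
     ge1 ge2 (fun i => proj2 (hr i)) (fun i j ij => proj2 (ht (i, j) ij)))).
rewrite -/U in main.
apply: (@le_trans _ _ (wnorm mu (fun x => f x - pev p x))).
  by apply: ereal_inf_lbound; exists p.
rewrite wnorm_pev// lee_fin -/be0; set Q := sqnorm _ _.
have n0 : 0 < n%:R :> R by rewrite ltr0n; clear -sn; lia.
have k0 : 0 <= Num.sqrt K / n%:R ^+ (2 * s + 1) * U.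
  by apply: mulr_ge0 => //; rewrite divr_ge0 ?sqrtr_ge0// exprn_ge0// ltW.
rewrite -[leRHS]ger0_norm// -sqrtr_sqr ler_wsqrtr//.
rewrite exprMn exprMn sqr_sqrtr ?(ltW K0)// exprVn -exprM.
rewrite (_ : ((2 * s + 1) * 2)%N = (4 * s + 2)%N); last by clear; lia.
have nn0 : 0 < n%:R ^+ (4 * s + 2) :> R by rewrite exprn_gt0.
rewrite mulrAC ler_pdivlMr// -mulrA [Q * _]mulrC /K -!mulrA ler_pM2l//.
Qed.

End Final.

Theorem theorem1p2 (R : realType) (d : nat) (mu : R) (s : nat)
    (hd : (2 <= d)%N) (hmu : -1 < mu) :
  exists2 c : R, 0 < c &
    forall f : 'rV[R]_d -> R, sobolev (2 * s + 1) mu f ->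
    forall n : nat, (2 * s + 1 <= n)%N ->
      (best_approx n mu f <=
       (c / n%:R ^+ (2 * s + 1))%:E *
       (\sum_(i < d) best_approx (n - (2 * s + 1)) (mu + (2 * s + 1)%:R)
                       (wpartial i (iter s laplacian f)) +
        \sum_(i < d) \sum_(j < d | (i < j)%N)
           best_approx n mu (angular i j (iter s laplace_beltrami f))))%E.
Proof.
have [c c0 hc] := best_approx_estimate s hd hmu; exists c => // f sf n sn.
apply: le_sum_adherent => [|i|i j|fin1 fin2 eps eps0].
- by rewrite divr_gt0// exprn_gt0// ltr0n; clear -sn; lia.
- exact: best_approx_ge0.
- exact: best_approx_ge0.
exact: hc.
Qed.
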